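(* Let $C\subset\mathbb{P}^2$ be a rational curve with a proper parameterization $\mathbf f=(f_0:f_1:f_2)$, $f_u\in K[s,t]_n$, $n\ge 3$, and let $X_k\subset\mathbb{P}^k$ ($2\le k\le n-1$) be the schemes associated to it (defined in the context). Then each $X_k$ is either $0$-dimensional or empty. Moreover: (1) for every $k$ with $2\le k\le n-1$, $X_k$ is non-empty if and only if there is at least one singular point of $C$ of multiplicity $\ge k$; (2) every singular point $P$ of $C$ yields at least one point of $X_2$ (i.e. there is $R\in X_2$ such that the line $H_R$ is contracted to $P$ by $\pi$), and $\operatorname{length} X_2=\binom{n-1}{2}$ (in particular $X_2$ is never empty).
   Context: $K$ is an algebraically closed field of characteristic $0$, $\mathbb{P}^m=\mathbb{P}^m_K$, and $n\ge 3$. $C\subset\mathbb{P}^2$ is a plane rational curve given by $\mathbf f=(f_0:f_1:f_2):\mathbb{P}^1\to\mathbb{P}^2$ with $f_u=\sum_{j=0}^n a_{uj}s^{n-j}t^j\in K[s,t]_n$. The parameterization is proper: $\mathbf f$ is generically $1:1$ onto $C$ and $f_0,f_1,f_2$ have no common zeroes (so $\deg C=n$). For $2\le k\le n-1$, $M_k$ is the $(n-k+4)\times(n+1)$ matrix (columns numbered $0,\dots,n$) whose first $n-k+1$ rows are indexed by $i=0,\dots,n-k$, the $i$-th having entries $x_0,x_1,\dots,x_k$ in columns $i,i+1,\dots,i+k$ and $0$ elsewhere, and whose last three rows are $(a_{u0},a_{u1},\dots,a_{un})$, $u=0,1,2$. The scheme $X_k\subset\mathbb{P}^k$ (homogeneous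 coordinates $x_0,\dots,x_k$) is the one defined by the ideal of the $(n-k+3)$-minors of $M_k$. $\nu_n:\mathbb{P}^1\to\mathbb{P}^n$, $(s:t)\mapsto(s^n:s^{n-1}t:\dots:t^n)$, $C_n=\nu_n(\mathbb{P}^1)$. The projection $\pi:\mathbb{P}^n\dashrightarrow\mathbb{P}^2$ is $\pi(z_0:\dots:z_n)=(\sum_j a_{0j}z_j:\sum_j a_{1j}z_j:\sum_j a_{2j}z_j)$, with center $\Pi$ the common zero locus of these three linear forms; $\Pi\cap C_n=\emptyset$ and $\pi\circ\nu_n=\mathbf f$. A point $R=(a_0:\dots:a_k)\in\mathbb{P}^k$ corresponds to the binary form $G_R=\sum_i a_is^{k-i}t^i$ up to scalar, whose zeros give a degree $k$ divisor on $C_n\cong\mathbb{P}^1$; its linear span is the $k$-secant $(k-1)$-space $H_R\subset\mathbb{P}^n$, with equations $\sum_{i=0}^k a_iz_{i+j}=0$, $j=0,\dots,n-k$. We say $H_R$ is contracted to $P$ by $\pi$ if $\pi(H_R\setminus\Pi)=\{P\}$. *)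

(* Defs.v *)
From HB Require Import structures.
From mathcomp Require Import all_boot all_order all_algebra.
From mathcomp.multinomials Require Import mpoly.

Set Implicit Arguments.
Unset Strict Implicit.
Unset Printing Implicit Defensive.

Import GRing.Theory.
Local Open Scope ring_scope.

(* Mathematical Components + multinomials.
   A point of P^m is given by a nonzero row vector of homogeneous coordinates
   (v 0 : ... : v m), two such vectors being the same point when they are
   related by [same_pt].  Subsets of P^m are predicates on such vectors. *)

Section Projective.
Variables (K : fieldType) (m : nat).
Implicit Types (v w : 'rV[K]_m.+1) (X Y Z : 'rV[K]_m.+1 -> Prop).
Implicit Types (F G p : {mpoly K[m.+1]}).

Definition same_pt v w : Prop := exists2 c : K, c != 0 & v = c *: w.

Definition hval F v : K := F.@[fun i => v 0 i].

Definition ideal_gen (S : {mpoly K[m.+1]} -> Prop) p : Prop :=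
  exists r (c g : 'I_r -> {mpoly K[m.+1]}),
    (forall i, S (g i)) /\ p = \sum_(i < r) c i * g i.

Definition zeros (S : {mpoly K[m.+1]} -> Prop) v : Prop :=
  v != 0 /\ forall F, S F -> hval F v = 0.

Definition nonempty X : Prop := exists v, X v.

Definition included X Y : Prop := forall v, X v -> Y v.

Definition zariski_closed Z : Prop :=
  exists2 S : {mpoly K[m.+1]} -> Prop,
    (forall F, S F -> exists d, F \is d.-homog) & forall v, Z v <-> zeros S v.

Definition irreducible_closed Z : Prop :=
  [/\ zariski_closed Z, nonempty Z
    & forall A B, zariski_closed A -> zariski_closed B ->
        (forall v, Z v -> A v \/ B v) -> included Z A \/ included Z B].

(* Z_0 < Z_1 < ... < Z_d irreducible closed subsets of X *)
Definition has_chain X d : Prop :=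
  exists Z : nat -> 'rV[K]_m.+1 -> Prop,
    (forall i, (i <= d)%N -> irreducible_closed (Z i) /\ included (Z i) X) /\
    (forall i, (i < d)%N ->
       included (Z i) (Z i.+1) /\ ~ included (Z i.+1) (Z i)).

Definition has_dim X d : Prop := has_chain X d /\ ~ has_chain X d.+1.

(* dim_K K[x_0,...,x_m]/J = N *)
Definition quot_dim (J : {mpoly K[m.+1]} -> Prop) (N : nat) : Prop :=
  exists b : 'I_N -> {mpoly K[m.+1]},
    forall p, exists! c : 'rV[K]_N, J (p - \sum_(i < N) c 0 i *: b i).

Definition lin_form (l : 'rV[K]_m.+1) : {mpoly K[m.+1]} :=
  \sum_(i < m.+1) l 0 i *: 'X_i.

(* The subscheme X of P^m defined by the homogeneous ideal I is finite of
   length N, i.e. dim_K H^0(X, O_X) = N.  A finite X misses some hyperplane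
   l = 0, hence is the affine scheme X \cap D_+(l), whose coordinate ring
   (the degree 0 part of (K[x]/I)[1/l]) is K[x]/(I + (l - 1)).  If X is not
   finite, no such l exists when K is algebraically closed. *)
Definition scheme_length (I : {mpoly K[m.+1]} -> Prop) (N : nat) : Prop :=
  exists l : 'rV[K]_m.+1,
    (forall v, zeros I v -> hval (lin_form l) v != 0) /\
    quot_dim (ideal_gen (fun p => I p \/ p = lin_form l - 1)) N.

End Projective.

Section PlaneCurve.
Variable K : fieldType.
Implicit Types (C : 'rV[K]_3 -> Prop) (F : {mpoly K[3]}) (P : 'rV[K]_3).

(* F generates the homogeneous ideal of C *)
Definition curve_eq C F : Prop :=
  (exists d, F \is d.-homog) /\
  forall G : {mpoly K[3]},
    (forall P, C P -> hval G P = 0) <-> exists H, G = H * F.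

(* F in the affine chart x_i = 1, with P translated to the origin *)
Definition local_eq F P (i : 'I_3) : {mpoly K[3]} :=
  F \mPo [tuple (if j == i then 1 else 'X_j + (P 0 j / P 0 i)%:MP) | j < 3].

(* The multiplicity of C at P is the degree of the lowest nonzero homogeneous
   part of a local equation of C at P. *)
Definition has_mult C P (mu : nat) : Prop :=
  exists F (i : 'I_3),
    [/\ curve_eq C F, P 0 i != 0,
        forall u : 'X_{1..3}, (mdeg u < mu)%N -> (local_eq F P i)@_u = 0
      & exists2 u : 'X_{1..3}, mdeg u = mu & (local_eq F P i)@_u != 0].

Definition singular_pt C P : Prop :=
  C P /\ exists2 mu, (1 < mu)%N & has_mult C P mu.

End PlaneCurve.

(* The entry a u j is the coefficient of s^(n-j) t^j in f_u. *)
Section RationalCurve.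
Variables (K : fieldType) (n : nat) (a : 'M[K]_(3, n.+1)).

Definition param (p : 'rV[K]_2) : 'rV[K]_3 :=
  \row_(u < 3) \sum_(j < n.+1) a u j * p 0 0 ^+ (n - j) * p 0 1 ^+ j.

Definition curve (P : 'rV[K]_3) : Prop :=
  exists2 p : 'rV[K]_2, p != 0 & same_pt P (param p).

Definition generically_injective : Prop :=
  exists Z : 'rV[K]_3 -> Prop,
    [/\ zariski_closed Z, exists2 P, curve P & ~ Z P
      & forall P, curve P -> ~ Z P -> forall p q : 'rV[K]_2,
          p != 0 -> q != 0 -> same_pt P (param p) -> same_pt P (param q) ->
          same_pt p q].

Definition proper_param : Prop :=
  (forall p : 'rV[K]_2, p != 0 -> param p != 0) /\ generically_injective.

Definition Mmat (k : nat) : 'M[{mpoly K[k.+1]}]_((n - k).+1 + 3, n.+1) :=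
  col_mx
    (\matrix_(i, j) if (i <= j <= i + k)%N then 'X_(inord (j - i)) else 0)
    (map_mx (@mpolyC _ _) a).

Definition minor (T : comNzRingType) (p q r : nat) (M : 'M[T]_(p, q)) (x : T) :
    Prop :=
  exists (f : 'I_r -> 'I_p) (g : 'I_r -> 'I_q),
    [/\ {homo f : i j / (i < j)%N}, {homo g : i j / (i < j)%N}
      & x = \det (mxsub f g M)].

Definition Xideal (k : nat) : {mpoly K[k.+1]} -> Prop :=
  ideal_gen (minor (n - k + 3) (Mmat k)).

Definition Xpts (k : nat) : 'rV[K]_k.+1 -> Prop := zeros (@Xideal k).

(* z \in H_R; only used for k <= n *)
Definition in_secant (k : nat) (R : 'rV[K]_k.+1) (z : 'rV[K]_n.+1) : Prop :=
  z != 0 /\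
  forall j : nat, (j <= n - k)%N ->
    \sum_(i < k.+1) R 0 i * z 0 (inord (i + j)) = 0.

(* The center of the projection is its zero locus: z \in Pi iff proj z = 0. *)
Definition proj (z : 'rV[K]_n.+1) : 'rV[K]_3 :=
  \row_(u < 3) \sum_(j < n.+1) a u j * z 0 j.

Definition contracted_to (k : nat) (R : 'rV[K]_k.+1) (P : 'rV[K]_3) : Prop :=
  forall Q : 'rV[K]_3,
    (exists z, [/\ in_secant R z, proj z != 0 & same_pt Q (proj z)]) <->
    same_pt Q P.

End RationalCurve.

(* Main.v *)
(* Binary forms are dehomogenised at s = 1, a form of degree d being a
   polynomial of size at most d.+1.

   R lies in X_k iff G_R divides the pullbacks to P^1 of two independent linear
   forms, i.e. iff G_R divides the pullback f^*P of the point P where they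
   vanish; H_R is then contracted to P.  The multiplicity of C at P is
   deg f^*P: the lower bound is the corank at P of a determinantal equation of
   C, the upper one comes from counting the intersections of C with a general
   line through P.

   X_k is finite because a root of G_R is a point where f is ramified or not
   injective.

   For the length of X_2, take a general point c of P^1 and the chart
   G_R(c) = 1.  The Bezoutian of the pencil of lines through f(c) brings M_2 to an
   (N+1) x N matrix, N = n - 2, with entries y on the diagonal and z below it,
   up to constants.  The leading forms of its maximal minors are, up to sign,
   the y^i z^(N - i), so the monomials of degree < N are a basis of the
   quotient: there are N(N+1)/2 of them.  In particular the ideal is proper, and
   the Nullstellensatz for finite-dimensional quotients gives a point of X_2. *)

Require Import Defs.
From HB Require Import structures.
From mathcomp Require Import all_boot all_fingroup all_algebra all_field.
From mathcomp Require Import zify ring.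
From mathcomp.multinomials Require Import ssrcomplements mpoly.
From Stdlib Require Import Classical.

Set Implicit Arguments.
Unset Strict Implicit.
Unset Printing Implicit Defensive.

Import GRing.Theory.
Local Open Scope ring_scope.

(** Multiplicity is defined through a generator of the whole homogeneous ideal of C, so a form that
    merely vanishes on C is not enough. The determinantal form is a generator because it is monic of
    degree n in the direction of a point [Q] off C: dividing a form that vanishes on C by it, along
    the lines through [Q], leaves a remainder of degree below n with n distinct zeros on a general
    such line. That these zeros are distinct rests on a Wronskian being nonzero, which is where
    characteristic 0 enters. In a dehomogenised form a zero at infinity shows only as a drop of the
    size, so divisibility of forms is always accompanied by a bound on the size of the cofactor. For
    the length, knowing the leading forms of the minors only bounds the quotient from above.
    Equality also requires that no combination of the minors has degree below N. This holds because
    the linear relations between the minors, one for each column of the matrix, lift the relations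
    between the monomials y^i z^(N - i), as in Buchberger's criterion. *)

(* [size p] may be typed through different inheritance paths from [K], which
   [lia] takes for different atoms. *)
Definition psize (K : closedFieldType) (p : {poly K}) : nat := size p.

Ltac plia := repeat match goal with
  | H : context [@size ?T (@polyseq ?R ?p)] |- _ =>
      change (@size T (@polyseq R p)) with (psize p) in H
  | |- context [@size ?T (@polyseq ?R ?p)] =>
      change (@size T (@polyseq R p)) with (psize p)
  end; lia.

(** * Polynomial functions over an infinite field *)

Section InfiniteField.
Variable K : closedFieldType.

Lemma poly_eq0_horner (p : {poly K}) : (forall x, p.[x] = 0) -> p = 0.
Proof.
move=> p0; apply/eqP; apply/negPn/negP => /closed_nonrootP[x].
by rewrite rootE p0 eqxx.
Qed.

Lemma meval_muni n (p : {mpoly K[n.+1]}) (v : 'I_n.+1 -> K) :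
  p.@[v] = (map_poly (meval (v \o widen_ord (leqnSn n))) (muni p)).[v ord_max].
Proof.
rewrite muniE raddf_sum /= -horner_evalE raddf_sum /= mevalE.
apply: eq_bigr => m _; rewrite /horner_eval.
rewrite -[_ *: 'X_[_]]mul_mpolyC -!mul_polyC !rmorphM /= !map_polyC /= mevalC map_polyXn.
rewrite !hornerE mevalX big_ord_recr /= mulrA.
congr (_ * _ * _); apply: eq_bigr => i _; by rewrite mnmE.
Qed.

Lemma muni_inj n (p : {mpoly K[n.+1]}) : muni p = 0 -> p = 0.
Proof.
move=> p0; apply/mpolyP => m; rewrite mcoeff0.
case: (boolP (m \in msupp p)) => [mp|]; last by move/memN_msupp_eq0.
pose m' := [multinom m (widen_ord (leqnSn n) i) | i < n].
have: ((muni p)`_(m ord_max))@_m' = 0 by rewrite p0 coef0 mcoeff0.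
rewrite muniE coef_sum raddf_sum /= (bigD1_seq m) ?msupp_uniq //= big1 ?addr0.
  by rewrite coefZ coefXn eqxx mulr1 mcoeffZ mcoeffX eqxx mulr1.
move=> k km; rewrite coefZ coefXn.
case: (eqVneq (m ord_max) (k ord_max)) => [e|_]; last by rewrite mulr0 mcoeff0.
rewrite mulr1 mcoeffZ mcoeffX; case: eqP => [/mnmP e'|]; last by rewrite mulr0.
case/eqP: km; apply/mnmP => i; case: (unliftP ord_max i) => [j ->|->]; last by [].
have := e' j; rewrite !mnmE; set w := widen_ord _ _.
by have -> : lift ord_max j = w by apply/val_inj; rewrite /= /bump leqNgt ltn_ord.
Qed.

Lemma meval_eq0 n (p : {mpoly K[n]}) : (forall v, p.@[v] = 0) -> p = 0.
Proof.
elim: n p => [|n IH] p p0.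
  have := p0 (fun=> 0); have [c ->] : exists c, p = c%:MP.
    exists p@_0%MM; apply/mpolyP => m; rewrite mcoeffC.
    by have -> : m = 0%MM; [apply/mnmP; case|rewrite eqxx mulr1].
  by rewrite mevalC => ->; rewrite mpolyC0.
apply: muni_inj; apply/polyP => k; rewrite coef0; apply: IH => v.
pose w x (i : 'I_n.+1) := if unlift ord_max i is Some j then v j else x.
have wE x : w x \o widen_ord (leqnSn n) =1 v.
  move=> i /=; rewrite /w; have -> : widen_ord (leqnSn n) i = lift ord_max i.
    by apply/val_inj; rewrite /= /bump leqNgt ltn_ord.
  by rewrite liftK.
suff : map_poly (meval v) (muni p) = 0 by move/polyP/(_ k); rewrite coef_map coef0.
apply: poly_eq0_horner => x; rewrite -[RHS](p0 (w x)) meval_muni.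
have -> : w x ord_max = x by rewrite /w unlift_none.
congr (_.[_]); apply/polyP => i; rewrite !coef_map /=.
by apply: meval_eq => j; rewrite wE.
Qed.

(** Statements about general points enter the algebra here: they hold off the zeros of some [B], and
    [B * p] vanishes everywhere. *)
Lemma meval_generic n (B p : {mpoly K[n]}) :
  B != 0 -> (forall v, B.@[v] != 0 -> p.@[v] = 0) -> p = 0.
Proof.
move=> B0 H; have /eqP : B * p = 0.
  apply: meval_eq0 => v; rewrite mevalM.
  by case: (eqVneq B.@[v] 0) => [->|/H ->]; rewrite ?mul0r ?mulr0.
by rewrite mulf_eq0 (negPf B0) => /eqP.
Qed.

End InfiniteField.

Section Evaluation.
Variables (R : comNzRingType) (n : nat).

Lemma horner_mmap (h : 'I_n -> {poly R}) (p : {mpoly R[n]}) t :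
  (mmap polyC h p).[t] = p.@[fun i => (h i).[t]].
Proof.
rewrite /mmap -horner_evalE raddf_sum /= mevalE; apply: eq_bigr => m _.
rewrite /horner_eval hornerCM /mmap1 horner_prod; congr (_ * _).
by apply: eq_bigr => i _; rewrite horner_exp.
Qed.

Lemma size_mmap (h : 'I_n -> {poly R}) (p : {mpoly R[n]}) d :
  (forall i, (size (h i) <= 2)%N) -> (msize p <= d)%N ->
  (size (mmap polyC h p) <= d)%N.
Proof.
move=> h2 pd; rewrite (leq_trans (size_sum _ _ _)) //.
apply/bigmax_leqP_seq => m mp _; rewrite mul_polyC.
apply: leq_trans (size_scale_leq _ _) _.
apply: leq_trans (leq_trans (msize_mdeg_lt mp) pd).
rewrite /mmap1 mdegE.
apply: (big_ind2 (fun (q : {poly R}) k => (size q <= k.+1)%N)) => [|p1 k1 p2 k2 H1 H2|i _].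
- by rewrite size_poly1.
- by apply: leq_trans (size_polyMleq _ _) _; lia.
apply: leq_trans (size_poly_exp_leq _ _) _.
by rewrite ltnS -[leqRHS]mul1n leq_mul2r; have := h2 i; lia.
Qed.

End Evaluation.

Lemma hvalM (K : fieldType) m (F G : {mpoly K[m.+1]}) v :
  hval (F * G) v = hval F v * hval G v.
Proof. exact: mevalM. Qed.

Lemma hvalZ_homog (K : fieldType) m d (F : {mpoly K[m.+1]}) c v :
  F \is d.-homog -> hval F (c *: v) = c ^+ d * hval F v.
Proof.
move=> /dhomogP hF; rewrite /hval !mevalE mulr_sumr.
apply: eq_big_seq => u /hF /= <-; rewrite mulrCA; congr (_ * _).
rewrite mdegE -prodrXr -big_split /=.
by apply: eq_bigr => i _; rewrite mxE exprMn.
Qed.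

(** * Pencils of coprime polynomials *)

Section Pencil.
Variable K : closedFieldType.
Implicit Types (g h u v p q : {poly K}).

(** Coprimality makes [g] divide [u] and [h] divide [v]; the one of [g], [h] that has degree [e] is
    too large to divide anything nonzero here. *)
Lemma coprime_syzygy0 g h u v e :
  coprimep g h -> maxn (size g) (size h) = e.+1 -> (size u <= e)%N ->
  (size v <= e)%N -> u * h = v * g -> u = 0 /\ v = 0.
Proof.
move=> cop se su sv E.
have gu : g %| u by rewrite -(Gauss_dvdpl _ cop) E dvdp_mulIr.
have hv : h %| v by rewrite -(@Gauss_dvdpl _ v g) 1?coprimep_sym // -E dvdp_mulIr.
have z p q : p %| q -> (size q < size p)%N -> q = 0.
  by move=> pq; case: (eqVneq q 0) => // q0; rewrite ltnNge dvdp_leq.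
have z' p q : q != 0 -> p * q = 0 -> p = 0.
  by move=> q0 /eqP; rewrite mulf_eq0 (negPf q0) orbF => /eqP.
case: (leqP (size h) (size g)) => gh.
  have u0 : u = 0 by apply: z gu _; lia.
  split=> //; apply: (z' v g); first by rewrite -size_poly_eq0; lia.
  by rewrite -E u0 mul0r.
have v0 : v = 0 by apply: z hv _; lia.
split=> //; apply: (z' u h); first by rewrite -size_poly_eq0; lia.
by rewrite E v0 mul0r.
Qed.

Hypothesis charK0 : [pchar K] =i pred0.

Lemma deriv0_size p : p^`() = 0 -> (size p <= 1)%N.
Proof.
move=> /polyP p'; apply/leq_sizeP => -[//|j] _; have := p' j.
rewrite coef_deriv coef0 -mulr_natr => /eqP; rewrite mulf_eq0.
by move/pcharf0P: charK0 => ->; rewrite orbF => /eqP.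
Qed.

Definition wronskian g h := g * h^`() - h * g^`().

(** If it vanished, [g] would divide its own derivative, so g' = 0 and then h' = 0; in
    characteristic 0 both would be constant. Its zeros are the affine ramification points of (g :
    h). *)
Lemma wronskian_neq0 g h e :
  coprimep g h -> maxn (size g) (size h) = e.+2 -> wronskian g h != 0.
Proof.
move=> cop se; apply/negP => /eqP /subr0_eq W.
have [g0|g0] := eqVneq g 0.
  by move: cop se; rewrite g0 coprime0p size_poly0 max0n -size_poly_eq1 => /eqP->.
have g'0 : g^`() = 0.
  apply/eqP; apply/negPn/negP => g'0.
  have : g %| g^`() by rewrite -(Gauss_dvdpr _ cop) -W dvdp_mulIl.
  by move/dvdp_leq => /(_ g'0); rewrite leqNgt lt_size_deriv.
have := deriv0_size g'0; move: W; rewrite g'0 mulr0 => /eqP.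
rewrite mulf_eq0 (negPf g0) => /eqP /deriv0_size; lia.
Qed.

(** Bertini for a pencil on P^1: a multiple zero of a member is a zero of the Wronskian, and only
    one member passes through a given point. [bad] lists the directions of the members through the
    points to avoid. *)
Lemma pencil_general g h E e :
  coprimep g h -> maxn (size g) (size h) = e.+1 -> E != 0 ->
  exists bad : seq (K * K), all (fun w => w != (0, 0)) bad /\
    forall x y : K, all (fun w => x * w.2 - y * w.1 != 0) bad ->
    exists rs : seq K, [/\ uniq rs, size rs = e,
      all (root (x *: h - y *: g)) rs & all (fun r => E.[r] != 0) rs].
Proof.
case: e => [|e] cop se E0.
  by exists [::]; split=> // x y _; exists [::].
have WE0 : wronskian g h * E != 0 by rewrite mulf_neq0 // (wronskian_neq0 cop se).
have [srs Ers] := closed_field_poly_normal (wronskian g h * E).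
have rootWE r : root (wronskian g h * E) r -> r \in srs.
  by rewrite Ers rootZ ?lead_coef_eq0 // root_prod_XsubC.
(* The first entry is the value of the pencil at infinity; avoiding it keeps the member of full
   degree [e.+1]. *)
pose bad := (g`_e.+1, h`_e.+1) :: [seq (g.[r], h.[r]) | r <- srs].
exists bad; split.
  apply/andP; split.
    apply/negP => /eqP [ge he].
    have [gh|gh] := leqP (size h) (size g).
      have : lead_coef g = 0 by rewrite lead_coefE; have -> : (size g).-1 = e.+1 by move: se; rewrite (maxn_idPl gh) => ->.
      by move/eqP; rewrite lead_coef_eq0 => /eqP g0; move: gh se; rewrite g0 size_poly0; lia.
    have : lead_coef h = 0 by rewrite lead_coefE; have -> : (size h).-1 = e.+1 by move: se; rewrite (maxn_idPr (ltnW gh)) => ->.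
    by move/eqP; rewrite lead_coef_eq0 => /eqP g0; move: gh se; rewrite g0 size_poly0; lia.
  apply/allP => _ /mapP[r _ ->]; apply/negP => /eqP [gr hr].
  by have := coprimep_root cop (x := r); rewrite rootE gr eqxx hr eqxx => /(_ isT).
move=> x y /andP[/= inf /allP fin].
set l := x *: h - y *: g.
have sl : size l = e.+2.
  apply/eqP; rewrite eqn_leq; apply/andP; split.
    apply: leq_trans (size_polyD _ _) _; rewrite size_polyN geq_max.
    have /andP[sg sh] : (size g <= e.+2)%N && (size h <= e.+2)%N by rewrite -geq_max se.
    by rewrite !(leq_trans (size_scale_leq _ _)).
  by rewrite ltnNge; apply: contraNN inf => /leq_sizeP/(_ e.+1 (leqnn _));
     rewrite /l coefB !coefZ => ->.
have l0 : l != 0 by rewrite -size_poly_eq0 sl.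
have lW r : root l r -> ~~ root (wronskian g h * E) r.
  move=> lr; apply/negP => /rootWE rin.
  have := fin (g.[r], h.[r]); rewrite map_f // => /(_ isT) /=.
  by move: lr; rewrite rootE /l !hornerE => /eqP ->; rewrite eqxx.
have [rs Er] := closed_field_poly_normal l.
have rsl : {in rs, forall r, root l r}.
  by move=> r rin; rewrite Er rootZ ?lead_coef_eq0 // root_prod_XsubC.
exists rs; split.
- rewrite -separable_prod_XsubC; have : separable_poly l; last first.
    by rewrite Er !separable_poly.unlock derivZ coprimepZl ?coprimepZr ?lead_coef_eq0.
  rewrite separable_poly.unlock; apply/Pdiv.ClosedField.coprimepP => r lr.
  apply: contra (lW _ lr) => l'r; rewrite rootM; apply/orP; left.
  move: lr l'r; rewrite !rootE /l derivB !derivZ !hornerE !subr_eq0 => /eqP e1 /eqP e2.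
  have xy : (x != 0) || (y != 0).
    by apply: contraNT inf; rewrite negb_or !negbK => /andP[/eqP-> /eqP->]; rewrite !mul0r subr0.
  case/orP: xy => x0; apply/eqP; apply: (mulfI x0).
    by rewrite mulrCA e2 [RHS]mulrA e1; ring.
  by rewrite mulrA -e1 [RHS]mulrCA -e2; ring.
- have := sl; rewrite Er size_scale ?lead_coef_eq0 // size_prod_XsubC; lia.
- exact/allP.
- apply/allP => r /rsl/lW; apply: contra => /eqP Er0.
  by rewrite rootM [root E r]rootE Er0 eqxx orbT.
Qed.

End Pencil.

(** * Linear forms and the parameterization *)

Section SamePoint.
Variables (K : fieldType) (m : nat).
Implicit Types u v w : 'rV[K]_m.+1.

Lemma same_pt_refl v : same_pt v v.
Proof. by exists 1; rewrite ?oner_eq0 ?scale1r. Qed.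

Lemma same_pt_sym v w : same_pt v w -> same_pt w v.
Proof. by case=> c c0 ->; exists c^-1; rewrite ?invr_eq0 // scalerA mulVf // scale1r. Qed.

Lemma same_pt_trans u v w : same_pt u v -> same_pt v w -> same_pt u w.
Proof. by case=> c c0 -> [d d0 ->]; exists (c * d); rewrite ?mulf_neq0 // scalerA. Qed.

Lemma same_pt_neq0 v w : same_pt v w -> w != 0 -> v != 0.
Proof. by case=> c c0 -> w0; rewrite scaler_eq0 negb_or c0. Qed.

End SamePoint.

Section LinForm.
Variables (K : fieldType) (m : nat).
Implicit Types (l y : 'rV[K]_m).

Definition lf l y : K := \sum_u l 0 u * y 0 u.

Lemma lfDl l1 l2 y : lf (l1 + l2) y = lf l1 y + lf l2 y.
Proof. by rewrite /lf -big_split; apply: eq_bigr => i _; rewrite mxE mulrDl. Qed.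
Lemma lfZl c l y : lf (c *: l) y = c * lf l y.
Proof. by rewrite /lf mulr_sumr; apply: eq_bigr => i _; rewrite mxE mulrA. Qed.
Lemma lfBl l1 l2 y : lf (l1 - l2) y = lf l1 y - lf l2 y.
Proof. by rewrite lfDl -scaleN1r lfZl mulN1r. Qed.
Lemma lfC l y : lf l y = lf y l.
Proof. by apply: eq_bigr => i _; rewrite mulrC. Qed.
Lemma lfDr l y1 y2 : lf l (y1 + y2) = lf l y1 + lf l y2.
Proof. by rewrite lfC lfDl !(lfC l). Qed.
Lemma lfBr l y1 y2 : lf l (y1 - y2) = lf l y1 - lf l y2.
Proof. by rewrite lfC lfBl !(lfC l). Qed.
Lemma lfZr c l y : lf l (c *: y) = c * lf l y.
Proof. by rewrite lfC lfZl (lfC l). Qed.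
Lemma lf_delta i y : lf (delta_mx 0 i) y = y 0 i.
Proof.
rewrite /lf (bigD1 i) //= mxE !eqxx mul1r big1 ?addr0 // => j ji.
by rewrite mxE (negPf ji) mul0r.
Qed.

End LinForm.

Section Annihilator.
Variable K : fieldType.
Implicit Types (P l y : 'rV[K]_3).

(** A basis of the pencil of lines through [P], together with the dual fact that the two lines meet
    in [P] alone. *)
Definition annpair P l1 l2 :=
  [/\ forall l, lf l P = 0 <-> exists x z : K, l = x *: l1 + z *: l2,
      forall y, lf l1 y = 0 -> lf l2 y = 0 -> exists c, y = c *: P
    & forall x z : K, x *: l1 + z *: l2 = 0 -> x = 0 /\ z = 0].

Lemma annpairP P : P != 0 -> exists l1 l2, annpair P l1 l2.
Proof.
move=> /rV0Pn[i Pi].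
pose l t : 'rV[K]_3 := P 0 i *: delta_mx 0 (lift i t) - P 0 (lift i t) *: delta_mx 0 i.
have lE (t : 'I_2) y : lf (l t) y = P 0 i * y 0 (lift i t) - P 0 (lift i t) * y 0 i.
  by rewrite /l lfBl !lfZl !lf_delta.
have t2 (t : 'I_2) : t = 0 \/ t = 1 by case: t => [[|[|//]] ?]; [left|right]; apply: val_inj.
have lx (t s : 'I_2) : l t 0 (lift i s) = P 0 i * (s == t)%:R.
  by rewrite /l !mxE !eqxx /= (inj_eq (@lift_inj _ i)) [lift i s == i]eq_sym (negPf (neq_lift _ _)) mulr0 subr0.
have lxi (t : 'I_2) : l t 0 i = - P 0 (lift i t).
  by rewrite /l !mxE !eqxx /= (negPf (neq_lift _ _)) mulr0 sub0r mulr1.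
exists (l 0), (l 1); split.
- move=> w; split=> [w0|[x [y ->]]]; last first.
    by rewrite lfDl !lfZl !lE !(mulrC (P 0 i)) !subrr !mulr0 addr0.
  exists (w 0 (lift i 0) / P 0 i), (w 0 (lift i 1) / P 0 i).
  apply/rowP => j; rewrite mxE [(_ *: l 0) _ _]mxE [(_ *: l 1) _ _]mxE.
  case: (unliftP i j) => [s ->|->].
    by rewrite !lx; case: (t2 s) => -> /=; rewrite ?mulr0 ?addr0 ?add0r mulr1 mulrVK ?unitfE.
  rewrite !lxi; apply: (mulIf Pi); move: w0; rewrite /lf (bigD1_ord i) //= !big_ord_recl big_ord0 /=.
  rewrite !addr0 => /eqP; rewrite addr_eq0 => /eqP ->.
  have -> : lift ord0 ord0 = 1 :> 'I_2 by apply: val_inj.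
  rewrite -[ord0 : 'I_2]/(0 : 'I_2); field.
  by rewrite Pi.
- move=> y; rewrite !lE => /subr0_eq h0 /subr0_eq h1.
  exists (y 0 i / P 0 i); apply/rowP => j; rewrite !mxE.
  apply: (mulfI Pi); rewrite mulrA mulrCA mulfV // mulr1.
  case: (unliftP i j) => [s ->|->]; last by rewrite mulrC.
  by case: (t2 s) => ->; rewrite ?h0 ?h1 mulrC.
- move=> x y /rowP E; split.
    have := E (lift i 0); rewrite mxE [(_ *: l 0) _ _]mxE [(_ *: l 1) _ _]mxE !lx !mxE /=.
    by rewrite !mulr0 addr0 mulr1 => /eqP; rewrite mulf_eq0 (negPf Pi) orbF => /eqP.
  have := E (lift i 1); rewrite mxE [(_ *: l 0) _ _]mxE [(_ *: l 1) _ _]mxE !lx !mxE /=.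
  by rewrite !mulr0 add0r mulr1 => /eqP; rewrite mulf_eq0 (negPf Pi) orbF => /eqP.
Qed.

Lemma annpair_ann P l1 l2 : annpair P l1 l2 -> lf l1 P = 0 /\ lf l2 P = 0.
Proof.
case=> sp _ _; split; apply/sp.
  by exists 1, 0; rewrite scale1r scale0r addr0.
by exists 0, 1; rewrite scale1r scale0r add0r.
Qed.

Lemma indep_annpair l1 l2 :
  (forall x y : K, x *: l1 + y *: l2 = 0 -> x = 0 /\ y = 0) ->
  exists2 P, P != 0 & annpair P l1 l2.
Proof.
move=> ind; pose A : 'M[K]_(3, 1 + 1) := (col_mx l1 l2)^T.
have rA : (\rank A <= 2)%N by exact: rank_leq_col.
have : kermx A != 0 by rewrite -mxrank_eq0 mxrank_ker; lia.
case/rowV0Pn => P /sub_kermxP PA P0; exists P => //.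
have lP l : lf l P = (P *m l^T) 0 0.
  by rewrite mxE; apply: eq_bigr => i _; rewrite mxE mulrC.
move: PA; rewrite /A tr_col_mx mul_mx_row -row_mx0 => /eq_row_mx[p1 p2].
have l1P : lf l1 P = 0 by rewrite lP p1 mxE.
have l2P : lf l2 P = 0 by rewrite lP p2 mxE.
have [k1 [k2 [sp pt ik]]] := annpairP P0.
have /sp [x1 [y1 E1]] := l1P; have /sp [x2 [y2 E2]] := l2P.
(* The determinant of [l1], [l2] in the explicit basis [k1], [k2]; inverting it carries the
   properties of that basis over. *)
have D0 : x1 * y2 - x2 * y1 != 0.
  apply/negP => /eqP d0.
  have [z1 /eqP] : y2 = 0 /\ - y1 = 0.
    apply: ind; rewrite E1 E2 !scalerDr !scalerA addrACA -!scalerDl.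
    have -> : y2 * x1 + - y1 * x2 = 0 by rewrite -d0; ring.
    have -> : y2 * y1 + - y1 * y2 = 0 by ring.
    by rewrite !scale0r addr0.
  rewrite oppr_eq0 => /eqP z2.
  have [z3 /eqP] : x2 = 0 /\ - x1 = 0.
    apply: ind; rewrite E1 E2 !scalerDr !scalerA addrACA -!scalerDl.
    have -> : x2 * x1 + - x1 * x2 = 0 by ring.
    have -> : x2 * y1 + - x1 * y2 = 0 by rewrite -[RHS]oppr0 -d0; ring.
    by rewrite !scale0r addr0.
  rewrite oppr_eq0 => /eqP z4.
  have := ind 1 1; rewrite E1 E2 z1 z2 z3 z4 !scale0r !addr0 scaler0 addr0 => /(_ erefl) [/eqP].
  by rewrite oner_eq0.
have k1E : k1 = (y2 / (x1 * y2 - x2 * y1)) *: l1 + (- y1 / (x1 * y2 - x2 * y1)) *: l2.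
  rewrite E1 E2 !scalerDr !scalerA addrACA -!scalerDl.
  set c := (X in X *: k1); set d := (X in X *: k2).
  have -> : c = 1 by rewrite /c; field.
  have -> : d = 0 by rewrite /d; field.
  by rewrite scale1r scale0r addr0.
have k2E : k2 = (- x2 / (x1 * y2 - x2 * y1)) *: l1 + (x1 / (x1 * y2 - x2 * y1)) *: l2.
  rewrite E1 E2 !scalerDr !scalerA addrACA -!scalerDl.
  set c := (X in X *: k1); set d := (X in X *: k2).
  have -> : c = 0 by rewrite /c; field.
  have -> : d = 1 by rewrite /d; field.
  by rewrite scale1r scale0r add0r.
split=> //.
- move=> l; split=> [/sp [x [y ->]]|[x [y ->]]]; last first.
    by rewrite lfDl !lfZl l1P l2P !mulr0 addr0.
  rewrite k1E k2E !scalerDr !scalerA addrACA -!scalerDl.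
  by do 2 eexists.
- by move=> y z1 z2; apply: pt; rewrite ?k1E ?k2E lfDl !lfZl z1 z2 !mulr0 addr0.
Qed.

End Annihilator.

Section Curve.
Variables (K : closedFieldType) (n : nat) (a : 'M[K]_(3, n.+1)).
Implicit Types (l P : 'rV[K]_3) (p q : 'rV[K]_2).

Definition aff (r : K) : 'rV[K]_2 := \row_i (if i == 0 then 1 else r).
Definition infpt : 'rV[K]_2 := \row_i (if i == 0 then 0 else 1).

(* The pullback of the linear form [l] to the affine line s = 1. *)
Definition cpoly l : {poly K} := rVpoly (l *m a).

Lemma rV2P p : p = \row_i (if i == 0 then p 0 0 else p 0 1).
Proof.
apply/rowP => i; rewrite mxE; case: (unliftP 0 i) => [j ->|->] //=.
by congr (p _ _); apply: val_inj; rewrite /= ord1.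
Qed.

Lemma pt_cases p : p != 0 -> (exists r, same_pt p (aff r)) \/ same_pt p infpt.
Proof.
move=> p0; have [s0|s0] := eqVneq (p 0 0) 0.
  right; exists (p 0 1).
    apply: contraNN p0 => /eqP t0; apply/eqP; rewrite (rV2P p) s0 t0.
    by apply/rowP => i; rewrite !mxE; case: ifP.
  rewrite [LHS]rV2P s0; apply/rowP => i; rewrite !mxE.
  by case: ifP; rewrite ?mulr0 ?mulr1.
left; exists (p 0 1 / p 0 0), (p 0 0) => //.
rewrite [LHS]rV2P; apply/rowP => i; rewrite !mxE.
by case: ifP => _; rewrite ?mulr1 // mulrCA mulfV // mulr1.
Qed.

Lemma aff_neq0 r : aff r != 0.
Proof. by apply/rV0Pn; exists 0; rewrite mxE /= oner_eq0. Qed.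

Lemma infpt_neq0 : infpt != 0.
Proof. by apply/rV0Pn; exists 1; rewrite mxE /= oner_eq0. Qed.

Lemma same_aff r s : same_pt (aff r) (aff s) -> r = s.
Proof.
case=> c _ /rowP E; have := E 0; have := E 1; rewrite !mxE /= mulr1.
by move=> -> <-; rewrite mul1r.
Qed.

Lemma aff_infpt r : ~ same_pt (aff r) infpt.
Proof. by case=> c _ /rowP /(_ 0); rewrite !mxE /= mulr0 => /eqP; rewrite oner_eq0. Qed.

Lemma paramZ c p : param a (c *: p) = c ^+ n *: param a p.
Proof.
apply/rowP => u; rewrite !mxE mulr_sumr; apply: eq_bigr => j _.
have -> : c ^+ n = c ^+ (n - j) * c ^+ j by rewrite -exprD subnK // -ltnS.
by rewrite !exprMn; ring.
Qed.

Lemma same_param p q : same_pt p q -> same_pt (param a p) (param a q).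
Proof. by case=> c c0 ->; exists (c ^+ n); rewrite ?expf_neq0 // paramZ. Qed.

Lemma lf_param l p :
  lf l (param a p) = \sum_(j < n.+1) (cpoly l)`_j * p 0 0 ^+ (n - j) * p 0 1 ^+ j.
Proof.
rewrite /lf; under eq_bigr do rewrite mxE mulr_sumr.
rewrite exchange_big; apply: eq_bigr => j _ /=.
rewrite /cpoly coef_rVpoly_ord mxE !mulr_suml; apply: eq_bigr => u _.
by rewrite !mulrA.
Qed.

Lemma size_cpoly l : (size (cpoly l) <= n.+1)%N.
Proof. exact: size_poly. Qed.

Lemma lf_param_aff l r : lf l (param a (aff r)) = (cpoly l).[r].
Proof.
rewrite lf_param (horner_coef_wide _ (size_cpoly l)); apply: eq_bigr => j _.
by rewrite !mxE /= expr1n mulr1.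
Qed.

Lemma lf_param_inf l : lf l (param a infpt) = (cpoly l)`_n.
Proof.
rewrite lf_param big_ord_recr /= subnn expr0 !mxE /= expr1n !mulr1 big1 ?add0r // => j _.
by rewrite expr0n subn_eq0 leqNgt ltn_ord mulr0 mul0r.
Qed.

Lemma cpolyD l1 l2 : cpoly (l1 + l2) = cpoly l1 + cpoly l2.
Proof. by rewrite /cpoly mulmxDl linearD. Qed.

Lemma cpolyZ c l : cpoly (c *: l) = c *: cpoly l.
Proof. by rewrite /cpoly -scalemxAl linearZ. Qed.

Lemma cpolyB l1 l2 : cpoly (l1 - l2) = cpoly l1 - cpoly l2.
Proof. by rewrite cpolyD -scaleN1r cpolyZ scaleN1r. Qed.

Lemma cpoly_sum l : cpoly l = \sum_u l 0 u *: cpoly (delta_mx 0 u).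
Proof.
rewrite {1}(row_sum_delta l); elim/big_rec2: _ => [|i x y _ <-].
  by rewrite /cpoly mul0mx linear0.
by rewrite cpolyD cpolyZ.
Qed.

(* [E] vanishes on the finitely many affine parameters of points of Z. *)
Lemma generic_inj : proper_param a ->
  exists2 E : {poly K}, E != 0 & forall r q, E.[r] != 0 -> q != 0 ->
    same_pt (param a q) (param a (aff r)) -> same_pt q (aff r).
Proof.
case=> base [Z [[S homS ZS] [P CP nZP] inj]].
have [p p0 Pp] := CP.
have P0 : P != 0 by apply: same_pt_neq0 Pp (base _ p0).
have [F SF FP] : exists2 F, S F & hval F P != 0.
  apply: NNPP => H; apply: nZP; apply/ZS; split=> // F SF.
  by apply/eqP/negPn/negP => FP; apply: H; exists F.
have [d hF] := homS _ SF.
have Fpar q : same_pt q p -> hval F (param a q) != 0.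
  move=> qp; have [c c0 ->] : same_pt (param a q) P.
    by apply: same_pt_trans (same_param qp) _; apply: same_pt_sym.
  by rewrite (hvalZ_homog _ _ hF) mulf_neq0 ?expf_neq0.
pose f u := \sum_(j < n.+1) a u j *: 'X^j : {poly K}.
have fE u r : (f u).[r] = param a (aff r) 0 u.
  rewrite mxE /f -horner_evalE raddf_sum; apply: eq_bigr => j _ /=.
  by rewrite /horner_eval hornerZ hornerXn !mxE /= expr1n mulr1.
pose E := mmap polyC f F.
have EE r : E.[r] = hval F (param a (aff r)).
  by rewrite /E horner_mmap /hval; apply: meval_eq => u; rewrite fE.
have E0 : E != 0.
  case: (pt_cases p0) => [[r pr]|pinf].
    apply: contraNneq (Fpar _ (same_pt_sym pr)) => E0.
    by rewrite -EE E0 horner0.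
  (* The known point outside [Z] is at infinity, so [F] is first tested in the chart t = 1. *)
  pose g u := \sum_(j < n.+1) a u j *: 'X^(n - j) : {poly K}.
  pose pt s : 'rV[K]_2 := \row_i (if i == 0 then s else 1).
  have gE u s : (g u).[s] = param a (pt s) 0 u.
    rewrite mxE /g -horner_evalE raddf_sum; apply: eq_bigr => j _ /=.
    by rewrite /horner_eval hornerZ hornerXn !mxE /= expr1n mulr1.
  pose E' := mmap polyC g F.
  have EE' s : E'.[s] = hval F (param a (pt s)).
    by rewrite /E' horner_mmap /hval; apply: meval_eq => u; rewrite gE.
  (* The factor ['X] makes the nonroot [s] nonzero, so that (s : 1) is also the affine point of
     parameter [s^-1]. *)
  have : 'X * E' != 0.
    rewrite mulf_neq0 ?polyX_eq0 //; apply/negP => /eqP E'0.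
    have := Fpar infpt (same_pt_sym pinf).
    have -> : infpt = pt 0 by [].
    by rewrite -EE' E'0 horner0 eqxx.
  case/closed_nonrootP => s; rewrite rootM negb_or rootX => /andP[s0].
  rewrite rootE EE' => Fs; apply: contraNneq Fs => E0.
  have -> : pt s = s *: aff s^-1.
    by apply/rowP => i; rewrite !mxE; case: ifP; rewrite ?mulr1 ?mulfV.
  by rewrite paramZ (hvalZ_homog _ _ hF) -EE E0 horner0 mulr0.
exists E => // r q Er q0 qr.
have Cq : curve a (param a (aff r)) by exists (aff r); [exact: aff_neq0|exact: same_pt_refl].
apply: (inj _ Cq) => //; first last.
- exact: same_pt_refl.
- exact: same_pt_sym.
- exact: aff_neq0.
- by case/ZS => _ /(_ _ SF); rewrite -EE; apply/eqP.
Qed.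

Hypothesis charK0 : [pchar K] =i pred0.

Lemma generic_dir (bad : seq (K * K)) : all (fun w => w != (0, 0)) bad ->
  exists y : K, all (fun w => 1 * w.2 - y * w.1 != 0) bad.
Proof.
move=> b0; pose B := \prod_(w <- bad) (w.2%:P - w.1 *: 'X).
have : B != 0.
  rewrite prodf_seq_neq0; apply/allP => w wb /=; have := allP b0 _ wb.
  apply: contraNneq => /polyP H; have := H 0%N; have := H 1%N.
  rewrite !coefB !coefC !coefZ !coefX /= mulr0 mulr1 sub0r subr0 ?coef0.
  by case: w {wb H} => x y /= /eqP; rewrite oppr_eq0 => /eqP -> ->.
case/closed_nonrootP => y; rewrite rootE horner_prod prodf_seq_neq0 => /allP H.
exists y; apply/allP => w /H; rewrite !hornerE /=.
by rewrite mulrC [_ * w.1]mulrC.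
Qed.

(* If [cpoly l = 0] then C lies on a line, onto which a map of degree n >= 2
   is not injective. *)
Lemma cpoly_eq0 l : proper_param a -> (1 < n)%N -> cpoly l = 0 -> l = 0.
Proof.
move=> prop n1 cl; apply/eqP; apply/negPn/negP => l0.
have [E E0 HE] := generic_inj prop.
have [base _] := prop.
have /rV0Pn[i li] := l0.
have di : delta_mx 0 i != 0 :> 'rV[K]_3 by apply/rV0Pn; exists i; rewrite mxE !eqxx oner_eq0.
have [l1 [l2 [_ pt ind]]] := annpairP di.
have lE y : lf l y = 0 -> lf l1 y = 0 -> lf l2 y = 0 -> y = 0.
  move=> ly y1 y2; have [c cy] := pt _ y1 y2; move: ly.
  rewrite cy lfZr lfC lf_delta => /eqP; rewrite mulf_eq0 (negPf li) orbF => /eqP ->.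
  by rewrite scale0r.
have lp q : lf l (param a q) = 0.
  by rewrite lf_param cl big1 // => j _; rewrite coef0 !mul0r.
have cop : coprimep (cpoly l1) (cpoly l2).
  apply/Pdiv.ClosedField.coprimepP => r; rewrite rootE -!lf_param_aff => /eqP r1.
  apply/negP => /eqP r2; have := base _ (aff_neq0 r).
  by rewrite (lE _ _ r1 r2) ?eqxx.
have se : maxn (size (cpoly l1)) (size (cpoly l2)) = n.+1.
  apply/eqP; rewrite eqn_leq geq_max !size_cpoly /= ltnNge.
  apply/negP; rewrite geq_max => /andP[/leq_sizeP/(_ _ (leqnn _)) s1 /leq_sizeP/(_ _ (leqnn _)) s2].
  have := base _ infpt_neq0.
  by rewrite (lE _ (lp infpt)) ?eqxx // lf_param_inf.
have [bad [b0 /(_ 1)]] := pencil_general charK0 cop se E0.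
have [y yb] := generic_dir b0 => /(_ y yb)[rs [urs srs /allP rl /allP rE]].
(* Two distinct zeros of a general member give the same ratio of [l2] to [l1], hence the same point
   of the line [l = 0], against injectivity. *)
case: rs urs srs rl rE => [|r [|s rs]] /=; [by case: (n) n1|by case: (n) n1 => [|[]]|].
rewrite inE negb_or -andbA => /andP[/eqP rs_neq _] _ rl rE.
apply: rs_neq; apply: same_aff; apply: same_pt_sym.
have root_rel x : root (1 *: cpoly l2 - y *: cpoly l1) x ->
    lf l2 (param a (aff x)) = y * lf l1 (param a (aff x)).
  by rewrite rootE !hornerE subr_eq0 ?mul1r !lf_param_aff => /eqP.
have r2 := root_rel r (rl _ _); have s2 := root_rel s (rl _ _).
have nz x : lf l2 (param a (aff x)) = y * lf l1 (param a (aff x)) -> lf l1 (param a (aff x)) != 0.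
  move=> e2; apply: contra (base _ (aff_neq0 x)) => /eqP e1.
  by rewrite (lE (param a (aff x))) // e2 e1 mulr0.
have {}r2 : lf l2 (param a (aff r)) = y * lf l1 (param a (aff r)) by apply: r2; rewrite inE eqxx.
have {}s2 : lf l2 (param a (aff s)) = y * lf l1 (param a (aff s)) by apply: s2; rewrite !inE eqxx orbT.
apply: HE; [by apply: rE; rewrite inE eqxx|exact: aff_neq0|].
exists (lf l1 (param a (aff s)) / lf l1 (param a (aff r))).
  by rewrite mulf_neq0 ?invr_eq0 ?nz.
apply/eqP; rewrite -subr_eq0; apply/eqP; apply: lE.
- by rewrite -scaleN1r lfDr !lfZr !lp !mulr0 addr0.
- by rewrite -scaleN1r lfDr !lfZr mulrVK ?unitfE ?nz // mulN1r subrr.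
- by rewrite -scaleN1r lfDr !lfZr r2 s2 mulN1r mulrCA mulrVK ?unitfE ?nz ?subrr.
Qed.
End Curve.
Arguments infpt {K}.

Lemma hval_lin_form (K : fieldType) m (l x : 'rV[K]_m.+1) : hval (lin_form l) x = lf l x.
Proof.
rewrite /hval /lin_form raddf_sum; apply: eq_bigr => i _ /=.
by rewrite mevalZ mevalXU.
Qed.

Lemma lin_form_eq0 (K : fieldType) m (l : 'rV[K]_m.+1) : lin_form l = 0 -> l = 0.
Proof.
move=> l0; apply/rowP => i; have := hval_lin_form l (delta_mx 0 i).
by rewrite l0 /hval meval0 lfC lf_delta mxE.
Qed.

(** * Fixed and moving part of the pencil of lines through a point *)

Section PencilAt.
Variables (K : closedFieldType) (n : nat) (a : 'M[K]_(3, n.+1)).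
Hypothesis charK0 : [pchar K] =i pred0.
Hypothesis n_gt1 : (1 < n)%N.
Hypothesis a_proper : proper_param a.
Implicit Types (l P : 'rV[K]_3) (D g h G q : {poly K}).
Local Notation cpoly := (cpoly a).
Local Notation param := (param a).

(* The lines through [P] cut on P^1 the moving part (g : h), of degree n - m,
   and the fixed divisor D = f^*P of degree m; m is the multiplicity of C at P. *)
Definition pencil P m l1 l2 D g h :=
  [/\ annpair P l1 l2, cpoly l1 = D * g /\ cpoly l2 = D * h, coprimep g h,
      maxn (size g) (size h) = (n - m).+1
    & [/\ (size D <= m.+1)%N, D != 0 & (m < n)%N]].

Lemma pencil_of_annpair P l1 l2 : annpair P l1 l2 ->
  exists m D g h, pencil P m l1 l2 D g h.
Proof.
move=> [sp pt ind]; set c1 := cpoly l1; set c2 := cpoly l2.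
have c10 : c1 != 0.
  apply/negP => /eqP /(cpoly_eq0 charK0 a_proper n_gt1) l10.
  have [] := ind 1 0; first by rewrite l10 scaler0 scale0r addr0.
  by move/eqP; rewrite oner_eq0.
pose D := gcdp c1 c2; have D0 : D != 0 by rewrite gcdp_eq0 (negPf c10).
have [g Eg] : exists g, c1 = D * g.
  by exists (c1 %/ D); rewrite mulrC divpK // dvdp_gcdl.
have [h Eh] : exists h, c2 = D * h.
  by exists (c2 %/ D); rewrite mulrC divpK // dvdp_gcdr.
have cop : coprimep g h.
  have := eqpxx D; rewrite {1}/D Eg Eh -(eqp_ltrans (mulp_gcdr _ _ _)).
  by rewrite -{2}[D]mulr1 eqp_mul2l // -size_poly_eq1.
have g0 : g != 0 by apply: contraNneq c10 => g0; rewrite Eg g0 mulr0.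
have sg := size_cpoly a l1; have sh := size_cpoly a l2.
rewrite -/c1 Eg size_mul // in sg.
have D1 : (0 < size D)%N by rewrite lt0n size_poly_eq0.
have g1 : (0 < size g)%N by rewrite lt0n size_poly_eq0.
have {}sh : (size D + size h <= n.+2)%N.
  have [->|h0] := eqVneq h 0; first by rewrite size_poly0; plia.
  by move: sh; rewrite -/c2 Eh size_mul //; plia.
(* A constant moving part would give a nontrivial combination of [l1] and [l2] with zero
   pullback. *)
have mx1 : (1 < maxn (size g) (size h))%N.
  rewrite ltnNge geq_max; apply/negP => /andP[/size1_polyC gc /size1_polyC hc].
  set x := g`_0 in gc; set y := h`_0 in hc.
  have : cpoly (y *: l1 - x *: l2) = 0.
    by rewrite cpolyB !cpolyZ -/c1 -/c2 Eg Eh gc hc -!mul_polyC; ring.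
  move/(cpoly_eq0 charK0 a_proper n_gt1); rewrite -scaleNr => /ind[_ /eqP].
  by rewrite oppr_eq0 => /eqP x0; move: g0; rewrite gc x0 eqxx.
(* This is the degree of the fixed divisor as a form; the degree of [D] is smaller when the divisor
   contains infinity. *)
exists (n.+1 - maxn (size g) (size h))%N, D, g, h.
have ? : (maxn (size g) (size h) <= n.+1)%N by rewrite geq_max; plia.
split=> //; first by plia.
split=> //; last by plia.
have : (maxn (size g) (size h) <= n.+2 - size D)%N by rewrite geq_max; plia.
by plia.
Qed.

Lemma pencil_exists P : P != 0 -> exists m l1 l2 D g h, pencil P m l1 l2 D g h.
Proof.
move=> /annpairP [l1 [l2 /pencil_of_annpair [m [D [g [h H]]]]]].
by exists m, l1, l2, D, g, h.
Qed.

Lemma ann_same_pt P l1 l2 y : annpair P l1 l2 -> y != 0 -> lf l1 y = 0 -> lf l2 y = 0 ->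
  same_pt y P.
Proof.
move=> [_ pt _] y0 y1 y2; have [c cy] := pt _ y1 y2; exists c => //.
by apply: contraNneq y0 => c0; rewrite cy c0 scale0r.
Qed.

Lemma pencil_root P m l1 l2 D g h r : pencil P m l1 l2 D g h -> root D r ->
  same_pt (param (aff r)) P.
Proof.
case=> ann [E1 E2] _ _ _ /eqP Dr; apply: (ann_same_pt ann).
- by apply: (proj1 a_proper); exact: aff_neq0.
- by rewrite lf_param_aff E1 hornerM Dr mul0r.
- by rewrite lf_param_aff E2 hornerM Dr mul0r.
Qed.

Lemma coef_mul_lt (p q : {poly K}) d e : (size p <= d)%N -> (size q <= e.+1)%N ->
  (p * q)`_(d + e) = 0.
Proof.
move=> sp sq; have [->|p0] := eqVneq p 0; first by rewrite mul0r coef0.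
have [->|q0] := eqVneq q 0; first by rewrite mulr0 coef0.
have := p0; rewrite -size_poly_eq0 => p1.
by apply/leq_sizeP: (leqnn (d + e)%N); rewrite size_mul //; plia.
Qed.

Lemma pencil_inf P m l1 l2 D g h : pencil P m l1 l2 D g h -> (size D <= m)%N ->
  same_pt (param infpt) P.
Proof.
case=> ann [E1 E2] _ se [sD D0 mn] sDm; apply: (ann_same_pt ann).
- by apply: (proj1 a_proper); exact: infpt_neq0.
- rewrite lf_param_inf E1; have -> : n = (m + (n - m))%N by plia.
  by apply: coef_mul_lt => //; rewrite -se leq_maxl.
- rewrite lf_param_inf E2; have -> : n = (m + (n - m))%N by plia.
  by apply: coef_mul_lt => //; rewrite -se leq_maxr.
Qed.

(** A common divisor [G] divides [D]. The bounds on the cofactors make it a divisor of degree [k] as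
    a form, zeros at infinity included, so that [k] is compared with [m] and not with the degree of
    [D]. *)
Lemma pencil_max P m l1 l2 D g h G q1 q2 k : pencil P m l1 l2 D g h -> (k <= n)%N ->
  G != 0 -> cpoly l1 = G * q1 -> cpoly l2 = G * q2 -> 
  (size q1 <= (n - k).+1)%N -> (size q2 <= (n - k).+1)%N -> (k <= m)%N.
Proof.
case=> _ [E1 E2] cop se [sD D0 mn] kn G0 e1 e2 s1 s2.
have GD : G %| D.
  have : G %| gcdp (D * g) (D * h) by rewrite dvdp_gcd -E1 -E2 e1 e2 !dvdp_mulIl.
  rewrite -(eqp_dvdr _ (mulp_gcdr _ _ _)) (eqp_dvdr _ (_ : D * gcdp g h %= D)) //.
  by rewrite -{2}[D]mulr1 eqp_mul2l // -size_poly_eq1.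
have [D1 ED] : exists D1, D = G * D1 by exists (D %/ G); rewrite mulrC divpK.
have D10 : D1 != 0 by apply: contraNneq D0 => z; rewrite ED z mulr0.
have q1E : q1 = D1 * g by apply: (mulfI G0); rewrite -e1 E1 ED mulrA.
have q2E : q2 = D1 * h by apply: (mulfI G0); rewrite -e2 E2 ED mulrA.
have sD1 : (0 < size D1)%N by rewrite lt0n size_poly_eq0.
have aux (q : {poly K}) : (size (D1 * q)%R <= (n - k).+1)%N -> (size q <= (n - k).+1)%N.
  have [->|q0] := eqVneq q 0; first by rewrite size_poly0.
  by rewrite size_mul //; plia.
have : (maxn (size g) (size h) <= (n - k).+1)%N by rewrite geq_max (aux g) -?q1E ?(aux h) -?q2E.
by rewrite se; plia.
Qed.

(** On the line through [P] and [x], the points other than [P] have the ratio l1 : l2 of [x], so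
    those on C come from the zeros of one member of the moving pencil. For general [x] these are n -
    m simple zeros, and generic injectivity separates their images. *)
Lemma line_general P m l1 l2 D g h (E : {poly K}) : pencil P m l1 l2 D g h -> E != 0 ->
  exists2 B : {mpoly K[3]}, B != 0 & forall x, hval B x != 0 ->
  exists ts : seq K, [/\ uniq ts, size ts = (n - m)%N
    & forall t, t \in ts -> exists r c, [/\ E.[r] != 0, c != 0 & x + t *: P = c *: param (aff r)]].
Proof.
case=> ann [E1 E2] cop se [sD D0 mn] E0.
have [sp pt ind] := ann.
have [I I0 HI] := generic_inj a_proper.
(* Zeros of [D] map to [P] itself, and zeros of [I] may share their image with another parameter. *)
have EDI0 : E * D * I != 0 by rewrite !mulf_neq0.
have [bad [b0 Hbad]] := pencil_general charK0 cop se EDI0.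
(* With [l1] nonzero at [x], a point of the line can be scaled to agree with [x] under [l1], and
   then it differs from [x] by a multiple of [P]. The other factors keep the direction of [x] out of
   [bad]. *)
exists (lin_form l1 * \prod_(w <- bad) lin_form (w.2 *: l1 - w.1 *: l2)).
  rewrite mulf_neq0 //.
    apply/negP => /eqP /lin_form_eq0 l10; have [] := ind 1 0.
      by rewrite l10 scaler0 scale0r addr0.
    by move/eqP; rewrite oner_eq0.
  rewrite prodf_seq_neq0; apply/allP => w wb /=; apply/negP => /eqP /lin_form_eq0.
  rewrite -scaleNr => /ind[w2 /eqP]; rewrite oppr_eq0 => /eqP w1.
  by have := allP b0 _ wb; rewrite [w]surjective_pairing w1 w2 eqxx.
move=> x; rewrite hvalM mulf_eq0 negb_or hval_lin_form => /andP[u0 Hx].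
set u := lf l1 x in u0 *; set v := lf l2 x.
have [|rs [urs srs /allP rl /allP rE]] := Hbad u v.
  apply/allP => w wb; move: Hx; rewrite /hval rmorph_prod prodf_seq_neq0 => /allP /(_ _ wb) /=.
  by rewrite -/(hval _ _) hval_lin_form lfBl !lfZl mulrC [w.1 * _]mulrC.
have /rV0Pn[i Pi] : P != 0.
  apply/negP => /eqP P0; have /sp[x1 [y1 e1]] : lf (delta_mx 0 0 : 'rV[K]_3) P = 0.
    by rewrite lf_delta P0 mxE.
  have [w /rV0Pn[j wj] [w1 w2]] : exists2 w : 'rV[K]_3, w != 0 & lf l1 w = 0 /\ lf l2 w = 0.
    have [w w0 ann'] := indep_annpair ind; exists w => //; exact: annpair_ann ann'.
  have [d dw] := pt _ w1 w2; move: wj; rewrite dw P0 scaler0 mxE eqxx //.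
pose y r := param (aff r); pose c r := u / lf l1 (y r).
have key r : r \in rs -> [/\ E.[r] != 0, I.[r] != 0, c r != 0 &
   exists t, c r *: y r - x = t *: P].
  move=> rin; have := rE _ rin; rewrite !hornerM !mulf_eq0 !negb_or -andbA => /and3P[Er Dr Ir].
  have := rl _ rin; rewrite rootE !hornerE subr_eq0 => /eqP R.
  have y1 : lf l1 (y r) = D.[r] * g.[r] by rewrite lf_param_aff E1 hornerM.
  have y2 : lf l2 (y r) = D.[r] * h.[r] by rewrite lf_param_aff E2 hornerM.
  have gr : g.[r] != 0.
    apply/negP => /eqP gr; move: R; rewrite gr mulr0 => /eqP; rewrite mulf_eq0 (negPf u0) /=.
    by apply/negP; apply: coprimep_root cop _; rewrite rootE gr.
  have ly : lf l1 (y r) != 0 by rewrite y1 mulf_neq0.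
  split=> //; first by rewrite u0 invr_eq0.
  apply: pt; first by rewrite lfBr lfZr mulrVK ?unitfE ?subrr.
  have Dr0 : D.[r] != 0 by [].
  rewrite lfBr lfZr /c y1 y2; apply/eqP; rewrite subr_eq0; apply/eqP.
  by apply: (mulIf gr); rewrite -/v -R; field; rewrite Dr0 gr.
pose T r := (c r * y r 0 i - x 0 i) / P 0 i.
have TE r : r \in rs -> x + T r *: P = c r *: y r.
  move=> /key [_ _ _ [t Et]]; have -> : T r = t.
    have /rowP/(_ i) := Et; rewrite /T !mxE => ->.
    by rewrite mulfK.
  by rewrite -Et addrC subrK.
exists [seq T r | r <- rs]; split.
- rewrite map_inj_in_uniq // => r s rin sin rs_eq.
  have [_ Ir cr0 _] := key _ rin; have [_ _ cs0 _] := key _ sin.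
  apply: same_aff; apply: same_pt_sym; apply: HI => //; first exact: aff_neq0.
  exists ((c s)^-1 * c r); first by rewrite mulf_neq0 ?invr_eq0.
  by rewrite -scalerA -[param (aff r)]/(y r) -[param (aff s)]/(y s) -TE // rs_eq TE // scalerA mulVf ?scale1r.
- by rewrite size_map.
- move=> t /mapP[r rin ->]; exists r, (c r); have [Er _ cr0 _] := key _ rin.
  by split=> //; exact: TE.
Qed.
End PencilAt.

(** [minor] asks for increasing selections of rows and columns; an arbitrary injective one is sorted
    at the cost of a sign. *)
Lemma sort_ord r p (f : 'I_r -> 'I_p) : injective f ->
  exists (f' : 'I_r -> 'I_p) (s : 'S_r),
    {homo f' : i j / (i < j)%N} /\ f =1 f' \o s.
Proof.
move=> inj; pose A := f @: 'I_r.
have cA : #|A| = r by rewrite card_imset // card_ord.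
pose f' (i : 'I_r) : 'I_p := enum_val (cast_ord (esym cA) i).
have fA i : f i \in A by apply: imset_f.
pose s i := cast_ord cA (enum_rank_in (fA i) (f i)).
have fs i : f' (s i) = f i by rewrite /f' /s cast_ordK enum_rankK_in.
have sinj : injective s by move=> i j e; apply: inj; rewrite -!fs e.
exists f', (perm sinj); split; last by move=> i /=; rewrite permE fs.
move=> i j ij; have srt : sorted ltn (map val (enum A)).
  rewrite /enum_mem -enumT.
  apply: (@sub_sorted _ ltn) => //; rewrite sorted_map.
  apply: sorted_filter; first by move=> x y z; apply: ltn_trans.
  by rewrite -sorted_map val_enum_ord iota_ltn_sorted.
have sz : size (map val (enum A)) = r by rewrite size_map -cardE.
have E t : val (f' t) = nth 0%N (map val (enum A)) t.
  rewrite /f' (enum_val_nth (f t)) (nth_map (f t)) //.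
  by rewrite -cardE cA.
rewrite [X in (X < _)%N]E [X in (_ < X)%N]E.
by apply: (sorted_ltn_nth ltn_trans) => //; rewrite inE sz.
Qed.

Lemma mxsub_perm_det (R : comNzRingType) p q r (M : 'M[R]_(p, q)) f g f' g' (s t : 'S_r) :
  f =1 f' \o s -> g =1 g' \o t ->
  \det (mxsub f g M) = (-1) ^+ s * (-1) ^+ t * \det (mxsub f' g' M).
Proof.
move=> fs gt; have -> : mxsub f g M = row_perm s (col_perm t (mxsub f' g' M)).
  by apply/matrixP => i j; rewrite !mxE fs gt.
by rewrite row_permE col_permE !det_mulmx !det_perm odd_permV mulrA mulrAC.
Qed.

(** * The points of X_k *)

Section MinorRank.
Variable F : fieldType.

Lemma mxrank_mxsub p q r s (M : 'M[F]_(p, q)) (f : 'I_r -> 'I_p) (g : 'I_s -> 'I_q) :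
  (\rank (mxsub f g M) <= \rank M)%N.
Proof.
have -> : mxsub f g M = rowsub f (colsub g M) by apply/matrixP => i j; rewrite !mxE.
apply: leq_trans (mxrankS (rowsub_sub _ _)) _.
by rewrite -mxrank_tr -[leqRHS]mxrank_tr trmx_mxsub mxrankS // rowsub_sub.
Qed.

Lemma minors_rank p q r (M : 'M[F]_(p, q)) :
  (forall x, minor r M x -> x = 0) <-> (\rank M < r)%N.
Proof.
split=> [H|rM x [f [g [_ _ ->]]]]; last first.
  apply/eqP; apply: contraTT rM; rewrite -leqNgt -unitfE -unitmxE => u.
  by rewrite -{1}(mxrank_unit u) mxrank_mxsub.
rewrite ltnNge; apply/negP => rM.
pose f (i : 'I_r) := maxrankfun M (widen_ord rM i).
have finj : injective f by move=> i j /maxrankfun_inj /(congr1 val) /= /val_inj.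
have rf : row_free (rowsub f M).
  have -> : rowsub f M = rowsub (widen_ord rM) (rowsub (maxrankfun M) M).
    by apply/matrixP => i j; rewrite !mxE.
  have /row_freeP[B HB] := maxrowsub_free M.
  apply/row_freeP; exists (B *m (rowsub (widen_ord rM) 1%:M)^T).
  rewrite mulmxA [rowsub _ _]rowsubE -(mulmxA _ _ B) HB mulmx1.
  apply/matrixP => i j; rewrite !mxE (bigD1 (widen_ord rM i)) //= !mxE eqxx mul1r.
  rewrite big1 ?addr0 => [|k]; last by rewrite !mxE eq_sym => /negPf ->; rewrite mul0r.
  by rewrite eq_sym; congr (_ %:R); apply/eqP/eqP => [/(congr1 val)/val_inj|->].
have rfull : row_full (rowsub f M)^T by rewrite /row_full mxrank_tr.
pose g := fullrankfun rfull.
have ginj : injective g by exact: fullrankfun_inj.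
have [f' [s [f'h fE]]] := sort_ord finj; have [g' [t [g'h gE]]] := sort_ord ginj.
have /H m0 : minor r M (\det (mxsub f' g' M)) by exists f', g'.
have := fullrowsub_unit rfull; rewrite unitmxE -/g.
have -> : rowsub g (rowsub f M)^T = (mxsub f g M)^T by apply/matrixP => i j; rewrite !mxE.
by rewrite det_tr (mxsub_perm_det _ fE gE) m0 mulr0 unitr0.
Qed.

End MinorRank.

Section Xchar.
Variables (K : closedFieldType) (n : nat) (a : 'M[K]_(3, n.+1)).
Local Notation cpoly := (cpoly a).

(** In monomial bases, multiplication by [G_R] from polynomials of degree at most n - k to
    polynomials of degree at most n. *)
Definition shiftmx k (R : 'rV[K]_k.+1) : 'M[K]_((n - k).+1, n.+1) :=
  \matrix_(i, j) (if (i <= j <= i + k)%N then R 0 (inord (j - i)) else 0).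

Lemma Xpts_rank k (R : 'rV[K]_k.+1) :
  Xpts a R <-> R != 0 /\ (\rank (col_mx (shiftmx R) a) < n - k + 3)%N.
Proof.
pose ev := meval (R 0) : {mpoly K[k.+1]} -> K.
have evE : map_mx ev (Mmat a k) = col_mx (shiftmx R) a.
  rewrite map_col_mx; congr col_mx; apply/matrixP => i j; rewrite !mxE.
    by rewrite /ev; case: ifP => _; rewrite ?mevalXU ?meval0.
  exact: mevalC.
have minE x : minor (n - k + 3) (col_mx (shiftmx R) a) x <->
    exists2 y, minor (n - k + 3) (Mmat a k) y & x = ev y.
  split=> [[f [g [fh gh ->]]]|[_ [f [g [fh gh ->]]] ->]].
    exists (\det (mxsub f g (Mmat a k))); first by exists f, g.
    rewrite -evE -map_mxsub; exact: det_map_mx.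
  exists f, g; split=> //.
  rewrite -evE -map_mxsub; apply/esym; exact: det_map_mx.
rewrite /Xpts /zeros -minors_rank; split=> -[R0 H]; split=> //.
  move=> x /minE[y my ->]; apply: H; exists 1%N, (fun=> 1), (fun=> y).
  by split=> //; rewrite big_ord1 mul1r.
move=> F [r [c [g [mg ->]]]]; rewrite /hval raddf_sum big1 // => i _ /=.
rewrite mevalM (H (g i).@[R 0]) ?mulr0 //.
by apply/minE; exists (g i).
Qed.

Lemma shiftmx_mul k (R : 'rV[K]_k.+1) (u : 'rV_(n - k).+1) : (k <= n)%N ->
  rVpoly (u *m shiftmx R) = rVpoly u * rVpoly R.
Proof.
move=> kn; apply/polyP => j; rewrite coefM.
have [jn|jn] := ltnP j n.+1; last first.
  have /leq_sizeP -> // : (size (rVpoly (u *m shiftmx R)) <= n.+1)%N by exact: size_poly.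
  apply/esym; apply: big1 => i _; case: (ltnP i (n - k).+1) => ik.
    have /leq_sizeP -> // : (size (rVpoly R) <= k.+1)%N by exact: size_poly.
      by rewrite mulr0.
    by lia.
  have /leq_sizeP -> // : (size (rVpoly u) <= (n - k).+1)%N by exact: size_poly.
  by rewrite mul0r.
have -> : j = Ordinal jn by [].
rewrite coef_rVpoly_ord mxE /=.
pose F i := (rVpoly u)`_i * (if (i <= j)%N then (rVpoly R)`_(j - i) else 0).
transitivity (\sum_(i < (n - k).+1) F i).
  apply: eq_bigr => i _; rewrite /F coef_rVpoly_ord !mxE /=; congr (_ * _).
  case: (leqP i j) => //= ij; case: (leqP j (i + k)) => jk.
    have jik : (j - i < k.+1)%N by lia.
    have -> : inord (j - i) = Ordinal jik :> 'I_k.+1 by apply: val_inj; rewrite /= inordK.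
    by rewrite -[in RHS]/(nat_of_ord (Ordinal jik)) coef_rVpoly_ord.
  have /leq_sizeP -> // : (size (rVpoly R) <= k.+1)%N by exact: size_poly.
  by lia.
transitivity (\sum_(i < n.+1) F i).
  rewrite (big_ord_widen n.+1 F); last by lia.
  rewrite big_mkcond; apply: eq_bigr => i _; case: ifP => // /negbT; rewrite -leqNgt => ik.
  by rewrite /F; have /leq_sizeP -> // : (size (rVpoly u) <= (n - k).+1)%N by [exact: size_poly]; rewrite mul0r.
transitivity (\sum_(i < n.+1 | (i < j.+1)%N) F i).
  rewrite [RHS]big_mkcond; apply: eq_bigr => i _; case: ifP => //.
  by rewrite ltnS /F => ->; rewrite mulr0.
rewrite -(big_ord_widen n.+1 F) //; apply: eq_bigr => i _.
by rewrite /F -ltnS ltn_ord.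
Qed.

(* [G] divides the pullback of the linear form [l], as forms of degree k and n. *)
Definition fdvd k (G : {poly K}) l := exists2 q : {poly K}, (size q <= (n - k).+1)%N & cpoly l = G * q.

Lemma fdvd_sub k (R : 'rV[K]_k.+1) l : (k <= n)%N ->
  fdvd k (rVpoly R) l <-> (l *m a <= shiftmx R)%MS.
Proof.
move=> kn; split=> [[q sq E]|/submxP[u E]].
  apply/submxP; exists (poly_rV q); apply: (can_inj rVpolyK).
  by rewrite shiftmx_mul // poly_rV_K // -/(cpoly l) E mulrC.
exists (rVpoly u); first exact: size_poly.
by rewrite /cpoly E shiftmx_mul // mulrC.
Qed.

Hypothesis charK0 : [pchar K] =i pred0.
Hypothesis n_gt1 : (1 < n)%N.
Hypothesis a_proper : proper_param a.

Lemma row_free_a : row_free a.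
Proof.
rewrite -kermx_eq0; apply/rowV0P => l /sub_kermxP la.
apply: (cpoly_eq0 charK0 a_proper n_gt1); by rewrite /(cpoly) la linear0.
Qed.

Lemma rVpoly_eq0 k (R : 'rV[K]_k) : (rVpoly R == 0) = (R == 0).
Proof. by apply/eqP/eqP => [E|->]; [rewrite -[R]rVpolyK E linear0|exact: linear0]. Qed.

Lemma row_free_shiftmx k (R : 'rV[K]_k.+1) : (k <= n)%N -> R != 0 -> row_free (shiftmx R).
Proof.
move=> kn R0; rewrite -kermx_eq0; apply/rowV0P => u /sub_kermxP uS.
have /eqP := shiftmx_mul R u kn; rewrite uS linear0 eq_sym mulf_eq0 !rVpoly_eq0 (negPf R0) orbF.
by move/eqP.
Qed.

(** Both blocks of rows are free, of ranks n - k + 1 and 3, so the rank is below n - k + 3 exactly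
    when their row spaces meet in dimension at least 2. A common row is both a multiple of [G_R] and
    the pullback of a linear form. *)
Lemma XptsP k (R : 'rV[K]_k.+1) : (k <= n)%N ->
  Xpts a R <-> R != 0 /\ exists l1 l2,
    [/\ forall x y : K, x *: l1 + y *: l2 = 0 -> x = 0 /\ y = 0,
        fdvd k (rVpoly R) l1 & fdvd k (rVpoly R) l2].
Proof.
move=> kn; rewrite Xpts_rank.
suff H : R != 0 -> (\rank (col_mx (shiftmx R) a) < n - k + 3)%N <-> exists l1 l2,
    [/\ forall x y : K, x *: l1 + y *: l2 = 0 -> x = 0 /\ y = 0,
        fdvd k (rVpoly R) l1 & fdvd k (rVpoly R) l2].
  by split=> -[R0 /(H R0)].
move=> R0; set T := shiftmx R.
have rT : \rank T = (n - k).+1 by apply/eqP; exact: row_free_shiftmx.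
have ra : \rank a = 3 by apply/eqP; exact: row_free_a.
have rsum := mxrank_sum_cap T a; rewrite rT ra addsmxE in rsum.
have aux c r : (c + r = (n - k).+1 + 3 -> (c < n - k + 3) = (2 <= r))%N by lia.
rewrite (aux _ _ rsum).
split=> [r2|[l1 [l2 [ind d1 d2]]]].
  have /submxP[X EX] := capmxSr T a.
  have rX : (2 <= \rank X)%N by apply: leq_trans r2 _; rewrite EX mxrankM_maxl.
  pose i0 := Ordinal (ltnW rX); pose i1 := Ordinal rX.
  pose l i := row i (row_base X).
  have ld i : fdvd k (rVpoly R) (l i).
    apply/fdvd_sub => //; apply: submx_trans (capmxSl T a); rewrite EX.
    by rewrite submxMr // /l; apply: submx_trans (row_sub _ _) _; rewrite eq_row_base.
  exists (l i0), (l i1); split=> // x y.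
  have -> : x *: l i0 + y *: l i1 = (x *: delta_mx 0 i0 + y *: delta_mx 0 i1) *m row_base X.
    by rewrite mulmxDl -!scalemxAl /l !rowE.
  move/eqP; rewrite mulmx_free_eq0 ?row_base_free // => /eqP /rowP E.
  by split; [have := E i0|have := E i1]; rewrite !mxE /= ?mulr1 ?mulr0 ?addr0 ?add0r.
have /fdvd_sub s1 := d1; have /fdvd_sub s2 := d2.
have : (col_mx l1 l2 *m a <= T :&: a)%MS.
  by rewrite sub_capmx submxMl andbT mul_col_mx col_mx_sub s1 ?s2.
move/mxrankS; rewrite mxrankMfree ?row_free_a //; apply: leq_trans.
have : row_free (col_mx l1 l2); last by move/eqP ->.
rewrite -kermx_eq0; apply/rowV0P => u /sub_kermxP.
rewrite -[u]hsubmxK mul_row_col [lsubmx u]mx11_scalar [rsubmx u]mx11_scalar !mul_scalar_mx.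
by move/ind => [-> ->]; rewrite !raddf0 row_mx0.
Qed.

End Xchar.

(** * Finiteness of X_k *)

Section ZeroDim.
Variables (K : fieldType) (m : nat).
Implicit Types (v w : 'rV[K]_m.+1) (X Z A B : 'rV[K]_m.+1 -> Prop).

Lemma zariski_same_pt Z v w : zariski_closed Z -> same_pt v w -> Z w -> Z v.
Proof.
case=> S homS ZS vw; have [c c0 cv] := vw; rewrite !ZS => -[w0 Hw]; split.
  exact: same_pt_neq0 vw w0.
move=> F SF; have [d /hvalZ_homog hF] := homS _ SF.
by rewrite cv hF Hw // mulr0.
Qed.

Lemma zariski_union A B : zariski_closed A -> zariski_closed B ->
  zariski_closed (fun v => A v \/ B v).
Proof.
case=> S homS AS [T homT BT].
exists (fun F => exists2 G, S G & exists2 H, T H & F = G * H).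
  move=> F [G /homS[d dG] [H /homT[e eH] ->]]; exists (d + e)%N; exact: dhomogM.
move=> v; split=> [[/AS[v0 Hv]|/BT[v0 Hv]]|[v0 Hv]].
- by split=> // _ [G SG [H TH ->]]; rewrite hvalM Hv ?mul0r.
- by split=> // _ [G SG [H TH ->]]; rewrite hvalM (Hv H) ?mulr0.
case: (classic (A v)) => [Av|nAv]; [by left|right].
apply/BT; split=> // H TH; apply: NNPP => /eqP Hn; apply: nAv; apply/AS; split=> // G SG.
have /eqP : hval (G * H) v = 0 by apply: Hv; exists G => //; exists H.
by rewrite hvalM mulf_eq0 (negPf Hn) orbF => /eqP.
Qed.

Lemma zariski_point w : zariski_closed (fun v => v != 0 /\ same_pt v w).
Proof.
have [->|w0] := eqVneq w 0.
  (* No nonzero vector is proportional to 0, so the set is empty, with equation 1 = 0. *)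
  exists (fun F => F = 1); first by move=> F ->; exists 0%N; apply: dhomog1.
  move=> v; split=> [[v0 [c _]]|[_ /(_ 1 erefl)]]; first by rewrite scaler0 => v00; rewrite v00 eqxx in v0.
  by rewrite /hval meval1 => /eqP; rewrite oner_eq0.
exists (fun F => exists i j, F = w 0 i *: 'X_j - w 0 j *: 'X_i).
  move=> _ [i [j ->]]; exists 1%N; apply: rpredB; apply: dhomogZ; rewrite dhomogX /=; apply/eqP; exact: mdeg1.
have ev v i j : hval (w 0 i *: 'X_j - w 0 j *: 'X_i) v = w 0 i * v 0 j - w 0 j * v 0 i.
  by rewrite /hval mevalB !mevalZ !mevalXU.
move=> v; split=> [[v0 [c c0 ->]]|[v0 Hv]]; split=> //.
- by rewrite scaler_eq0 negb_or c0.
- by move=> _ [i [j ->]]; rewrite ev !mxE; ring.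
have /rV0Pn[i wi] := w0.
have E : v = (v 0 i / w 0 i) *: w.
  apply/rowP => j; rewrite mxE; apply: (mulfI wi).
  have /eqP : hval (w 0 i *: 'X_j - w 0 j *: 'X_i) v = 0 by apply: Hv; exists i, j.
  by rewrite ev subr_eq0 => /eqP ->; field.
exists (v 0 i / w 0 i) => //; apply: contraNneq v0 => c0.
by rewrite E c0 scale0r.
Qed.

Lemma zariski_ext A B : (forall v, A v <-> B v) -> zariski_closed A -> zariski_closed B.
Proof. by move=> AB [S homS AS]; exists S => // v; rewrite -AB. Qed.

Lemma zariski_points (L : seq 'rV[K]_m.+1) :
  zariski_closed (fun v => v != 0 /\ exists2 w, w \in L & same_pt v w).
Proof.
elim: L => [|x L IH].
  exists (fun F => F = 1); first by move=> F ->; exists 0%N; apply: dhomog1.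
  move=> v; split=> [[v0 []//]|[_ /(_ 1 erefl)]].
  by rewrite /hval meval1 => /eqP; rewrite oner_eq0.
apply: zariski_ext (zariski_union (zariski_point x) IH) => v; split.
  case=> [[v0 vx]|[v0 [w wL vw]]]; split=> //; first by exists x; rewrite ?mem_head.
  by exists w; rewrite ?inE ?wL ?orbT.
case=> v0 [w]; rewrite inE => /orP[/eqP ->|wL] vw; [by left|right].
by split=> //; exists w.
Qed.

Lemma irreducible_points (L : seq 'rV[K]_m.+1) Z : irreducible_closed Z ->
  (forall v, Z v -> exists2 w, w \in L & same_pt v w) ->
  exists w, forall v, Z v -> same_pt v w.
Proof.
case=> Zc [z Zz] irr; elim: L => [|x L IH] ZL; first by case: (ZL z Zz).
have Z0 v : Z v -> v != 0 by case: Zc => S _ ZS /ZS[].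
have [|H|H] := irr _ _ (zariski_point x) (zariski_points L).
- move=> v Zv; have [w] := ZL v Zv; rewrite inE => /orP[/eqP ->|wL] vw; [left|right]; split=> //; try exact: Z0.
  by exists w.
- by exists x => v /H[].
- by apply: IH => v /H[].
Qed.

(** An irreducible closed set covered by finitely many points is a single point, so no chain in [X]
    has two members. *)
Lemma finite_dim0 (L : seq 'rV[K]_m.+1) X : nonempty X ->
  (forall v, X v -> v != 0) -> (forall v w, same_pt v w -> X w -> X v) ->
  (forall v, X v -> exists2 w, w \in L & same_pt v w) -> has_dim X 0.
Proof.
case=> x Xx X0 Xsame XL; split.
  exists (fun _ v => v != 0 /\ same_pt v x); split=> [i _|[]//]; split; last by move=> v [_ /Xsame]; apply.
  split; first exact: zariski_point.
    by exists x; split; [exact: X0|exact: same_pt_refl].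
  move=> A B cA cB AB; have [] := AB x.
  - by split; [exact: X0|exact: same_pt_refl].
  - by move=> Ax; left=> v [_ vx]; apply: zariski_same_pt vx Ax.
  - by move=> Bx; right=> v [_ vx]; apply: zariski_same_pt vx Bx.
case=> Z [Zi /(_ 0%N isT)[Z01 []]].
have [[Z0c [z Zz] _] _] := Zi 0%N isT; have [irr1 Z1X] := Zi 1%N isT.
have [|w Hw] := irreducible_points (L := L) irr1.
  by move=> v /Z1X; apply: XL.
move=> v /Hw vw; apply: (zariski_same_pt Z0c _ Zz).
by apply: same_pt_trans vw (same_pt_sym (Hw _ (Z01 _ Zz))).
Qed.

End ZeroDim.

(** Meant for the lists of affine zeros of [G_R]: they have length at most k, take values in a fixed
    finite set, and determine R up to a scalar. *)
Lemma short_words (T : eqType) (s : seq T) k : exists L : seq (seq T),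
  forall w, (size w <= k)%N -> {subset w <= s} -> w \in L.
Proof.
elim: k => [|k [L HL]].
  by exists [:: [::]] => -[].
exists ([::] :: [seq x :: w | x <- s, w <- L]) => -[|x w]; rewrite ?mem_head //= => wk ws.
rewrite inE /=; apply/allpairsP; exists (x, w); split=> //=; first by apply: ws; rewrite mem_head.
by apply: HL => // y yw; apply: ws; rewrite inE yw orbT.
Qed.

Section XFinite.
Variables (K : closedFieldType) (n : nat) (a : 'M[K]_(3, n.+1)).
Hypothesis charK0 : [pchar K] =i pred0.
Hypothesis n_gt1 : (1 < n)%N.
Hypothesis a_proper : proper_param a.
Local Notation cpoly := (cpoly a).
Local Notation param := (param a).

Lemma fdvd_root k (R : 'rV[K]_k.+1) l r : fdvd a k (rVpoly R) l -> root (rVpoly R) r ->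
  lf l (param (aff r)) = 0.
Proof. by case=> q _ E /eqP Rr; rewrite lf_param_aff E hornerM Rr mul0r. Qed.

Lemma fdvd_inf k (R : 'rV[K]_k.+1) l : (k <= n)%N -> fdvd a k (rVpoly R) l ->
  (size (rVpoly R) <= k)%N -> lf l (param infpt) = 0.
Proof.
move=> kn [q sq E] sR; rewrite lf_param_inf E.
by have -> : n = (k + (n - k))%N by [lia]; apply: coef_mul_lt.
Qed.

Lemma lf_deriv l r :
  lf l (\row_u (cpoly (delta_mx 0 u))^`().[r]) = (cpoly l)^`().[r].
Proof.
rewrite (cpoly_sum _ l) raddf_sum /= -horner_evalE raddf_sum /lf; apply: eq_bigr => u _.
by rewrite mxE /= derivZ /horner_eval hornerZ.
Qed.

(* A point of G_R on which f is unramified and injective cannot be followed by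
   a second point of G_R over the same point of C. *)
Lemma X_roots : exists2 E : {poly K}, E != 0 &
  forall k (R : 'rV[K]_k.+1), (2 <= k <= n)%N -> Xpts a R ->
  forall r, root (rVpoly R) r -> root E r.
Proof.
have [I I0 HI] := generic_inj a_proper.
have d0 : delta_mx 0 0 != 0 :> 'rV[K]_3 by apply/rV0Pn; exists 0; rewrite mxE !eqxx oner_eq0.
have [m [l1 [l2 [D [g [h [_ [E1 E2] cop se [_ D0 mn]]]]]]]] :=
  pencil_exists charK0 n_gt1 a_proper d0.
have Wgh : wronskian g h != 0.
  by apply: (wronskian_neq0 (e := (n - m).-1) charK0 cop); rewrite se; lia.
(* It vanishes wherever the tangent vector of the parameterization is proportional to its value, so
   this single pencil serves for all points of X_k. *)
pose W := wronskian (cpoly l1) (cpoly l2).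
have WE : W = D ^+ 2 * wronskian g h.
  by rewrite /W /wronskian E1 E2 !derivM; ring.
exists (I * W); first by rewrite WE !mulf_neq0 ?expf_neq0.
move=> k R /andP[k2 kn] /(XptsP charK0 n_gt1 a_proper _ kn) [R0 [k1' [k2' [ind d1 d2]]]] r Rr.
rewrite rootM; apply/orP; have [Ir|Ir] := boolP (root I r); [by left|right].
have [P P0 ann] := indep_annpair ind.
have base q : q != 0 -> param q != 0 by apply: (proj1 a_proper).
have rP : same_pt (param (aff r)) P.
  by apply: (ann_same_pt ann (base _ (aff_neq0 r))); exact: fdvd_root Rr.
have uniqpt q : q != 0 -> same_pt (param q) P -> same_pt q (aff r).
  move=> q0 qP; apply: HI => //.
  exact: same_pt_trans qP (same_pt_sym rP).
have /factor_theorem[G1 EG] := Rr.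
have RV0 : rVpoly R != 0 by rewrite rVpoly_eq0.
have G10 : G1 != 0 by apply: contraNneq RV0 => G10; rewrite EG G10 mul0r.
(* As k >= 2, [G_R] has a second zero, a root of [G1] or else infinity. Injectivity excludes
   infinity and forces a root of [G1] to be [r] again. *)
have [/closed_rootP[s G1s]|] := boolP (size G1 != 1%N); last first.
  rewrite negbK => /eqP sG1; have sR : (size (rVpoly R) <= k)%N.
    by rewrite EG size_mul ?polyXsubC_eq0 // size_XsubC sG1.
  case: (@aff_infpt K r); apply: same_pt_sym; apply: uniqpt; first exact: infpt_neq0.
  by apply: (ann_same_pt ann (base _ (infpt_neq0 K))); apply: fdvd_inf sR.
have Rs : root (rVpoly R) s by rewrite EG rootM G1s.
have sr : s = r.
  apply: same_aff; apply: uniqpt; first exact: aff_neq0.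
  by apply: (ann_same_pt ann (base _ (aff_neq0 s))); exact: fdvd_root Rs.
rewrite {s Rs}sr in G1s.
have dz l : fdvd a k (rVpoly R) l -> (cpoly l)^`().[r] = 0.
  have /factor_theorem[G2 EG2] := G1s => -[q _ ->].
  by rewrite EG EG2 !derivM !derivXsubC !hornerE subrr; ring.
have [_ pt _] := ann.
(* Since [r] is a double zero of [G_R], both forms also vanish on the tangent vector [y], which is
   thus a multiple of [P]. *)
set y := (\row_u (cpoly (delta_mx 0 u))^`().[r] : 'rV[K]_3).
have [c yP] : exists c, y = c *: P by apply: pt; rewrite lf_deriv dz.
have [d _ dP] := same_pt_sym rP.
have cd l : (cpoly l)^`().[r] = c * d * (cpoly l).[r].
  by rewrite -lf_deriv -/y yP dP scalerA lfZr lf_param_aff.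
by rewrite rootE /W /wronskian hornerD hornerN !hornerM !cd; apply/eqP; ring.
Qed.

Lemma Xpts_same k (R R' : 'rV[K]_k.+1) : (k <= n)%N -> same_pt R R' -> Xpts a R' -> Xpts a R.
Proof.
move=> kn RR; rewrite !(XptsP charK0 n_gt1 a_proper) // => -[R0 [l1 [l2 [ind d1 d2]]]].
split; first exact: same_pt_neq0 RR R0.
have [c c0 ->] := RR.
have dd l : fdvd a k (rVpoly R') l -> fdvd a k (rVpoly (c *: R')) l.
  case=> q sq E; exists (c^-1 *: q); first by rewrite size_scale ?invr_eq0.
  by rewrite linearZ /= -scalerAl -scalerAr scalerA mulfV // scale1r.
by exists l1, l2; split=> //; exact: dd.
Qed.

Lemma X_dim0 k : (2 <= k <= n)%N -> ~ nonempty (@Xpts K n a k) \/ has_dim (@Xpts K n a k) 0.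
Proof.
move=> kn; have kn' : (k <= n)%N by case/andP: kn.
case: (classic (nonempty (@Xpts K n a k))) => [ne|]; [right|by left].
have [E E0 HE] := X_roots.
have [srs Ers] := closed_field_poly_normal E.
have [L HL] := short_words srs k.
apply: (@finite_dim0 _ _ [seq poly_rV (\prod_(x <- w) ('X - x%:P)) | w <- L]) => //.
- by move=> v [].
- by move=> v w vw; apply: Xpts_same.
move=> R XR; have R0 : R != 0 by case: XR.
have [rs Er] := closed_field_poly_normal (rVpoly R).
have lc0 : lead_coef (rVpoly R) != 0 by rewrite lead_coef_eq0 rVpoly_eq0.
exists (poly_rV (\prod_(x <- rs) ('X - x%:P))).
  apply: map_f; apply: HL.
    have : (size (rVpoly R) <= k.+1)%N by exact: size_poly.
    by rewrite Er size_scale // size_prod_XsubC.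
  move=> r rin; have : root E r.
    by apply: HE XR _ _ => //; rewrite Er rootZ // root_prod_XsubC.
  by rewrite Ers rootZ ?lead_coef_eq0 // root_prod_XsubC.
exists (lead_coef (rVpoly R)) => //.
by rewrite -[LHS]rVpolyK {1}Er linearZ.
Qed.

End XFinite.

(** * Secant spaces contracted by the projection *)

Section Contraction.
Variables (K : closedFieldType) (n : nat) (a : 'M[K]_(3, n.+1)).
Local Notation cpoly := (cpoly a).
Local Notation param := (param a).

Lemma lf_proj l z : lf l (proj a z) = (l *m a *m z^T) 0 0.
Proof.
rewrite -mulmxA mxE; apply: eq_bigr => u _; rewrite !mxE; congr (_ * _).
by apply: eq_bigr => j _; rewrite mxE.
Qed.

(** The equations of [H_R] express orthogonality to the multiples of [G_R]; hence a linear form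
    whose pullback is such a multiple vanishes on the projection of [H_R]. *)
Lemma in_secantE k (R : 'rV[K]_k.+1) z : (k <= n)%N ->
  in_secant R z <-> z != 0 /\ shiftmx n R *m z^T = 0.
Proof.
move=> kn; have E (j : 'I_(n - k).+1) :
    \sum_(i < k.+1) R 0 i * z 0 (inord (i + j)) = (shiftmx n R *m z^T) j 0.
  rewrite mxE; have jn : (j + k.+1 <= n.+1)%N by have := ltn_ord j; lia.
  pose F c := (if (j <= c <= j + k)%N then R 0 (inord (c - j)) else 0) * z 0 (inord c).
  transitivity (\sum_(c < n.+1) F c); last first.
    by apply: eq_bigr => c _; rewrite /F !mxE inord_val.
  rewrite -(big_mkord xpredT F) (@big_cat_nat _ _ _ j) //=; last by lia.
  rewrite (@big_cat_nat _ _ _ (j + k.+1) j) //=; last by lia.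
  rewrite [X in _ = X + _]big_nat [X in _ = X + _]big1 ?add0r => [|c /andP[_ cj]]; last first.
    by rewrite /F leqNgt cj mul0r.
  rewrite [X in _ = _ + X]big_nat [X in _ = _ + X]big1 ?addr0 => [|c /andP[cj _]]; last first.
    by rewrite /F; case: ifP; rewrite ?mul0r //; lia.
  rewrite -[in RHS](@add0n (nat_of_ord j)) big_addn addKn big_mkord; apply: eq_bigr => i _.
  by rewrite /F leq_addl addnC leq_add2l -ltnS ltn_ord /= addKn inord_val.
split=> -[z0 H]; split=> //.
  by apply/matrixP => j c; rewrite ord1 -E H ?mxE // -ltnS.
move=> j jn; have jlt : (j < (n - k).+1)%N by [].
by rewrite -[j]/(nat_of_ord (Ordinal jlt)) E H mxE.
Qed.

Hypothesis charK0 : [pchar K] =i pred0.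
Hypothesis n_gt1 : (1 < n)%N.
Hypothesis a_proper : proper_param a.

(** [G] takes up to [k] roots of [D]. If there are fewer, the remaining zeros of [G_R] are at
    infinity, which the fixed divisor contains m - deg D times. *)
Lemma pencil_fdvd P m l1 l2 D g h k : pencil a P m l1 l2 D g h -> (k <= m)%N ->
  exists R : 'rV[K]_k.+1, [/\ Xpts a R, fdvd a k (rVpoly R) l1 & fdvd a k (rVpoly R) l2].
Proof.
case=> [[_ _ ind] [E1 E2] cop se [sD D0 mn]] km.
have kn : (k <= n)%N by lia.
have [rs ED] := closed_field_poly_normal D.
have lc0 : lead_coef D != 0 by rewrite lead_coef_eq0.
have srs : (size rs <= m)%N.
  by rewrite -ltnS; move: sD; rewrite ED size_scale // size_prod_XsubC.
pose G := \prod_(x <- take k rs) ('X - x%:P).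
pose D1 := lead_coef D *: \prod_(x <- drop k rs) ('X - x%:P).
have EG : D = G * D1 by rewrite ED -scalerAr -big_cat cat_take_drop.
have sG : (size G <= k.+1)%N by rewrite size_prod_XsubC size_take; case: ifP => // /negbT; rewrite -leqNgt.
have G0 : G != 0 by rewrite -size_poly_eq0 size_prod_XsubC.
have sD1 : (size D1 + k <= m.+1)%N.
  by rewrite size_scale // size_prod_XsubC size_drop; lia.
have D10 : (0 < size D1)%N by rewrite size_scale // size_prod_XsubC.
have aux l (q : {poly K}) : cpoly l = D * q -> (size q <= (n - m).+1)%N ->
    fdvd a k (rVpoly (poly_rV G : 'rV_k.+1)) l.
  move=> El sq; exists (D1 * q); last by rewrite poly_rV_K // mulrA -EG.
  have [->|q0] := eqVneq q 0; first by rewrite mulr0 size_poly0.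
  rewrite size_mul //; last by rewrite -size_poly_eq0; plia.
  by plia.
have d1 : fdvd a k (rVpoly (poly_rV G : 'rV_k.+1)) l1 by apply: aux E1 _; rewrite -se leq_maxl.
have d2 : fdvd a k (rVpoly (poly_rV G : 'rV_k.+1)) l2 by apply: aux E2 _; rewrite -se leq_maxr.
exists (poly_rV G); split=> //.
apply/(XptsP charK0 n_gt1 a_proper _ kn); split; last by exists l1, l2.
by rewrite -rVpoly_eq0 poly_rV_K.
Qed.

(** Both forms vanish on the projection of [H_R], which leaves only [P]. That [H_R] is not contained
    in the center is seen at the point of C_n over a zero of [G_R], as the parameterization has no
    base points. *)
Lemma fdvd_contracted k (R : 'rV[K]_k.+1) P l1 l2 : (0 < k <= n)%N -> annpair P l1 l2 ->
  P != 0 ->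
  fdvd a k (rVpoly R) l1 -> fdvd a k (rVpoly R) l2 -> contracted_to a R P.
Proof.
move=> /andP[k0 kn] ann P0 d1 d2.
have kill l z : fdvd a k (rVpoly R) l -> in_secant R z -> lf l (proj a z) = 0.
  move=> dl zH; have /submxP[u Eu] := (proj1 (fdvd_sub a R l kn) dl).
  have [_ Sz] := proj1 (in_secantE R z kn) zH.
  by rewrite lf_proj Eu -mulmxA Sz mulmx0 mxE.
move=> Q; split=> [[z [zH z0 Qz]]|QP].
  apply: same_pt_trans Qz _; apply: (ann_same_pt ann z0); exact: kill zH.
have [z [zH pz]] : exists z, in_secant R z /\ proj a z != 0; last first.
  exists z; split=> //; apply: same_pt_trans QP _; apply: same_pt_sym.
  by apply: (ann_same_pt ann pz); exact: kill zH.
have base q : q != 0 -> param q != 0 by apply: (proj1 a_proper).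
pose zz (p : 'rV[K]_2) : 'rV[K]_n.+1 := \row_j (p 0 0 ^+ (n - j) * p 0 1 ^+ j).
have pz p : proj a (zz p) = param p.
  by apply/rowP => u; rewrite !mxE; apply: eq_bigr => j _; rewrite mxE mulrA.
have zz0 p : p != 0 -> zz p != 0.
  move=> p0; apply: contraNneq (base _ p0) => z0; rewrite -pz z0.
  by apply/eqP/rowP => u; rewrite !mxE big1 // => j _; rewrite mxE mulr0.
(* [G_R] vanishes at infinity when its degree is below k; otherwise it has an affine root because k
   > 0. *)
have [sR|sR] := leqP (size (rVpoly R)) k.
  exists (zz infpt); rewrite pz base ?infpt_neq0 //; split=> //; split; first by rewrite zz0 ?infpt_neq0.
  move=> j jn; apply: big1 => i _; rewrite !mxE /= expr1n mulr1 expr0n inordK; last first.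
    by have := ltn_ord i; lia.
  case: (boolP (n - (i + j) == 0)%N) => [|_]; rewrite ?mulr0 ?mulr1 // => /eqP e0.
  rewrite -coef_rVpoly_ord; have /leq_sizeP -> // := sR.
  by have := ltn_ord i; lia.
have /closed_rootP[r Rr] : size (rVpoly R) != 1%N by plia.
exists (zz (aff r)); rewrite pz base ?aff_neq0 //; split=> //; split; first by rewrite zz0 ?aff_neq0.
move=> j jn; transitivity (r ^+ j * (rVpoly R).[r]); last by rewrite (eqP Rr) mulr0.
rewrite (@horner_coef_wide _ k.+1) ?size_poly // mulr_sumr; apply: eq_bigr => i _.
rewrite !mxE /= expr1n mul1r coef_rVpoly_ord inordK; last by have := ltn_ord i; lia.
by rewrite exprD; ring.
Qed.

End Contraction.

Lemma dhomog_prod1 (R : comNzRingType) k n (F : 'I_n -> {mpoly R[k]}) :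
  (forall i, F i \is 1.-homog) -> \prod_i F i \is n.-homog.
Proof.
elim: n F => [|n IH] F hF; first by rewrite big_ord0; apply: dhomog1.
rewrite big_ord_recl; apply: (@dhomogM _ _ _ 1%N _ n) => //.
by apply: IH => i; apply: hF.
Qed.

Lemma dhomog_det (R : comNzRingType) k n (M : 'M[{mpoly R[k]}]_n) :
  (forall i j, M i j \is 1.-homog) -> \det M \is n.-homog.
Proof.
move=> hM; apply: rpred_sum => s _; rewrite mulr_sign.
have H : \prod_i M i (s i) \is n.-homog by apply: dhomog_prod1 => i.
by case: ifP => _ //; rewrite rpredN.
Qed.

Lemma dhomog_lin_form (K : fieldType) m (l : 'rV[K]_m.+1) : lin_form l \is 1.-homog.
Proof.
apply: rpred_sum => i _; apply: dhomogZ; rewrite dhomogX /=; apply/eqP; exact: mdeg1.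
Qed.

Lemma coef_mul_top (R : nzRingType) (p q : {poly R}) d e : (size p <= d.+1)%N ->
  (size q <= e.+1)%N -> (p * q)`_(d + e) = p`_d * q`_e.
Proof.
move=> sp sq; rewrite coefM.
have dd : (d < (d + e).+1)%N by lia.
rewrite (bigD1 (Ordinal dd)) //= addKn big1 ?addr0 // => i.
rewrite -val_eqE /= => id; have [di|di] := ltnP d i.
  by rewrite (leq_sizeP _ _ sp) ?mul0r.
by rewrite (leq_sizeP _ _ sq (d + e - i)%N) ?mulr0 //; lia.
Qed.

(** Surjectivity of the Sylvester map: reducing one Bezout coefficient modulo the polynomial of
    degree [e] bounds both. *)
Lemma bezout_size (F : closedFieldType) (g h p : {poly F}) e : coprimep g h ->
  maxn (size g) (size h) = e.+1 -> (size p <= e + e)%N ->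
  exists u v : {poly F}, [/\ (size u <= e)%N, (size v <= e)%N & p = g * u + h * v].
Proof.
have main (g' h' : {poly F}) : coprimep g' h' -> size h' = e.+1 -> (size g' <= e.+1)%N ->
    (size p <= e + e)%N ->
    exists u v : {poly F}, [/\ (size u <= e)%N, (size v <= e)%N & p = g' * u + h' * v].
  move=> cop sh sg sp; have h0 : h' != 0 by rewrite -size_poly_eq0 sh.
  have /Bezout_eq1_coprimepP[[x y] /= xy] := cop.
  pose u := (p * x) %% h'.
  have su : (size u <= e)%N by rewrite -ltnS -sh ltn_modp.
  have hd : h' %| p - g' * u.
    have -> : p - g' * u = h' * (p * y + g' * (p * x %/ h')).
      have E := divp_eq (p * x) h'; rewrite -/u in E.
      have -> : p - g' * u = p * (x * g' + y * h') - g' * u by rewrite xy mulr1.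
      have -> : u = p * x - p * x %/ h' * h' by apply/eqP; rewrite eq_sym subr_eq addrC -E.
      by ring.
    by apply: dvdp_mulIl.
  exists u, ((p - g' * u) %/ h'); split=> //; last by rewrite [h' * _]mulrC divpK //; ring.
  rewrite size_divp // sh /=.
  have : (size (p - g' * u)%R <= e + e)%N.
    apply: leq_trans (size_polyD _ _) _; rewrite size_polyN geq_max sp /=.
    by apply: leq_trans (size_polyMleq _ _) _; plia.
  by plia.
move=> cop se sp; have [gh|gh] := leqP (size g) (size h).
  by apply: main => //; move: se; rewrite (maxn_idPr gh) // => <-.
have [||||v [u [sv su ->]]] := main h g => //.
- by rewrite coprimep_sym.
- by rewrite -se (maxn_idPl (ltnW gh)).
- by rewrite -se leq_maxr.
by exists u, v; split=> //; rewrite addrC.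
Qed.

Lemma rVpoly_row_mx (R : nzSemiRingType) m n (p : 'I_m -> {poly R}) i : (size (p i) <= n)%N ->
  rVpoly (row i (\matrix_j poly_rV (p j) : 'M_(m, n))) = p i.
Proof. by move=> sp; rewrite rowK poly_rV_K. Qed.

(** * The implicit equation of C *)

Section GenericLine.
Variables (K : fieldType) (m : nat) (Q : 'rV[K]_m.+1).
Local Notation S := {mpoly K[m.+1]}.

(* F(x + T Q), as a polynomial in T over K[x] *)
Definition genline : S -> {poly S} :=
  mmap (polyC \o @mpolyC m.+1 K) (fun i => ('X_i)%:P + (Q 0 i)%:MP *: 'X).

HB.instance Definition _ := GRing.RMorphism.on genline.

Let genlineD F G : genline (F + G) = genline F + genline G.
Proof. exact: mmapD. Qed.
Let genlineM F G : genline (F * G) = genline F * genline G.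
Proof. exact: (rmorphM genline). Qed.
Let genlineC c : genline c%:MP = c%:MP%:P.
Proof. exact: mmapC. Qed.
Let genline0 : genline 0 = 0.
Proof. exact: mmap0. Qed.

Lemma genline_lin l : genline (lin_form l) = (lin_form l)%:P + (lf l Q)%:MP *: 'X.
Proof.
rewrite /lin_form /lf !rmorph_sum /= scaler_suml -big_split; apply: eq_bigr => i _ /=.
rewrite -mul_mpolyC rmorphM /= /genline mmapC mmapX mmap1U /=.
by rewrite mulrDr -polyCM -mul_polyC mulrA -polyCM mul_mpolyC -mpolyCM -mul_polyC.
Qed.

Lemma genline_at0 F : (genline F).[0] = F.
Proof.
elim/mpolyind: F => [|c u F _ _ IH]; first by rewrite genline0 horner0.
rewrite genlineD hornerD.
apply: (f_equal2 (fun x y : S => x + y) _ IH).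
rewrite -mul_mpolyC genlineM hornerM genlineC hornerC /genline mmapX; congr (_ * _).
rewrite /mmap1 -horner_evalE rmorph_prod mpolyXE_id; apply: eq_bigr => i _.
by rewrite rmorphXn /= /horner_eval hornerD hornerC hornerZ hornerX mulr0 addr0.
Qed.

Lemma genline_eval F (x : 'rV[K]_m.+1) t : (map_poly (meval (x 0)) (genline F)).[t] = hval F (x + t *: Q).
Proof.
rewrite /hval; elim/mpolyind: F => [|c u F _ _ IH]; first by rewrite genline0 rmorph0 horner0 meval0.
rewrite genlineD rmorphD hornerD mevalD.
apply: (f_equal2 (fun x y : K => x + y) _ IH).
rewrite -mul_mpolyC genlineM genlineC mevalM mevalC rmorphM hornerM /= map_polyC hornerC /= mevalC; congr (_ * _).
rewrite /genline mmapX mevalX /mmap1 rmorph_prod -horner_evalE rmorph_prod; apply: eq_bigr => i _.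
rewrite !rmorphXn /= /horner_eval rmorphD /= map_polyC map_polyZ map_polyX /= mevalXU mevalC.
by rewrite hornerD hornerC hornerZ hornerX !mxE mulrC.
Qed.

End GenericLine.

Section ImplicitEquation.
Variables (K : closedFieldType) (n : nat) (a : 'M[K]_(3, n.+1)).
Hypothesis charK0 : [pchar K] =i pred0.
Hypothesis n_gt1 : (1 < n)%N.
Hypothesis a_proper : proper_param a.
Local Notation cpoly := (cpoly a).
Local Notation param := (param a).

(** [Q] is the intersection of [l1 = 0] with a line avoiding the finitely many points of C on it.
    Lines (1, t, t^2) suffice, since each point excludes finitely many [t]. The image of infinity is
    avoided as well, which gives [cpoly l2] degree n. *)
Lemma point_off_curve : exists Q l1 l2, pencil a Q 0 l1 l2 1 (cpoly l1) (cpoly l2).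
Proof.
have base q : q != 0 -> param q != 0 by apply: (proj1 a_proper).
pose l1 : 'rV[K]_3 := delta_mx 0 0.
have l10 : l1 != 0 by apply/rV0Pn; exists 0; rewrite mxE !eqxx oner_eq0.
have c10 : cpoly l1 != 0 by apply: contraNneq l10 => /(cpoly_eq0 charK0 a_proper n_gt1) ->.
have [rs Ers] := closed_field_poly_normal (cpoly l1).
pose pts := param infpt :: [seq param (aff r) | r <- rs].
pose B := \prod_(y <- pts) rVpoly y.
have : B != 0.
  rewrite prodf_seq_neq0; apply/allP => y /=; rewrite inE rVpoly_eq0 => /orP[/eqP->|/mapP[r _ ->]].
    by rewrite base ?infpt_neq0.
  by rewrite base ?aff_neq0.
case/closed_nonrootP => t; rewrite rootE horner_prod prodf_seq_neq0 => /allP Ht.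
pose l2 : 'rV[K]_3 := \row_u t ^+ u.
have l2E y : lf l2 y = (rVpoly y).[t].
  rewrite (@horner_coef_wide _ 3) ?size_poly //; apply: eq_bigr => u _.
  by rewrite mxE coef_rVpoly_ord mulrC.
have c2n : (cpoly l2)`_n != 0.
  by rewrite -lf_param_inf l2E; have := Ht (param infpt); rewrite mem_head => /(_ isT).
have sc2 : size (cpoly l2) = n.+1.
  apply/eqP; rewrite eqn_leq size_cpoly ltnNge; apply: contra c2n => /leq_sizeP ->//.
have cop : coprimep (cpoly l1) (cpoly l2).
  apply/Pdiv.ClosedField.coprimepP => r; rewrite Ers rootZ ?lead_coef_eq0 // root_prod_XsubC => rin.
  rewrite -lf_param_aff l2E; have := Ht (param (aff r)).
  by rewrite inE (map_f (fun r => param (aff r)) rin) orbT => /(_ isT).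
have se : maxn (size (cpoly l1)) (size (cpoly l2)) = (n - 0).+1.
  by rewrite sc2 subn0; apply/maxn_idPr; apply: size_cpoly.
have ind (x y : K) : x *: l1 + y *: l2 = 0 -> x = 0 /\ y = 0.
  move=> /(congr1 cpoly); rewrite cpolyD !cpolyZ {3}/(cpoly) mul0mx linear0.
  move/eqP; rewrite addr_eq0 -scaleNr -!mul_polyC => /eqP E.
  have [||y0 x0] := coprime_syzygy0 cop se _ _ (esym E).
  - by apply: leq_trans (size_polyC_leq1 _) _; lia.
  - by apply: leq_trans (size_polyC_leq1 _) _; lia.
  by split; apply/eqP; [move: x0|move: y0] => /eqP; rewrite polyC_eq0 ?oppr_eq0.
have [Q _ ann] := indep_annpair ind.
exists Q, l1, l2; split=> //; first by rewrite !mul1r.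
by rewrite size_poly1 oner_eq0; split=> //; lia.
Qed.

(* The determinantal equation of C: with g, h, w the pullbacks of l1, l2, l3
   one has w T^i = sum_j (A_ij g + B_ij h) T^j, so (T^j)_j is in the kernel of
   l3 - A l1 - B l2 at each point of C. *)
Section Determinantal.
Variables (l1 l2 l3 : 'rV[K]_3) (A B : 'M[K]_n).

Definition detmx : 'M[{mpoly K[3]}]_n :=
  \matrix_(i, j) ((i == j)%:R *: lin_form l3 - A i j *: lin_form l1 - B i j *: lin_form l2).

Definition detmx_at (v : 'rV[K]_3) : 'M[K]_n :=
  (lf l3 v)%:M - lf l1 v *: A - lf l2 v *: B.

Lemma hval_detmx v : hval (\det detmx) v = \det (detmx_at v).
Proof.
rewrite /hval; have -> : (\det detmx).@[v 0] = \det (map_mx (meval (v 0)) detmx).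
  by rewrite det_map_mx.
congr (\det _); apply/matrixP => i j; rewrite !mxE !mevalB !mevalZ.
rewrite -!/(hval _ _) !hval_lin_form mulr_natl [A i j * _]mulrC [B i j * _]mulrC.
by [].
Qed.

Lemma dhomog_detmx : \det detmx \is n.-homog.
Proof.
by apply: dhomog_det => i j; rewrite mxE !rpredB // rpredZ // dhomog_lin_form.
Qed.

Hypothesis AB : forall i : 'I_n, cpoly l3 * 'X^i =
  cpoly l1 * rVpoly (row i A) + cpoly l2 * rVpoly (row i B).

Lemma detmx_curve p : p != 0 -> hval (\det detmx) (param p) = 0.
Proof.
move=> p0; rewrite hval_detmx.
have det0 (v : 'cV[K]_n) M : v != 0 -> M *m v = 0 -> \det M = 0.
  move=> v0 Mv; apply/eqP; apply: contraNT v0; rewrite -unitfE -unitmxE => u.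
  by rewrite -[v](mulKmx u) Mv mulmx0.
have [[r [c c0 ->]]|[c c0 ->]] := pt_cases p0.
  rewrite paramZ; pose b : 'cV[K]_n := \col_j r ^+ j.
  apply: (det0 b).
    have n0 : (0 < n)%N by lia.
    by apply: contraTneq isT => /colP/(_ (Ordinal n0)); rewrite !mxE expr0 => /eqP; rewrite oner_eq0.
  apply/colP => i; rewrite !mulmxBl mul_scalar_mx -!scalemxAl !mxE !lfZr !lf_param_aff.
  have := congr1 (horner^~ r) (AB i); rewrite !hornerE.
  have aux (M : 'M[K]_n) : (rVpoly (row i M)).[r] = (M *m b) i 0.
    rewrite mxE (@horner_coef_wide _ n) ?size_poly //; apply: eq_bigr => j _.
    by rewrite coef_rVpoly_ord !mxE.
  rewrite !aux !mxE => E; rewrite -!mulrA -!mulrBr -addrA -opprD.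
  by rewrite E subrr mulr0.
(* At infinity the vector of powers degenerates to the last basis vector, and the identity needed is
   the coefficient of degree n + n.-1 in [AB]. *)
have n1 : (n.-1 < n)%N by lia.
pose o := Ordinal n1; rewrite paramZ; apply: (det0 (delta_mx o 0)).
  by apply: contraTneq isT => /colP/(_ o); rewrite !mxE !eqxx => /eqP; rewrite oner_eq0.
apply/colP => i; rewrite -colE !mxE !lfZr !lf_param_inf.
have := congr1 (fun p : {poly K} => p`_(n + n.-1)) (AB i).
have sn (q : {poly K}) : (size q <= n)%N -> (size q <= n.-1.+1)%N by rewrite prednK //; lia.
have cX : ('X^i : {poly K})`_n.-1 = (i == o)%:R by rewrite coefXn eq_sym.
rewrite coefD !coef_mul_top ?size_cpoly ?sn ?size_poly ?size_polyXn ?ltn_ord //.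
rewrite cX -[n.-1]/(val o) !coef_rVpoly_ord !mxE => E.
by rewrite -mulrnAr -!mulrA -!mulrBr -addrA -opprD -mulr_natr E subrr mulr0.
Qed.

(** In the direction [Q] only [l3] changes, at unit speed, so the determinant becomes a
    characteristic polynomial. *)
Lemma genline_detmx Q : annpair Q l1 l2 -> lf l3 Q = 1 ->
  genline Q (\det detmx) \is monic /\ size (genline Q (\det detmx)) = n.+1.
Proof.
move=> ann l3Q; have [l1Q l2Q] := annpair_ann ann.
pose N : 'M[{mpoly K[3]}]_n :=
  \matrix_(i, j) (A i j *: lin_form l1 + B i j *: lin_form l2 - (i == j)%:R *: lin_form l3).
have -> : genline Q (\det detmx) = char_poly N.
  have -> : genline Q (\det detmx) = \det (map_mx (genline Q) detmx) by rewrite det_map_mx.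
  congr (\det _); apply/matrixP => i j; rewrite !mxE !raddfB /= -!mul_mpolyC !rmorphM.
  rewrite /= !genline_lin l1Q l2Q l3Q !mpolyC0 !scale0r !addr0 mpolyC1 scale1r.
  have cst c : genline Q c%:MP = c%:MP%:P by rewrite /genline mmapC.
  rewrite /= !cst polyCD !polyCM.
  case: (i == j); rewrite ?mpolyC0 ?mpolyC1 ?polyC0 ?mulr0n ?mulr1n; ring.
by rewrite char_poly_monic size_char_poly.
Qed.

Lemma detmx_curve_eq Q : pencil a Q 0 l1 l2 1 (cpoly l1) (cpoly l2) -> lf l3 Q = 1 ->
  curve_eq (curve a) (\det detmx).
Proof.
move=> pen l3Q; have [ann _ _ _ _] := pen.
have [mon sz] := genline_detmx ann l3Q.
have vanish P : curve a P -> hval (\det detmx) P = 0.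
  case=> p p0 [c c0 ->].
  by rewrite (hvalZ_homog _ _ dhomog_detmx) detmx_curve ?mulr0.
split; first by exists n; apply: dhomog_detmx.
move=> G; split=> [GC|[H ->] P /vanish PV]; last by rewrite hvalM PV mulr0.
pose L := genline Q; pose q := Pdiv.Ring.rdivp (L G) (L (\det detmx)).
pose r := Pdiv.Ring.rmodp (L G) (L (\det detmx)).
have E : L G = q * L (\det detmx) + r by apply: Pdiv.RingMonic.rdivp_eq.
have sr : (size r <= n)%N.
  by rewrite -ltnS -sz Pdiv.Ring.ltn_rmodpN0 // monic_neq0.
have [B' B0 HB] := line_general charK0 a_proper pen (oner_neq0 {poly K}).
(* For general [x] the remainder has degree below n and vanishes at the n points of C on the line
   through [Q] and [x]. *)
have r0 : r = 0.
  apply/polyP => k; rewrite coef0; apply: (meval_generic B0) => v Bv.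
  pose x : 'rV[K]_3 := \row_i v i.
  have ex (F : {mpoly K[3]}) : F.@[v] = F.@[x 0] by apply: meval_eq => i; rewrite mxE.
  have [|ts [uts sts Hts]] := HB x; first by rewrite /hval -ex.
  rewrite ex -coef_map /=; suff -> : map_poly (meval (x 0)) r = 0 by rewrite coef0.
  apply: (@roots_geq_poly_eq0 _ _ ts) => //; last first.
    by apply: leq_trans (size_poly _ _) _; rewrite sts subn0.
  apply/allP => t /Hts[s [c [_ c0 xt]]].
  have onC : curve a (x + t *: Q).
    by exists (aff s); [exact: aff_neq0|exists c].
  have evE (p1 p2 p3 : {poly {mpoly K[3]}}) : (map_poly (meval (x 0)) (p1 * p2 + p3)).[t] =
      (map_poly (meval (x 0)) p1).[t] * (map_poly (meval (x 0)) p2).[t]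
      + (map_poly (meval (x 0)) p3).[t].
    by rewrite rmorphD rmorphM hornerD hornerM.
  have := genline_eval Q G x t; rewrite -/(L G) E evE {1}/L genline_eval GC // vanish // mulr0 add0r.
  by move/eqP.
(* At T = 0 the division along lines becomes an identity in K[x]. *)
exists q.[0]; rewrite -[LHS](genline_at0 Q) -/(L G) E r0 addr0.
have hM (p1 p2 : {poly {mpoly K[3]}}) : (p1 * p2).[0] = p1.[0] * p2.[0] by exact: hornerM.
by rewrite hM [X in _ * X](genline_at0 Q).
Qed.

End Determinantal.

Lemma implicit_equation : exists (Q l1 l2 l3 : 'rV[K]_3) (A B : 'M[K]_n),
  [/\ pencil a Q 0 l1 l2 1 (cpoly l1) (cpoly l2), lf l3 Q = 1,
      forall i : 'I_n, cpoly l3 * 'X^i =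
        cpoly l1 * rVpoly (row i A) + cpoly l2 * rVpoly (row i B)
    & curve_eq (curve a) (\det (detmx l1 l2 l3 A B))].
Proof.
have [Q [l1 [l2 pen]]] := point_off_curve.
have [ann _ cop se _] := pen.
have Q0 : Q != 0.
  have [sp pt ind] := ann; have [P P0 annP] := indep_annpair ind.
  have [p1 p2] := annpair_ann annP; have [c cP] := pt _ p1 p2.
  by apply: contraNneq P0 => q0; rewrite cP q0 scaler0.
have /rV0Pn[i Qi] := Q0.
pose l3 : 'rV[K]_3 := (Q 0 i)^-1 *: delta_mx 0 i.
have l3Q : lf l3 Q = 1 by rewrite lfZl lf_delta mulVf.
have H (j : 'I_n) : exists u : {poly K} * {poly K},
    [&& (size u.1 <= n)%N, (size u.2 <= n)%N & cpoly l3 * 'X^j == cpoly l1 * u.1 + cpoly l2 * u.2].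
  rewrite subn0 in se.
  have [|u [v [su sv E]]] := bezout_size (p := cpoly l3 * 'X^j) cop se.
    apply: leq_trans (size_polyMleq _ _) _; rewrite size_polyXn.
    by have := size_cpoly a l3; have := ltn_ord j; plia.
  by exists (u, v); rewrite /= su sv E eqxx.
pose w j := xchoose (H j).
pose A : 'M[K]_n := \matrix_j poly_rV (w j).1.
pose B : 'M[K]_n := \matrix_j poly_rV (w j).2.
have AB (j : 'I_n) : cpoly l3 * 'X^j =
    cpoly l1 * rVpoly (row j A) + cpoly l2 * rVpoly (row j B).
  have /and3P[s1 s2 /eqP ->] := xchooseP (H j).
  by rewrite (@rVpoly_row_mx _ _ _ (fun j => (w j).1)) ?(@rVpoly_row_mx _ _ _ (fun j => (w j).2)).
exists Q, l1, l2, l3, A, B.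
by split=> //; apply: detmx_curve_eq pen l3Q.
Qed.
End ImplicitEquation.

(** * Multiplicities *)

Section Order.
Variables (K : fieldType) (k : nat).
Implicit Types (p q : {mpoly K[k]}) (d e : nat).

(* [p] vanishes to order at least d at the origin *)
Definition ordge d p := forall u : 'X_{1..k}, (mdeg u < d)%N -> p@_u = 0.

Lemma ordgeD d p q : ordge d p -> ordge d q -> ordge d (p + q).
Proof. by move=> hp hq u ud; rewrite mcoeffD hp ?hq ?addr0. Qed.

Lemma ordgeZ d c p : ordge d p -> ordge d (c *: p).
Proof. by move=> hp u ud; rewrite mcoeffZ hp ?mulr0. Qed.

Lemma ordge_sum d (I : Type) (r : seq I) (P : pred I) (F : I -> {mpoly K[k]}) :
  (forall i, P i -> ordge d (F i)) -> ordge d (\sum_(i <- r | P i) F i).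
Proof.
by move=> hF u ud; rewrite raddf_sum big1 // => i Pi; exact: hF.
Qed.

Lemma ordgeM d e p q : ordge d p -> ordge e q -> ordge (d + e) (p * q).
Proof.
move=> hp hq u ud; rewrite mcoeffM big1 // => -[v w] /= /eqP uvw.
have {uvw} vw : (mdeg v + mdeg w < d + e)%N by rewrite -mdegD -uvw.
have [vd|vd] := ltnP (mdeg v) d.
  by rewrite hp // mul0r.
by rewrite (hq w) ?mulr0 //; lia.
Qed.

Lemma ordge_prod (I : Type) (r : seq I) (F : I -> {mpoly K[k]}) (d : I -> nat) :
  (forall i, ordge (d i) (F i)) -> ordge (\sum_(i <- r) d i) (\prod_(i <- r) F i).
Proof.
move=> hF; elim: r => [|i r IH]; first by rewrite !big_nil.
by rewrite !big_cons; apply: ordgeM.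
Qed.

Lemma ordge_le d e p : (d <= e)%N -> ordge e p -> ordge d p.
Proof. by move=> de hp u ud; apply: hp; apply: leq_trans de. Qed.

(** Invertible constant matrices bring [M0] to [pid_mx r]; in each term of the determinant the
    factors from the last n - r rows then vanish at the origin. *)
Lemma det_ordge n (M0 : 'M[K]_n) (N : 'M[{mpoly K[k]}]_n) :
  (forall i j, ordge 1 (N i j)) ->
  ordge (n - \rank M0) (\det (map_mx (@mpolyC k K) M0 + N)).
Proof.
move=> hN; set r := \rank M0.
pose C := @mpolyC k K.
have scal m1 m2 (U : 'M[K]_(n, n)) (W : 'M[{mpoly K[k]}]_n) :
    (forall i j, ordge 1 (W i j)) -> m1 = m2 :> nat ->
    (forall i j, ordge 1 ((map_mx C U *m W) i j)) /\ (forall i j, ordge 1 ((W *m map_mx C U) i j)).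
  move=> hW _; split=> i j; rewrite mxE; apply: ordge_sum => l _; rewrite !mxE ?[W i l * _]mulrC.
    by rewrite /C mul_mpolyC; apply: ordgeZ.
  by rewrite /C mul_mpolyC; apply: ordgeZ.
pose L := col_ebase M0; pose R := row_ebase M0.
have uL : L \in unitmx by exact: col_ebase_unit.
have uR : R \in unitmx by exact: row_ebase_unit.
pose N' := map_mx C (invmx L) *m N *m map_mx C (invmx R).
have hN' i j : ordge 1 (N' i j).
  apply: (proj2 (scal 0%N 0%N _ _ _ erefl)) => i' j'.
  by apply: (proj1 (scal 0%N 0%N _ _ _ erefl)).
have -> : map_mx C M0 + N = map_mx C L *m (map_mx C (pid_mx r) + N') *m map_mx C R.
  rewrite mulmxDr mulmxDl -!map_mxM mulmx_ebase; congr (_ + _).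
  by rewrite !mulmxA -map_mxM mulmxV // map_mx1 mul1mx -mulmxA -map_mxM mulVmx // map_mx1 mulmx1.
rewrite !det_mulmx !det_map_mx mulrAC; rewrite -rmorphM /C mul_mpolyC; apply: ordgeZ.
apply: ordge_sum => s _; rewrite mulr_sign.
suff H : ordge (n - r) (\prod_i (map_mx C (pid_mx r) + N') i (s i)).
  by case: ifP => _ //; rewrite -scaleN1r; apply: ordgeZ.
apply: (@ordge_le _ (\sum_(i < n) (r <= i))).
  rewrite -(big_mkord xpredT (fun i => (r <= i)%N : nat)).
  rewrite (@big_cat_nat _ _ _ r) //=; last exact: rank_leq_row.
  apply: leq_trans (leq_addl _ _).
  rewrite big_nat (eq_bigr (fun=> 1%N)) => [|i /andP[-> _]//].
  by rewrite -big_nat sum_nat_const_nat muln1.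
apply: ordge_prod => i; rewrite mxE; have [ri|ri] := leqP r i; last by [].
have -> : map_mx C (pid_mx r) i (s i) = 0.
  by rewrite mxE mxE ltnNge ri andbF; exact: mpolyC0.
by rewrite add0r.
Qed.

End Order.

Section Multiplicity.
Variables (K : closedFieldType) (n : nat) (a : 'M[K]_(3, n.+1)).
Hypothesis charK0 : [pchar K] =i pred0.
Hypothesis n_gt1 : (1 < n)%N.
Hypothesis a_proper : proper_param a.
Local Notation cpoly := (cpoly a).
Local Notation param := (param a).

Lemma rank_multiples (M : 'M[K]_n) (D : {poly K}) e :
  (forall i, exists2 q : {poly K}, (size q <= e)%N & rVpoly (row i M) = D * q) ->
  (\rank M <= e)%N.
Proof.
move=> H; pose S : 'M[K]_(e, n) := \matrix_j poly_rV (D * 'X^j).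
apply: leq_trans (rank_leq_row S); apply: mxrankS; apply/row_subP => i.
have [q sq E] := H i; apply/submxP; exists (poly_rV q).
rewrite -[row i M]rVpolyK E; rewrite mulmx_sum_row.
have {1}-> : q = \sum_(j < e) q`_j *: 'X^j.
  rewrite -[LHS](coefK q) poly_def (big_ord_widen e (fun j => q`_j *: 'X^j)) // big_mkcond.
  apply: eq_bigr => j _; case: ifP => // /negbT; rewrite -leqNgt => /leq_sizeP -> //.
  by rewrite scale0r.
rewrite mulr_sumr linear_sum; apply: eq_bigr => j _.
by rewrite rowK mxE -scalerAr linearZ.
Qed.

Section Local.
Variables (P : 'rV[K]_3) (i : 'I_3).
Hypothesis Pi : P 0 i != 0.

Lemma local_eqD F G : local_eq (F + G) P i = local_eq F P i + local_eq G P i.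
Proof. exact: rmorphD. Qed.
Lemma local_eqM F G : local_eq (F * G) P i = local_eq F P i * local_eq G P i.
Proof. exact: rmorphM. Qed.
Lemma local_eqZ c F : local_eq (c *: F) P i = c *: local_eq F P i.
Proof. exact: linearZ. Qed.

Lemma local_eq_lin l : ordge 1 (local_eq (lin_form l) P i - (lf l P / P 0 i)%:MP).
Proof.
move=> u; rewrite ltnS leqn0 mdeg_eq0 => /eqP ->.
have -> : local_eq (lin_form l) P i = \sum_j l 0 j *: local_eq 'X_j P i.
  rewrite /local_eq /lin_form (raddf_sum (comp_mpoly _)).
  by apply: eq_bigr => j _; exact: comp_mpolyZ.
rewrite mcoeffB mcoeffC eqxx mulr1 /lf raddf_sum /=.
apply/eqP; rewrite subr_eq0 mulr_suml; apply/eqP; apply: eq_bigr => j _.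
rewrite mcoeffZ /local_eq comp_mpolyXU -tnth_nth tnth_mktuple -mulrA; congr (_ * _).
case: eqP => [->|_]; first by rewrite mcoeff1 eqxx mulfV.
by rewrite mcoeffD mcoeffC eqxx mulr1 mcoeffX mnm1_eq0 add0r.
Qed.

Lemma local_eq_eval F (v : 'rV[K]_3) : v 0 i = 0 ->
  (local_eq F P i).@[v 0] = hval F ((P 0 i)^-1 *: P + v).
Proof.
move=> vi; rewrite comp_mpoly_meval; apply: meval_eq => j.
rewrite tnth_mktuple !mxE; case: eqP => [->|_]; first by rewrite meval1 vi addr0 mulVf.
by rewrite mevalD mevalXU mevalC addrC mulrC.
Qed.

Variables (m : nat) (k1 k2 : 'rV[K]_3) (D g h : {poly K}).
Hypothesis pen : pencil a P m k1 k2 D g h.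

Section Equation.
Variables (Q l1 l2 l3 : 'rV[K]_3) (A B : 'M[K]_n).
Hypothesis penQ : pencil a Q 0 l1 l2 1 (cpoly l1) (cpoly l2).
Hypothesis l3Q : lf l3 Q = 1.
Hypothesis AB : forall i : 'I_n, cpoly l3 * 'X^i =
  cpoly l1 * rVpoly (row i A) + cpoly l2 * rVpoly (row i B).
Local Notation Phi := (\det (detmx l1 l2 l3 A B)).

(** Modulo [D], the pullback of each form [l] is l(P) [u], with [u] the pullback of a form of value
    1 at [P]. So the relations [AB] make [D] divide [u] times each row, and [u] is prime to [D]. The
    rows are therefore multiples of the fixed divisor, which fill a space of dimension n - m. *)
Lemma rank_detmx_at : (\rank (detmx_at l1 l2 l3 A B P) <= n - m)%N.
Proof.
have [ann [E1 E2] cop se [sD D0 mn]] := pen.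
pose w : 'rV[K]_3 := (P 0 i)^-1 *: delta_mx 0 i; pose u := cpoly w.
have wP : lf w P = 1 by rewrite lfZl lf_delta mulVf.
have dv l : exists2 q : {poly K}, (size q <= (n - m).+1)%N & cpoly l - lf l P *: u = D * q.
  have [sp _ _] := ann; have [|x [y E]] := (proj1 (sp (l - lf l P *: w))).
    by rewrite lfBl lfZl wP mulr1 subrr.
  exists (x *: g + y *: h).
    apply: leq_trans (size_polyD _ _) _; rewrite -se geq_max.
    by rewrite !(leq_trans (size_scale_leq _ _)) ?leq_maxl ?leq_maxr.
  by rewrite -cpolyZ -cpolyB E cpolyD !cpolyZ E1 E2 mulrDr -!scalerAr.
have u_same p : same_pt (param p) P -> lf w (param p) != 0.
  by case=> c c0 ->; rewrite lfZr wP mulr1.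
have copD : coprimep D u.
  apply/Pdiv.ClosedField.coprimepP => r Dr; rewrite -lf_param_aff.
  by apply: u_same; apply: pencil_root pen Dr.
apply: (@rank_multiples _ D) => j.
set r := rVpoly (row j _).
have rE : r = lf l3 P *: 'X^j - lf l1 P *: rVpoly (row j A) - lf l2 P *: rVpoly (row j B).
  rewrite /r /detmx_at; apply/polyP => c; rewrite !coefB !coefZ !coef_rVpoly coefXn.
  case: insubP => [c' _ cE|cn]; last first.
    rewrite !mulr0 !subr0; case: eqP => [cj|_]; last by rewrite mulr0.
    by move: cn; rewrite cj ltn_ord.
  by rewrite !mxE -cE eq_sym -val_eqE /= mulr_natr.
have [q1 s1 e1] := dv l1; have [q2 s2 e2] := dv l2; have [q3 s3 e3] := dv l3.
pose q := q1 * rVpoly (row j A) + q2 * rVpoly (row j B) - q3 * 'X^j.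
have ur : u * r = D * q.
  rewrite /q !mulrDr mulrN !mulrA -e1 -e2 -e3 rE -!mul_polyC.
  have := AB j; rewrite !mulrBl => E; rewrite E; ring.
have n0 : (0 < n)%N by lia.
have sq : (size q <= (n - m) + n)%N.
  have sz (p1 p2 : {poly K}) : (size p1 <= (n - m).+1)%N -> (size p2 <= n)%N ->
      (size (p1 * p2)%R <= (n - m) + n)%N.
    by move=> ? ?; apply: leq_trans (size_polyMleq _ _) _; plia.
  rewrite /q; apply: leq_trans (size_polyD _ _) _; rewrite size_polyN geq_max.
  rewrite sz ?size_polyXn ?andbT //; apply: leq_trans (size_polyD _ _) _.
  by rewrite geq_max !sz ?size_poly.
have /dvdpP[r' Er] : D %| r by rewrite -(Gauss_dvdpr r copD) ur dvdp_mulr.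
rewrite mulrC in Er; exists r' => //.
have [->|r'0] := eqVneq r' 0; first by rewrite size_poly0.
have sr : (size r <= n)%N by exact: size_poly.
(* When the fixed divisor contains infinity, the size of [r] gives too weak a bound; there [u] has
   full degree n, and the size of [q = u * r'] bounds [r']. *)
have [sDm|sDm] := leqP (size D) m; last first.
  by move: sr; rewrite Er size_mul //; plia.
have un : u`_n != 0.
  by rewrite -lf_param_inf; apply: u_same; apply: pencil_inf pen sDm.
have su : (n < size u)%N by rewrite ltnNge; apply: contra un => /leq_sizeP ->.
have u0 : u != 0 by rewrite -size_poly_eq0; plia.
have qE : q = u * r' by apply: (mulfI D0); rewrite -ur Er; ring.
by move: sq; rewrite qE size_mul //; plia.
Qed.

Lemma local_eq_ge : ordge m (local_eq Phi P i).
Proof.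
have [_ _ _ _ [_ _ mn]] := pen.
pose M0 := (P 0 i)^-1 *: detmx_at l1 l2 l3 A B P.
pose N := map_mx (fun F => local_eq F P i) (detmx l1 l2 l3 A B) - map_mx (@mpolyC 3 K) M0.
have -> : local_eq Phi P i = \det (map_mx (@mpolyC 3 K) M0 + N).
  rewrite /N addrC subrK /local_eq; apply/esym; exact: det_map_mx.
have rM : (\rank M0 <= n - m)%N.
  by rewrite mxrank_scale_nz ?invr_eq0 //; exact: rank_detmx_at.
apply: (@ordge_le _ _ _ (n - \rank M0)%N); first by move: rM; move: (\rank M0) => ?; lia.
apply: det_ordge.
move=> x y; rewrite /N /M0 !mxE.
have -> : local_eq ((x == y)%:R *: lin_form l3 - A x y *: lin_form l1 - B x y *: lin_form l2) P i =
  (x == y)%:R *: local_eq (lin_form l3) P i + (- A x y) *: local_eq (lin_form l1) P i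
   + (- B x y) *: local_eq (lin_form l2) P i.
  by rewrite -!scaleNr !local_eqD !local_eqZ.
pose c l := (lf l P / P 0 i)%:MP_[3] : {mpoly K[3]}.
have E l : local_eq (lin_form l) P i = c l + (local_eq (lin_form l) P i - c l) by rewrite addrC subrK.
have cst : (x == y)%:R *: c l3 + (- A x y) *: c l1 + (- B x y) *: c l2 =
    ((P 0 i)^-1 * (lf l3 P *+ (x == y) - lf l1 P * A x y - lf l2 P * B x y))%:MP.
  rewrite /c -!mul_mpolyC -!mpolyCM -!mpolyCD; congr (_%:MP).
  by case: (x == y); rewrite ?mulr1n ?mulr0n; field.
have aux (a1 a2 a3 d1 d2 d3 : {mpoly K[3]}) :
    a1 + d1 + (a2 + d2) + (a3 + d3) - (a1 + a2 + a3) = d1 + d2 + d3 by ring.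
rewrite (E l1) (E l2) (E l3) !scalerDr -cst aux -!scalerDr.
by apply: ordgeD; [apply: ordgeD|]; apply: ordgeZ; apply: local_eq_lin.
Qed.

(* The general line through P has degree n >= deg (local equation), and n - m
   of its intersections with C are away from P. *)
Lemma local_eq_le : ~ ordge m.+1 (local_eq Phi P i).
Proof.
move=> ge; have [annQ _ _ _ _] := penQ.
have [_ _ _ _ [_ _ mn]] := pen.
have hom : Phi \is n.-homog := dhomog_detmx l1 l2 l3 A B.
(* Avoiding the zeros of this polynomial keeps the n - m points other than [P] in the chart x_i !=
   0. *)
have c0 : cpoly (delta_mx 0 i) != 0.
  apply/negP => /eqP /(cpoly_eq0 charK0 a_proper n_gt1) /matrixP /(_ 0 i) /eqP.
  by rewrite !mxE !eqxx oner_eq0.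
have [B0 B00 HB] := line_general charK0 a_proper pen c0.
have vanish p c : p != 0 -> hval Phi (c *: param p) = 0.
  by move=> p0; rewrite (hvalZ_homog _ _ hom) detmx_curve ?mulr0.
have Phi0 : Phi = 0.
  apply: (@meval_generic _ _ (B0 * 'X_i)).
    rewrite mulf_neq0 // -msize_poly_eq0 msizeX //.
  move=> v; pose x : 'rV[K]_3 := \row_j v j.
  have ex (F : {mpoly K[3]}) : F.@[v] = hval F x by apply: meval_eq => j; rewrite mxE.
  rewrite mevalM mevalXU mulf_eq0 negb_or => /andP[bx vi]; rewrite ex in bx.
  have [ts [uts sts Hts]] := HB x bx.
  (* The line meets x_i = 0 in [x'], so P / P_i + s x' parameterizes it inside the chart x_i = 1,
     with [P] at s = 0. *)
  rewrite ex; pose T0 := x 0 i / P 0 i; pose x' := x - T0 *: P.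
  have x'i : x' 0 i = 0 by rewrite !mxE /T0 mxE mulrVK ?unitfE ?subrr.
  pose q s := hval Phi ((P 0 i)^-1 *: P + s *: x').
  pose p := mmap polyC (fun j => ((P 0 i)^-1 * P 0 j)%:P + x' 0 j *: 'X) Phi.
  have pE s : p.[s] = q s.
    rewrite /p horner_mmap; apply: meval_eq => j.
    by rewrite !hornerE !mxE [s * _]mulrC.
  have sp : (size p <= n.+1)%N.
    apply: size_mmap => [j|].
      apply: leq_trans (size_polyD _ _) _; rewrite geq_max.
      rewrite (leq_trans (size_polyC_leq1 _)) //.
      by apply: leq_trans (size_scale_leq _ _) _; rewrite size_polyX.
    rewrite msizeE; apply/bigmax_leqP_seq => u uP _.
    by have /dhomogP/(_ _ uP) -> := hom.
  pose p2 := mmap polyC (fun j => x' 0 j *: 'X) (local_eq Phi P i).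
  have p2E : p2 = p.
    apply/eqP; rewrite -subr_eq0; apply/eqP; apply: poly_eq0_horner => s.
    rewrite hornerD hornerN pE /p2 horner_mmap.
    have -> : (local_eq Phi P i).@[fun j => (x' 0 j *: 'X).[s]] = (local_eq Phi P i).@[(s *: x') 0].
      by apply: meval_eq => j; rewrite !hornerE !mxE mulrC.
    by rewrite local_eq_eval ?subrr // mxE x'i mulr0.
  have dv : 'X^(m.+1) %| p.
    rewrite -p2E /p2 /mmap big_seq.
    apply: (big_ind (fun z => 'X^(m.+1) %| z)) => [|y z|u]; [exact: dvdp0|exact: dvdp_add|].
    rewrite mcoeff_msupp => u0; apply: dvdp_mull.
    have mu : (m.+1 <= mdeg u)%N.
      by rewrite leqNgt; apply: contraNN u0 => /ge ->.
    apply: dvdp_trans (dvdp_exp2l _ mu) _.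
    rewrite /mmap1 mdegE -prodrXr; under [X in _ %| X]eq_bigr do rewrite exprZn.
    apply: (big_ind2 (fun y z => y %| z)) => [|y1 y2 z1 z2|j _]; first exact: dvdpp.
      exact: dvdp_mul.
    by rewrite -mul_polyC dvdp_mulIr.
  have qT t : t != 0 -> hval Phi (x' + t *: P) = (t * P 0 i) ^+ n * q (t * P 0 i)^-1.
    move=> t0; rewrite -(hvalZ_homog _ _ hom); congr (hval Phi _).
    apply/rowP => j; rewrite !mxE; field; rewrite Pi t0 //.
  have p0 : p = 0.
    (* The cofactor of X^(m + 1) has degree below n - m, yet it vanishes at the n - m other
       intersections. *)
    have /dvdpP[r Er] := dv; suff r0 : r = 0 by rewrite Er r0 mul0r.
    apply/eqP; apply/negPn/negP => r0.
    have sr : (size r <= n - m)%N.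
      have X0 : 'X^(m.+1) != 0 :> {poly K} by rewrite -size_poly_eq0 size_polyXn.
      move: sp; rewrite Er size_mul // size_polyXn; plia.
    case/negP: r0; apply/eqP.
    pose f t := ((t + T0) * P 0 i)^-1.
    have Ht t : t \in ts -> t + T0 != 0 /\ q (f t) = 0.
      move=> /Hts [s [c [cs c1 E]]].
      have E' : x' + (t + T0) *: P = c *: param (aff s).
        by rewrite -E /x' scalerDl [t *: P + _]addrC addrA subrK.
      have t0 : t + T0 != 0.
        apply: contraTneq cs => t0; rewrite negbK; move/rowP/(_ i): E'.
        rewrite mxE x'i t0 scale0r mxE addr0 mxE => /esym /eqP.
        by rewrite mulf_eq0 (negPf c1) /= -lf_param_aff lf_delta.
      split=> //; have := qT _ t0; rewrite E' vanish ?aff_neq0 // => /esym/eqP.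
      rewrite mulf_eq0 expf_eq0 mulf_eq0 (negPf t0) (negPf Pi) andbF /= => /eqP //.
    apply: (@roots_geq_poly_eq0 _ _ [seq f t | t <- ts]); last by rewrite size_map sts.
      apply/allP => _ /mapP[t tin ->]; have [t0 qt] := Ht _ tin.
      move/eqP: qt; rewrite -pE Er hornerM hornerXn mulf_eq0 => /orP[//|].
      by rewrite expf_eq0 /f invr_eq0 mulf_eq0 (negPf t0) (negPf Pi).
    rewrite map_inj_in_uniq // => t s tin sin /invr_inj /(mulIf Pi).
    exact: addIr.
  have T00 : T0 != 0 by rewrite mulf_neq0 ?invr_eq0 // mxE.
  by have := qT _ T00; rewrite subrK -pE p0 horner0 mulr0.
(* At [Q] the matrix is the identity, so [Phi] cannot be zero. *)
have := hval_detmx l1 l2 l3 A B Q; have [z1 z2] := annpair_ann annQ.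
rewrite Phi0 /detmx_at l3Q z1 z2 !scale0r !subr0 det1 /hval meval0 => /esym/eqP.
by rewrite oner_eq0.
Qed.

End Equation.
End Local.
(** Two generators of the ideal of C divide each other, so the order at [P] can be read off the
    determinant. *)
Lemma local_eq_order P m k1 k2 D g h F i : pencil a P m k1 k2 D g h ->
  curve_eq (curve a) F -> P 0 i != 0 ->
  ordge m (local_eq F P i) /\ ~ ordge m.+1 (local_eq F P i).
Proof.
move=> pen [_ HF] Pi.
have [Q [l1 [l2 [l3 [A [B [penQ l3Q AB [_ HPhi]]]]]]]] :=
  implicit_equation charK0 n_gt1 a_proper.
have [H1 E1] : exists H, F = H * \det (detmx l1 l2 l3 A B).
  by apply/HPhi/HF; exists 1; rewrite mul1r.
have [H2 E2] : exists H, \det (detmx l1 l2 l3 A B) = H * F.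
  by apply/HF/HPhi; exists 1; rewrite mul1r.
have o0 (q : {mpoly K[3]}) : ordge 0 q by [].
split.
  rewrite E1 local_eqM; apply: (@ordgeM _ _ 0 m) => //.
  exact: (local_eq_ge Pi pen).
move=> ge; apply: (local_eq_le Pi pen penQ l3Q AB).
by rewrite E2 local_eqM; apply: (@ordgeM _ _ 0 m.+1).
Qed.

Lemma pencil_has_mult P m k1 k2 D g h : P != 0 -> pencil a P m k1 k2 D g h ->
  has_mult (curve a) P m.
Proof.
move=> /rV0Pn[i Pi] pen.
have [Q [l1 [l2 [l3 [A [B [_ _ _ eqPhi]]]]]]] := implicit_equation charK0 n_gt1 a_proper.
have [ge nge] := local_eq_order pen eqPhi Pi.
exists (\det (detmx l1 l2 l3 A B)), i; split=> //.
apply: NNPP => H; apply: nge => u um; apply/eqP/negPn/negP => u0; apply: H.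
exists u => //; apply/eqP; rewrite eqn_leq -ltnS um leqNgt.
by apply: contra u0 => /ge ->.
Qed.

Lemma has_mult_pencil P m k1 k2 D g h mu : pencil a P m k1 k2 D g h ->
  has_mult (curve a) P mu -> mu = m.
Proof.
move=> pen [F [i [eqF Pi ge [u um u0]]]].
have [ge' nge'] := local_eq_order pen eqF Pi.
apply/eqP; rewrite eqn_leq; apply/andP; split.
  by rewrite leqNgt; apply/negP => mmu; apply: nge' => w wm; apply: ge; apply: leq_trans wm mmu.
by rewrite leqNgt -um; apply: contra u0 => /ge' ->.
Qed.

Lemma pencil_curve P m k1 k2 D g h : (0 < m)%N -> pencil a P m k1 k2 D g h -> curve a P.
Proof.
move=> m0 pen; have [sD|sD] := leqP (size D) m.
  by exists infpt; [exact: infpt_neq0|apply: same_pt_sym; apply: pencil_inf pen sD].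
have /closed_rootP[r Dr] : size D != 1%N by plia.
by exists (aff r); [exact: aff_neq0|apply: same_pt_sym; apply: pencil_root pen Dr].
Qed.

Lemma X_nonemptyP k : (2 <= k <= n)%N ->
  nonempty (@Xpts K n a k) <->
  exists (P : 'rV[K]_3) (mu : nat),
    [/\ singular_pt (curve a) P, has_mult (curve a) P mu & (k <= mu)%N].
Proof.
move=> /andP[k2 kn]; split.
  case=> R /(XptsP charK0 n_gt1 a_proper _ kn) [R0 [l1 [l2 [ind [q1 s1 e1] [q2 s2 e2]]]]].
  have [P P0 ann] := indep_annpair ind.
  have [m [D [g [h pen]]]] := pencil_of_annpair charK0 n_gt1 a_proper ann.
  have RV0 : rVpoly R != 0 by rewrite rVpoly_eq0.
  have km := pencil_max n_gt1 pen kn RV0 e1 e2 s1 s2.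
  have mult := pencil_has_mult P0 pen.
  exists P, m; split=> //; split; last by exists m => //; lia.
  by apply: pencil_curve pen; lia.
case=> P [mu [_ mult kmu]]; have P0 : P != 0.
  by case: mult => F [i [_ Pi _ _]]; apply/rV0Pn; exists i.
have [m [l1 [l2 [D [g [h pen]]]]]] := pencil_exists charK0 n_gt1 a_proper P0.
rewrite (has_mult_pencil pen mult) in kmu.
have [R [XR _ _]] := pencil_fdvd charK0 n_gt1 a_proper pen kmu.
by exists R.
Qed.

Lemma singular_contracted P : singular_pt (curve a) P ->
  exists2 R : 'rV[K]_3, Xpts a R & contracted_to a R P.
Proof.
case=> _ [mu mu1 mult]; have P0 : P != 0.
  by case: mult => F [i [_ Pi _ _]]; apply/rV0Pn; exists i.
have [m [l1 [l2 [D [g [h pen]]]]]] := pencil_exists charK0 n_gt1 a_proper P0.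
have [ann _ _ _ _] := pen.
rewrite (has_mult_pencil pen mult) in mu1.
have [R [XR d1 d2]] := pencil_fdvd charK0 n_gt1 a_proper pen mu1.
have n2 : (0 < 2 <= n)%N by [].
exists R => //; exact: (fdvd_contracted n_gt1 a_proper n2 ann P0 d1 d2).
Qed.

End Multiplicity.

(** * The length of X_2 *)

Section MSize.
Variables (K : fieldType) (k : nat).
Implicit Types p q : {mpoly K[k]}.

Lemma msize_sum_le (I : Type) (r : seq I) (P : pred I) (F : I -> {mpoly K[k]}) d :
  (forall i, P i -> (msize (F i) <= d)%N) -> (msize (\sum_(i <- r | P i) F i) <= d)%N.
Proof.
move=> H; elim/big_ind: _ => [|p q hp hq|//]; first by rewrite msize0.
by apply: leq_trans (msizeD_le _ _) _; rewrite geq_max hp.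
Qed.

Lemma msize_sub_le p q d : (msize p <= d)%N -> (msize q <= d)%N -> (msize (p - q) <= d)%N.
Proof. by move=> hp hq; apply: leq_trans (msizeD_le _ _) _; rewrite msizeN geq_max hp. Qed.

Lemma msize_mul_le p q d e : (msize p <= d.+1)%N -> (msize q <= e)%N ->
  (msize (p * q) <= d + e)%N.
Proof.
have [->|p0] := eqVneq p 0; first by rewrite mul0r msize0.
have [->|q0] := eqVneq q 0; first by rewrite mulr0 msize0.
rewrite msizeM //; move: p0 q0; rewrite -!(msize_poly_eq0 (n := k)).
by move: (msize p) (msize q) => x y; lia.
Qed.

Lemma msize_prod_le (I : Type) (r : seq I) (F : I -> {mpoly K[k]}) (e : I -> nat) :
  (forall i, (msize (F i) <= (e i).+1)%N) -> (msize (\prod_(i <- r) F i) <= (\sum_(i <- r) e i).+1)%N.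
Proof.
move=> H; elim: r => [|i r IH]; first by rewrite !big_nil msize1.
by rewrite !big_cons -addnS; apply: msize_mul_le.
Qed.

Lemma msize_signr p b : msize ((-1) ^+ b * p) = msize p.
Proof. by rewrite -signr_odd mulr_sign; case: ifP; rewrite ?msizeN. Qed.

Lemma perm_descent n (s : 'S_n) : s != 1%g -> exists i, (s i < i)%N.
Proof.
move=> s1; apply/existsP; apply: contraNT s1; rewrite negb_exists => /forallP H.
have le (i : 'I_n) : (i <= s i)%N by rewrite leqNgt.
have E : (\sum_(i < n) val i = \sum_(i < n) val (s i))%N.
  by rewrite (reindex_inj (@perm_inj _ s)).
have [_ e] := leqif_sum (P := predT) (fun i _ => leqif_eq (le i)).
move: e; rewrite -E eqxx => /esym/forallP e.
by apply/eqP/permP => i; rewrite perm1; apply/val_inj/esym/eqP; exact: e.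
Qed.

Lemma msize_det_le n (M : 'M[{mpoly K[k]}]_n) :
  (forall i j, (msize (M i j) <= 2)%N) -> (msize (\det M) <= n.+1)%N.
Proof.
move=> H; apply: msize_sum_le => s _; rewrite msize_signr.
apply: leq_trans (msize_prod_le _ (e := fun=> 1%N) _) _ => [i|]; first exact: H.
by rewrite sum_nat_const card_ord muln1.
Qed.

(** The linear part is triangular with diagonal [x]; a permutation other than the identity passes
    below the diagonal, where the entry is constant, and loses a degree. *)
Lemma msize_det_trig n (M : 'M[{mpoly K[k]}]_n) (x : {mpoly K[k]}) : (msize x <= 2)%N ->
  (forall i j, (msize (M i j) <= 2)%N) ->
  (forall i j : 'I_n, (j <= i)%N -> (msize (M i j - x *+ (i == j)) <= 1)%N) ->
  (msize (\det M - x ^+ n) <= n)%N.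
Proof.
move=> hx H2 H1; rewrite /determinant (bigD1 1%g) //= odd_perm1 mul1r.
rewrite addrAC; apply: leq_trans (msizeD_le _ _) _; rewrite geq_max; apply/andP; split.
  have {H2} H i : (msize (M i i - x) <= 1)%N by have := H1 i i (leqnn i); rewrite eqxx mulr1n.
  under eq_bigr do rewrite perm1.
  elim: n M {H1} H => [|n IH] M H; first by rewrite big_ord0 expr0 subrr msize0.
  rewrite big_ord_recl exprS.
  set P := \prod_i _.
  have -> : M ord0 ord0 * P - x * x ^+ n = x * (P - x ^+ n) + (M ord0 ord0 - x) * P by ring.
  apply: leq_trans (msizeD_le _ _) _; rewrite geq_max; apply/andP; split.
    apply: (@msize_mul_le _ _ 1 n) => //.
    have := IH (\matrix_(i, j) M (lift ord0 i) (lift ord0 j)).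
    under eq_bigr do rewrite mxE; apply=> i; by rewrite mxE.
  apply: (@msize_mul_le _ _ 0 n.+1) => //.
  apply: leq_trans (msize_prod_le _ (e := fun=> 1%N) _) _ => [i|].
    rewrite -[M _ _](subrK x); apply: leq_trans (msizeD_le _ _) _.
    by rewrite geq_max hx (leq_trans (H _)).
  by rewrite sum_nat_const card_ord muln1.
apply: msize_sum_le => s s1; rewrite msize_signr.
have [i0 si0] := perm_descent s1.
apply: leq_trans (msize_prod_le _ (e := fun i : 'I_n => nat_of_bool (i <= s i)%N) _) _ => [i|].
  have [//|si] := leqP i (s i).
  have := H1 i (s i) (ltnW si); rewrite -val_eqE /= gtn_eqF // mulr0n subr0 //.
have si : (i0 <= s i0)%N = false by rewrite leqNgt si0.
rewrite (bigD1 i0) //= si add0n -[X in (_ < X)%N]card_ord.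
have cE : #|'I_n| = (\sum_(i | i != i0) 1).+1.
  by rewrite -sum1_card (bigD1 i0).
by rewrite cE ltnS; apply: leq_sum => i _; case: (i <= s i)%N.
Qed.

End MSize.

Section Cofactors.
Variables (R : comNzRingType) (N : nat) (L : 'M[R]_(N.+1, N)).

(* The zero column is a placeholder: it is deleted by the cofactor. *)
Definition cof (i : 'I_N.+1) : R := cofactor (row_mx (0 : 'cV_N.+1) L : 'M_N.+1) i ord0.

Lemma det_row_mx (v : 'cV[R]_N.+1) :
  \det (row_mx v L : 'M_N.+1) = \sum_i v i 0 * cof i.
Proof.
rewrite (expand_det_col _ ord0); apply: eq_bigr => i _; congr (_ * _).
  by rewrite mxE; case: splitP => // j _; rewrite ord1.
rewrite /cof /cofactor; congr (_ * \det _); apply/matrixP => x y; rewrite !mxE.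
by case: splitP => // j; rewrite ord1.
Qed.

(** The determinant of [L] bordered by one of its own columns is zero. *)
Lemma cof_relation j : \sum_i L i j * cof i = 0.
Proof.
have -> : \sum_i L i j * cof i = \sum_i (col j L) i 0 * cof i.
  by apply: eq_bigr => i _; rewrite mxE.
rewrite -det_row_mx -det_tr.
have j1 : ord0 != rshift 1 j :> 'I_N.+1 by [].
apply: (determinant_alternate j1) => i; rewrite !mxE.
case: splitP => // c _; rewrite mxE; case: splitP => [c'|c' /eqP]; first by rewrite ord1.
by rewrite /= !add1n eqSS => /eqP/val_inj ->.
Qed.

End Cofactors.

(** The induction step of [cof_lead]: the relation passes the error term of [d0] on to [d1]. *)
Lemma lead_step (R : comNzRingType) (y z d1 d0 S : R) e m : z * d1 + y * d0 + S = 0 ->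
  z * (d1 - (-1) ^+ m.+1 * (y ^+ m.+1 * z ^+ e)) =
  - (y * (d0 - (-1) ^+ m * (y ^+ m * z ^+ e.+1))) - S.
Proof.
move=> rel; have -> : S = - (z * d1 + y * d0) by apply/eqP; rewrite -addr_eq0 addrC rel.
by rewrite !exprS; ring.
Qed.

(** For [Jnf_mulX]: the relation trades [y * d0] for [z * d1]. *)
Lemma exchange_step (R : comNzRingType) (y z d1 d0 S sgn zs : R) : z * d1 + y * d0 + S = 0 ->
  y * (sgn * zs * d0) = - sgn * (z * zs) * d1 + - (sgn * zs) * S.
Proof.
move=> rel; have -> : S = - (z * d1 + y * d0) by apply/eqP; rewrite -addr_eq0 addrC rel.
by ring.
Qed.

Lemma scale_signr (R : comNzRingType) k n (p : {mpoly R[k]}) :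
  (-1) ^+ n *: ((-1) ^+ n * p) = p.
Proof.
rewrite -mul_mpolyC rmorphXn rmorphN1 mulrA -exprD addnn -mul2n exprM sqrrN.
by rewrite !expr1n mul1r.
Qed.

(** * Maximal minors of a perturbed Kronecker block *)

Section Pencil2.
Variables (K : fieldType) (N : nat) (C : 'M[K]_(N.+1, N)).
Local Notation A := {mpoly K[2]}.
Local Notation y := ('X_(0 : 'I_2) : A).
Local Notation z := ('X_(1 : 'I_2) : A).

Definition Lmx : 'M[A]_(N.+1, N) :=
  \matrix_(i, j) (z *+ (i == j.+1 :> nat) + y *+ (i == j :> nat) + (C i j)%:MP).

Local Notation d := (cof Lmx).

Lemma msizeXU (i : 'I_2) : msize ('X_i : A) = 2.
Proof. by rewrite msizeX mdeg1. Qed.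

Lemma msizeCle (c : K) : (msize (c%:MP : A) <= 1)%N.
Proof. by rewrite msizeC; case: eqP. Qed.

Lemma Lmx_msize i j : (msize (Lmx i j) <= 2)%N.
Proof.
rewrite mxE; apply: leq_trans (msizeD_le _ _) _; rewrite geq_max (leq_trans (msizeCle _)) // andbT.
apply: leq_trans (msizeD_le _ _) _.
by do 2 case: eqP => _; rewrite ?mulr1n ?mulr0n ?msize0 ?msizeXU.
Qed.

Lemma cofE i : d i = (-1) ^+ (i + 0) * \det (row' i Lmx).
Proof.
rewrite /cof /cofactor; congr (_ * \det _); apply/matrixP => r c; rewrite !mxE.
case: splitP => [j|j /= e]; first by rewrite ord1.
have -> : c = j by apply/val_inj; move: e; rewrite /bump !add1n => -[].
by rewrite !mxE.
Qed.

Lemma cof_msize i : (msize (d i) <= N.+1)%N.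
Proof.
rewrite cofE msize_signr; apply: msize_det_le => r c; rewrite mxE; exact: Lmx_msize.
Qed.

Lemma cof0_lead : (msize (d ord0 - z ^+ N) <= N)%N.
Proof.
rewrite cofE addn0 expr0 mul1r; apply: msize_det_trig; first by rewrite msizeXU.
  by move=> r c; rewrite mxE; exact: Lmx_msize.
move=> r c cr; rewrite !mxE /= /bump /= add1n eqSS -val_eqE /=.
have -> : (r.+1 == c :> nat) = false by lia.
by rewrite mulr0n addr0 addrAC subrr add0r msizeCle.
Qed.

Lemma cof_rel (j : 'I_N) :
  z * d (lift ord0 j) + y * d (widen_ord (leqnSn N) j) + \sum_i (C i j)%:MP * d i = 0.
Proof.
rewrite -[RHS](cof_relation Lmx j).
transitivity (\sum_(i < N.+1) (z *+ (i == j.+1 :> nat) * d i + y *+ (i == j :> nat) * d i + (C i j)%:MP * d i)).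
  rewrite !big_split /=; congr (_ + _ + _).
    rewrite (bigD1 (lift ord0 j)) //= eqxx mulr1n big1 ?addr0 // => i.
    by rewrite -val_eqE /= /bump add1n => /negPf ->; rewrite mulr0n mul0r.
  rewrite (bigD1 (widen_ord (leqnSn N) j)) //= eqxx mulr1n big1 ?addr0 // => i.
  by rewrite -val_eqE /= => /negPf ->; rewrite mulr0n mul0r.
by apply: eq_bigr => i _; rewrite [Lmx _ _]mxE !mulrDl.
Qed.

(** Induction along the column relations: in top degree they read z d_(j+1) = - y d_j, and
    cancelling [z] lowers the degree bound by one. The start is the triangular determinant of
    [cof0_lead]. *)
Lemma cof_lead (i : 'I_N.+1) :
  (msize (d i - (-1) ^+ i * (y ^+ i * z ^+ (N - i))) <= N)%N.
Proof.
case: i => i; elim: i => [|i IH] iN.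
  have -> : Ordinal iN = ord0 by apply: val_inj.
  by rewrite /= !expr0 !mul1r subn0; exact: cof0_lead.
have iN' : (i < N)%N by [].
have := cof_rel (Ordinal iN').
have -> : lift ord0 (Ordinal iN') = Ordinal iN by apply: val_inj.
have iN'' : (i < N.+1)%N by exact: ltnW.
have -> : widen_ord (leqnSn N) (Ordinal iN') = Ordinal iN'' by apply: val_inj.
move: (IH iN'') => {}IH /=.
set S := \sum_i _ => rel.
set q := _ - _; set p := (_ - _) in IH.
have zq : z * q = - (y * p) - S.
  rewrite /q /p /=; have -> : (N - i = (N - i.+1).+1)%N by lia.
  exact: lead_step.
have szq : (msize (z * q) <= N.+1)%N.
  rewrite zq; apply: msize_sub_le.
    by rewrite msizeN; apply: (@msize_mul_le _ _ _ _ 1 N); rewrite ?msizeXU.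
  apply: msize_sum_le => k _; apply: (@msize_mul_le _ _ _ _ 0 N.+1).
    exact: msizeCle.
  exact: cof_msize.
have [->|q0] := eqVneq q 0; first by rewrite msize0.
have z0 : z != 0 by rewrite -msize_poly_eq0 msizeXU.
by move: szq; rewrite msizeM // msizeXU.
Qed.

Definition mk (b c : nat) : 'X_{1..2} := [multinom if val i == 0%N then b else c | i < 2].

Lemma mk_eta (u : 'X_{1..2}) : u = mk (u 0) (u 1).
Proof.
apply/mnmP => i; rewrite mnmE; case: (unliftP 0 i) => [j ->|->] //=.
by congr (u _); apply: val_inj; rewrite /= ord1.
Qed.

Lemma mdeg_mk b c : mdeg (mk b c) = (b + c)%N.
Proof. by rewrite mdegE !big_ord_recl big_ord0 !mnmE addn0. Qed.

Lemma mk0 b c : mk b c 0 = b. Proof. by rewrite mnmE. Qed.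
Lemma mk1 b c : mk b c 1 = c. Proof. by rewrite mnmE. Qed.

Lemma XmkE b c : 'X_[mk b c] = y ^+ b * z ^+ c.
Proof.
rewrite [LHS](mpolyXE_id); rewrite !big_ord_recl big_ord0 mulr1 !mnmE /=.
by have -> : lift ord0 ord0 = 1 :> 'I_2 by apply: val_inj.
Qed.

(* The monomials of degree >= N are deformed into multiples of the minors;
   the deformation is unitriangular for the degree. *)
Definition theta (u : 'X_{1..2}) : A :=
  if (mdeg u < N)%N then 'X_[u]
  else let i := minn (u 0%R) N in
    (-1) ^+ i * 'X_[mk (u 0%R - i) (u 1%R - (N - i))] * d (inord i).

(** The minimum in [theta] selects an [i] for which y^i z^(N - i), the leading form of [d i] up to
    sign, divides the monomial. *)
Lemma theta_lead u : (msize ('X_[u] - theta u) <= mdeg u)%N.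
Proof.
rewrite /theta; case: ltnP => uN; first by rewrite subrr msize0.
move: uN; rewrite [u]mk_eta mdeg_mk !mk0 !mk1; move: (u 0) (u 1) => b c uN; set i := minn _ _.
have iN : (i <= N)%N by rewrite geq_minr.
have iu : (i <= b)%N by rewrite geq_minl.
have iz : (N - i <= c)%N by rewrite /i; lia.
have := cof_lead (inord i); rewrite inordK // => H.
have -> : 'X_[mk b c] = 'X_[mk (b - i) (c - (N - i))] * (y ^+ i * z ^+ (N - i)).
  by rewrite !XmkE mulrACA -!exprD !subnK.
move: (y ^+ i * z ^+ (N - i)) (d (inord i)) H => q e H.
have -> : 'X_[mk (b - i) (c - (N - i))] * q -
    (-1) ^+ i * 'X_[mk (b - i) (c - (N - i))] * e =
    'X_[mk (b - i) (c - (N - i))] * ((-1) ^+ i * (- (e - (-1) ^+ i * q))).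
  by rewrite opprB mulrBr mulrA -exprD addnn -mul2n exprM sqrrN !expr1n mul1r; ring.
have -> : (b + c = (b - i + (c - (N - i))) + N)%N by lia.
apply: msize_mul_le; first by rewrite msizeX mdeg_mk.
by rewrite msize_signr msizeN.
Qed.

Definition Theta (c : A) : A := \sum_(u <- msupp c) c@_u *: theta u.

Lemma Theta_wide c k : (msize c <= k)%N ->
  Theta c = \sum_(u : 'X_{1..2 < k}) c@_u *: theta u.
Proof.
move=> le_pk; pose I : subFinType _ := 'X_{1..2 < k}.
rewrite /Theta (big_mksub I) ?msupp_uniq //=; first last.
  by move=> x /msize_mdeg_lt /leq_trans; apply.
by rewrite big_rmcond //= => j /memN_msupp_eq0 ->; rewrite scale0r.
Qed.

Lemma ThetaD c e : Theta (c + e) = Theta c + Theta e.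
Proof.
pose k := maxn (msize c) (msize e).
rewrite !(@Theta_wide _ k) ?leq_maxl ?leq_maxr ?msizeD_le //.
by rewrite -big_split; apply: eq_bigr => u _; rewrite mcoeffD scalerDl.
Qed.

Lemma ThetaZX b u : Theta (b *: 'X_[u]) = b *: theta u.
Proof.
have [->|b0] := eqVneq b 0; first by rewrite !scale0r /Theta msupp0 big_nil.
by rewrite /Theta msuppMCX // big_seq1 mcoeffZ mcoeffX eqxx mulr1.
Qed.

(** The span of the [theta u] of degree at least [N]. Its generators are multiples of minors; that
    it is the whole ideal of the minors is the content of [Jnf_mul] and [Jnf_cof]. *)
Definition Jnf (p : A) := exists2 c : A, (forall u, u \in msupp c -> (N <= mdeg u)%N) & p = Theta c.

Lemma JnfD p q : Jnf p -> Jnf q -> Jnf (p + q).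
Proof.
case=> c hc -> [e he ->]; exists (c + e); last by rewrite ThetaD.
by move=> u /msuppD_le; rewrite mem_cat => /orP[/hc|/he].
Qed.

Lemma JnfX b u : (N <= mdeg u)%N -> Jnf (b *: theta u).
Proof.
move=> Nu; exists (b *: 'X_[u]); last by rewrite ThetaZX.
by move=> w /msuppZ_le; rewrite msuppX inE => /eqP ->.
Qed.

Lemma Jnf0 : Jnf 0.
Proof. by exists 0 => [u|]; rewrite ?msupp0 // /Theta msupp0 big_nil. Qed.

Lemma Jnf_sum (I : Type) (r : seq I) (P : pred I) (F : I -> A) :
  (forall i, P i -> Jnf (F i)) -> Jnf (\sum_(i <- r | P i) F i).
Proof. by move=> H; elim/big_ind: _ => //; [exact: Jnf0|exact: JnfD]. Qed.

Lemma thetaE b c i : (i <= N)%N -> (i = b \/ (i = N /\ N <= b))%N -> (N <= b + c)%N ->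
  theta (mk b c) = (-1) ^+ i * (y ^+ (b - i) * z ^+ (c - (N - i))) * d (inord i).
Proof.
move=> iN ib bc; rewrite /theta mdeg_mk ltnNge bc /= mk0 mk1.
have -> : minn b N = i by lia.
by rewrite XmkE.
Qed.

(** Multiplying by [z] keeps the minor used by [theta]. Multiplying by [y] changes it when b < N:
    the relation replaces y d_b by z d_(b+1) and constant multiples of the minors, and times the
    power z^s all of these are again in the span. *)
Lemma Jnf_mulX (j : 'I_2) p : Jnf p -> Jnf ('X_j * p).
Proof.
suff gen (b c : nat) (e : K) : (N <= b + c)%N -> Jnf (e *: ('X_j * theta (mk b c))).
  case=> c hc ->; rewrite /Theta mulr_sumr big_seq; apply: Jnf_sum => u /hc Nu.
  have bc : (N <= u 0%R + u 1%R)%N by rewrite -mdeg_mk -mk_eta.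
  by rewrite -scalerAr; have := gen _ _ (c@_u) bc; rewrite -mk_eta.
move=> bc {p}.
have [j1|j0] : j = 1 \/ j = 0.
  by case: j => [[|[|//]] ?]; [right|left]; apply: val_inj.
  pose i := minn b N.
  have -> : 'X_j * theta (mk b c) = theta (mk b c.+1).
    rewrite j1 !(@thetaE _ _ i) /i; try lia.
    have -> : (c.+1 - (N - minn b N) = (c - (N - minn b N)).+1)%N by lia.
    by rewrite exprS; ring.
  by apply: JnfX; rewrite mdeg_mk; lia.
rewrite j0; have [Nb|bN] := leqP N b.
  have -> : y * theta (mk b c) = theta (mk b.+1 c).
    rewrite !(@thetaE _ _ N); try lia.
    by rewrite subSn // exprS; ring.
  by apply: JnfX; rewrite mdeg_mk; lia.
pose s := (b + c - N)%N.
have rel : z * d (inord b.+1) + y * d (inord b) + \sum_i (C i (Ordinal bN))%:MP * d i = 0.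
  have := cof_rel (Ordinal bN).
  have -> : lift ord0 (Ordinal bN) = inord b.+1 by apply: val_inj; rewrite /= inordK.
  by have -> : widen_ord (leqnSn N) (Ordinal bN) = inord b by apply: val_inj; rewrite /= inordK // ltnW.
have tE (i : 'I_N.+1) : z ^+ s * d i = (-1) ^+ i *: theta (mk i (N - i + s)).
  rewrite (@thetaE _ _ i); try by have := ltn_ord i; lia.
  by rewrite subnn expr0 mul1r addKn inord_val -mulrA scale_signr.
have -> : y * theta (mk b c) = theta (mk b.+1 c) +
    \sum_(i < N.+1) (- (-1) ^+ b * C i (Ordinal bN) * (-1) ^+ i) *: theta (mk i (N - i + s)).
  rewrite (@thetaE b c b); try lia.
  rewrite (@thetaE b.+1 c b.+1); try lia.
  rewrite !subnn !expr0 !mul1r.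
  have -> : (c - (N - b) = s)%N by rewrite /s; lia.
  have -> : (c - (N - b.+1) = s.+1)%N by rewrite /s; lia.
  rewrite (exchange_step _ _ rel); congr (_ + _); first by rewrite !exprS mulN1r.
  rewrite mulr_sumr; apply: eq_bigr => i _.
  rewrite -scalerA -tE -mul_mpolyC mpolyCM mpolyCN rmorphXn rmorphN1.
  by move: (d i) ((C i _)%:MP) ((-1) ^+ b) (z ^+ s) => t1 t2 t3 t4; ring.
rewrite scalerDr; apply: JnfD; first by apply: JnfX; rewrite mdeg_mk; lia.
rewrite scaler_sumr; apply: Jnf_sum => i _; rewrite scalerA.
by apply: JnfX; rewrite mdeg_mk; have := ltn_ord i; lia.
Qed.

Lemma JnfZ b p : Jnf p -> Jnf (b *: p).
Proof.
case=> c hc ->; rewrite /Theta scaler_sumr big_seq; apply: Jnf_sum => u /hc Nu.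
by rewrite scalerA; apply: JnfX.
Qed.

Lemma Jnf_mul q p : Jnf p -> Jnf (q * p).
Proof.
move=> Jp; rewrite [q]mpolyE mulr_suml; apply: Jnf_sum => u _.
rewrite -scalerAl; apply: JnfZ; rewrite (mk_eta u) XmkE.
elim: (u 0) => [|b IH]; last by rewrite exprS -!mulrA; apply: Jnf_mulX; rewrite mulrA.
rewrite expr0 mul1r; elim: (u 1) => [|c IH]; first by rewrite expr0 mul1r.
by rewrite exprS -mulrA; apply: Jnf_mulX.
Qed.

Lemma Jnf_cof (i : 'I_N.+1) : Jnf (d i).
Proof.
have -> : d i = (-1) ^+ i *: theta (mk i (N - i)).
  rewrite (@thetaE _ _ i); try by have := ltn_ord i; lia.
  rewrite !subnn !expr0 mul1r mulr1 inord_val -mul_mpolyC rmorphXn rmorphN1.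
  by rewrite mulrA -exprD addnn -mul2n exprM sqrrN !expr1n mul1r.
by apply: JnfX; rewrite mdeg_mk; have := ltn_ord i; lia.
Qed.

(** An element of the ideal is [Theta c] with [c] supported in degrees at least [N], and [Theta]
    preserves the degree. *)
Lemma minors_low (v : 'I_N.+1 -> A) :
  (msize (\sum_i v i * d i) <= N)%N -> \sum_i v i * d i = 0.
Proof.
have : Jnf (\sum_i v i * d i) by apply: Jnf_sum => i _; apply: Jnf_mul; exact: Jnf_cof.
case=> c hc ->; have [->|c0] := eqVneq c 0; first by rewrite /Theta msupp0 big_nil.
move=> low; exfalso; have := c0; rewrite -msize_poly_eq0.
have [u uc um] : exists2 u, u \in msupp c & msize c = (mdeg u).+1.
  by exists (mlead c); rewrite ?mlead_supp // mlead_deg.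
move=> _; have Nu := hc u uc.
have tE : Theta c = c - \sum_(w <- msupp c) c@_w *: ('X_[w] - theta w).
  rewrite {2}[c]mpolyE -sumrB; apply: eq_bigr => w _.
  by rewrite scalerBr subKr.
have small : (msize (\sum_(w <- msupp c) c@_w *: ('X_[w] - theta w)) <= mdeg u)%N.
  rewrite big_seq; apply: msize_sum_le => w /msize_mdeg_lt; rewrite um ltnS => wu.
  by apply: leq_trans (msizeZ_le _ _) _; apply: leq_trans (theta_lead _) _.
have : (msize c <= mdeg u)%N.
  have -> : c = Theta c + \sum_(w <- msupp c) c@_w *: ('X_[w] - theta w) by rewrite tE subrK.
  by apply: leq_trans (msizeD_le _ _) _; rewrite geq_max small (leq_trans low).
by rewrite um ltnn.
Qed.

(** Division by the leading forms: in degree at least [N], [p - Theta p] has smaller degree than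
    [p], while [Theta p] is a low part plus a combination of minors. *)
Lemma minors_span (p : A) : exists (q : A) (v : 'I_N.+1 -> A),
  (msize q <= N)%N /\ p = q + \sum_i v i * d i.
Proof.
have [k] := ubnP (msize p); elim: k p => // k IH p; rewrite ltnS => pk.
have [pN|Np] := leqP (msize p) N.
  exists p, (fun=> 0); split=> //; rewrite big1 ?addr0 // => i _; exact: mul0r.
pose r := \sum_(u <- msupp p) p@_u *: ('X_[u] - theta u).
have thJ u : exists (q : A) (w : 'I_N.+1 -> A),
    (msize q <= N)%N /\ theta u = q + \sum_i w i * d i.
  rewrite /theta; case: ltnP => uN.
    exists 'X_[u], (fun=> 0); rewrite msizeX; split=> //.
    by rewrite big1 ?addr0 // => i _; exact: mul0r.
  set i := minn _ _; set c := _ * 'X_[_].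
  exists 0, (fun j => if j == inord i then c else 0); rewrite msize0 add0r; split=> //.
  by rewrite (bigD1 (inord i)) //= eqxx big1 ?addr0 // => j /negPf ->; rewrite mul0r.
have addJ p1 p2 : (exists (q : A) (w : 'I_N.+1 -> A), (msize q <= N)%N /\ p1 = q + \sum_i w i * d i) ->
    (exists (q : A) (w : 'I_N.+1 -> A), (msize q <= N)%N /\ p2 = q + \sum_i w i * d i) ->
    exists (q : A) (w : 'I_N.+1 -> A), (msize q <= N)%N /\ p1 + p2 = q + \sum_i w i * d i.
  case=> q1 [w1 [h1 ->]] [q2 [w2 [h2 ->]]]; exists (q1 + q2), (fun i => w1 i + w2 i); split.
    by apply: leq_trans (msizeD_le _ _) _; rewrite geq_max h1.
  by rewrite addrACA -big_split; congr (_ + _); apply: eq_bigr => i _; rewrite mulrDl.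
have -> : p = Theta p + r.
  rewrite {1}[p]mpolyE /Theta /r -big_split; apply: eq_bigr => u _ /=.
  by rewrite -scalerDr addrC subrK.
apply: (addJ).
  rewrite /Theta; elim/big_ind: _ => [|p1 p2 h1 h2|u _]; last 1 first.
  - have [q [w [qN ->]]] := thJ u; exists (p@_u *: q), (fun i => p@_u *: w i); split.
      exact: leq_trans (msizeZ_le _ _) qN.
    by rewrite scalerDr scaler_sumr; congr (_ + _); apply: eq_bigr => i _; rewrite scalerAl.
  - exists 0, (fun=> 0); rewrite msize0 add0r big1 // => i _; exact: mul0r.
  - exact: addJ.
apply: IH; apply: leq_trans _ pk; rewrite ltnNge; apply/negP => pr.
have : (msize r <= (msize p).-1)%N.
  rewrite /r big_seq; apply: msize_sum_le => u /msize_mdeg_lt up.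
  apply: leq_trans (msizeZ_le _ _) _; apply: leq_trans (theta_lead _) _.
  by move: up; case: (msize p).
move=> rp; have := leq_trans pr rp; move: Np; case: (msize p) => // sp _.
by rewrite ltnn.
Qed.

End Pencil2.

(** * Ideals of maximal minors under row and column operations *)

Section IdealGen.
Variables (K : fieldType) (m : nat) (S : {mpoly K[m.+1]} -> Prop).

Lemma ideal_gen0 : ideal_gen S 0.
Proof.
exists 0%N, (fun=> 0), (fun=> 0); split; first by case.
by rewrite big_ord0.
Qed.

Lemma ideal_genD p q : ideal_gen S p -> ideal_gen S q -> ideal_gen S (p + q).
Proof.
case=> r [c [g [Sg ->]]] [r' [c' [g' [Sg' ->]]]].
pose pick T (f : 'I_r -> T) (f' : 'I_r' -> T) (i : 'I_(r + r')) :=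
  match split i with inl j => f j | inr j => f' j end.
exists (r + r')%N, (pick _ c c'), (pick _ g g'); split.
  by move=> i; rewrite /pick; case: (split i).
rewrite big_split_ord; congr (_ + _); apply: eq_bigr => i _; rewrite /pick.
  by rewrite (unsplitK (inl i)).
by rewrite (unsplitK (inr i)).
Qed.

Lemma ideal_genMl q p : ideal_gen S p -> ideal_gen S (q * p).
Proof.
case=> r [c [g [Sg ->]]]; exists r, (fun i => q * c i), g; split=> //.
by rewrite mulr_sumr; apply: eq_bigr => i _; rewrite mulrA.
Qed.

Lemma ideal_gen_mem p : S p -> ideal_gen S p.
Proof.
by move=> Sp; exists 1%N, (fun=> 1), (fun=> p); split=> //; rewrite big_ord1 mul1r.
Qed.

Lemma ideal_gen_sum (I : Type) (r : seq I) (P : pred I) F :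
  (forall i, P i -> ideal_gen S (F i)) -> ideal_gen S (\sum_(i <- r | P i) F i).
Proof. by move=> H; elim/big_ind: _ => //; [exact: ideal_gen0|exact: ideal_genD]. Qed.

End IdealGen.

Section MaximalMinors.
Variables (K : fieldType) (m q : nat) (M : 'M[{mpoly K[m.+1]}]_(q.+1, q)).

Lemma cof_row' i : cof M i = (-1) ^+ (i + 0) * \det (row' i M).
Proof.
rewrite /cof /cofactor; congr (_ * \det _); apply/matrixP => r c; rewrite !mxE.
case: splitP => [j|j /= e]; first by rewrite ord1.
by have -> : c = j by apply/val_inj; move: e; rewrite /bump !add1n => -[].
Qed.

(** Bordering by an arbitrary column turns the ideal into a set of determinants, on which invertible
    matrices act by multiplicativity. *)
Lemma ideal_minors x : ideal_gen (minor q M) x <->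
  exists v : 'cV_q.+1, x = \det (row_mx v M : 'M_q.+1).
Proof.
split; last first.
  case=> v ->; rewrite det_row_mx; apply: ideal_gen_sum => i _; apply: ideal_genMl.
  rewrite cof_row'; apply: ideal_genMl; apply: ideal_gen_mem.
  exists (lift i), id; split=> //.
    by move=> r c rc; rewrite /= /bump; do 2 case: leqP; lia.
case=> r [c [g [Sg ->]]].
have H k : exists v : 'cV_q.+1, g k = \det (row_mx v M : 'M_q.+1).
  have [f [h [fh hh ->]]] := Sg k.
  have homo_inj p (u : 'I_q -> 'I_p) : {homo u : i j / (i < j)%N} -> injective u.
    move=> hu i j; case: (ltngtP i j) => [/hu|/hu|/val_inj //] ij e.
      by rewrite e ltnn in ij.
    by rewrite e ltnn in ij.
  have [i0 i0f] : exists i0, i0 \notin codom f.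
    apply/existsP; rewrite -negb_forall; apply/negP => /forallP fsurj.
    have : (#|'I_q.+1| <= #|codom f|)%N by apply: subset_leq_card; apply/subsetP => i _.
    by rewrite card_codom ?card_ord ?ltnn //; exact: homo_inj.
  have ne j : i0 != f j by apply: contraNneq i0f => ->; exact: codom_f.
  pose s j := odflt j (unlift i0 (f j)).
  have fs j : f j = lift i0 (s j).
    by rewrite /s; case: unliftP (ne j) => [x' ->|->] //=; rewrite eqxx.
  have sinj : injective s by move=> i j e; apply: (homo_inj _ _ fh); rewrite !fs e.
  have hinj := homo_inj _ _ hh.
  have E := @mxsub_perm_det _ _ _ _ M f h (lift i0) id (perm sinj) (perm hinj) _ _.
  have {}E : \det (mxsub f h M) = (-1) ^+ (perm sinj) * (-1) ^+ (perm hinj) * \det (row' i0 M).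
    have -> : row' i0 M = mxsub (lift i0) id M by apply/matrixP => y z; rewrite !mxE.
    by apply: E => j; rewrite /= permE ?fs.
  exists (((-1) ^+ (perm sinj) * (-1) ^+ (perm hinj) * (-1) ^+ (i0 + 0)) *: delta_mx i0 0).
  rewrite det_row_mx (bigD1 i0) //= big1 ?addr0; last first.
    by move=> i ii0; rewrite !mxE (negPf ii0) mulr0 mul0r.
  rewrite !mxE !eqxx mulr1 cof_row' E -!mulrA; congr (_ * (_ * _)).
  by rewrite mulrA -exprD addnn -mul2n exprM sqrrN !expr1n mul1r.
elim/big_rec: _ => [|k y _ [v ->]].
  exists 0; rewrite det_row_mx big1 // => i _; by rewrite mxE mul0r.
have [w ->] := H k; exists (c k *: w + v).
rewrite !det_row_mx mulr_sumr -big_split; apply: eq_bigr => i _.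
by rewrite !mxE mulrDl mulrA.
Qed.

End MaximalMinors.

(** Multiplying by [U] and by the square matrix [E] changes bordered determinants by units only, and
    the identity block then splits off. *)
Lemma ideal_reduction (K : fieldType) m N q (M : 'M[{mpoly K[m.+1]}]_(N.+1 + 3, q))
    (L : 'M[{mpoly K[m.+1]}]_(N.+1, N)) U (E : 'M[K]_(N + 3, q)) x :
  q = (N + 3)%N -> U \in unitmx -> row_free E ->
  U *m M = block_mx L 0 0 1%:M *m map_mx (@mpolyC m.+1 K) E ->
  ideal_gen (minor (N + 3) M) x <-> exists v, x = \sum_i v i * cof L i.
Proof.
move=> e; subst q; rewrite row_free_unit => uU uE UM.
pose C := @mpolyC m.+1 K; pose E' := map_mx C E.
have uE' : E' \in unitmx by rewrite map_unitmx.
rewrite (@ideal_minors K m (N + 3)%N M).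
have mE (v : 'cV_(N.+1 + 3)) : U *m row_mx v M =
    (block_mx (row_mx (usubmx (U *m v)) L : 'M_N.+1) 0 (row_mx (dsubmx (U *m v)) 0) (1%:M : 'M_3)
      : 'M_(N.+1 + 3, 1 + (N + 3))) *m block_mx (1%:M : 'M_1) 0 0 E'.
  rewrite mul_mx_row UM -[in LHS](vsubmxK (U *m v)).
  have -> : row_mx (col_mx (usubmx (U *m v)) (dsubmx (U *m v))) (block_mx L 0 0 1%:M *m E') =
      row_mx (col_mx (usubmx (U *m v)) (dsubmx (U *m v))) (block_mx L 0 0 1%:M) *m
      block_mx (1%:M : 'M_1) 0 0 E'.
    by rewrite mul_row_block mulmx1 !mulmx0 addr0 add0r.
  congr (_ *m _).
  by rewrite [X in row_mx _ X]block_mxEh row_mxA castmx_id -block_mxEh block_mxEv -block_mxEh.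
have key (v : 'cV_(N.+1 + 3)) :
    \det U * \det (row_mx v M : 'M_((N + 3).+1)) =
    \det (row_mx (usubmx (U *m v)) L : 'M_N.+1) * \det E'.
  have -> : \det E' = \det (block_mx (1%:M : 'M_1) 0 0 E') by rewrite det_ublock det1 mul1r.
  have -> : \det (row_mx (usubmx (U *m v)) L : 'M_N.+1) =
      \det (block_mx (row_mx (usubmx (U *m v)) L : 'M_N.+1) 0
              (row_mx (dsubmx (U *m v)) 0) (1%:M : 'M_3)).
    by rewrite det_lblock det1 mulr1.
  rewrite -!det_mulmx; congr determinant; exact: mE.
have uU0 : \det U \is a GRing.unit by rewrite -unitmxE.
have uE0 : \det E' \is a GRing.unit by rewrite -unitmxE.
split=> [[v ->]|[v ->]].
  exists (fun i => (\det U)^-1 * \det E' * usubmx (U *m v) i 0).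
  apply: (mulrI uU0); rewrite key det_row_mx mulrC.
  move: (\det U) uU0 (\det E') => t ut e.
  by rewrite !mulr_sumr; apply: eq_bigr => i _; rewrite !mulrA mulrV // mul1r.
pose w : 'cV[{mpoly K[m.+1]}]_(N.+1 + 3) := col_mx (\col_i v i) 0.
exists (\det U *: ((\det E')^-1 *: (invmx U *m w))).
apply: (mulrI uU0); rewrite key -!scalemxAr mulKVmx // det_row_mx.
move: (\det U) (\det E') uE0 => t e ue.
rewrite mulr_suml mulr_sumr; apply: eq_bigr => i _; rewrite /w !linearZ /= col_mxKu !mxE.
by move: (cof L i) => d; rewrite -!mulrA; congr (_ * _); rewrite [d * e]mulrC mulrCA mulKr.
Qed.

(* The affine chart G_R(c) = 1 of P^2, with coordinates y, z such that
   G_R = 1 + y (T - c) + z (T - c)^2. *)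
Section Chart.
Variables (K : fieldType) (c : K).
Local Notation A := {mpoly K[2]}.
Local Notation B := {mpoly K[3]}.
Local Notation y := ('X_(0 : 'I_2) : A).
Local Notation z := ('X_(1 : 'I_2) : A).

Definition R0 : 'rV[K]_3 := \row_i [:: 1; 0; 0]`_i.
Definition R1 : 'rV[K]_3 := \row_i [:: - c; 1; 0]`_i.
Definition R2 : 'rV[K]_3 := \row_i [:: c ^+ 2; - (c *+ 2); 1]`_i.

Lemma rVpolyE3 (p : {poly K}) (s : 'rV[K]_3) :
  (size p <= 3)%N -> (forall i : 'I_3, s 0 i = p`_i) -> rVpoly s = p.
Proof.
move=> sp H; rewrite -(poly_rV_K sp); congr rVpoly.
by apply/rowP => i; rewrite H mxE.
Qed.

Lemma rVpoly_R0 : rVpoly R0 = 1.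
Proof.
apply: rVpolyE3; first by rewrite size_poly1.
by move=> i; rewrite mxE coef1; case: i => [[|[|[|//]]] ?].
Qed.

Lemma rVpoly_R1 : rVpoly R1 = 'X - c%:P.
Proof.
apply: rVpolyE3; first by rewrite size_XsubC.
move=> i; rewrite mxE coefB coefX coefC; case: i => [[|[|[|//]]] ?] /=;
  by rewrite ?sub0r ?subr0 ?oppr0.
Qed.

Lemma rVpoly_R2 : rVpoly R2 = ('X - c%:P) ^+ 2.
Proof.
apply: rVpolyE3; first by rewrite size_exp_XsubC.
have -> : ('X - c%:P) ^+ 2 = 'X^2 - (c *+ 2) *: 'X + (c ^+ 2)%:P.
  by rewrite -mul_polyC polyCMn polyC_exp; ring.
move=> i; rewrite mxE coefD coefB coefZ coefXn coefX coefC.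
by case: i => [[|[|[|//]]] ?] /=; rewrite ?mulr1 ?mulr0 ?sub0r ?subr0 ?oppr0 ?add0r ?addr0.
Qed.

Definition psi : B -> A :=
  mmap (@mpolyC 2 K) (fun i => (R0 0 i)%:MP + R1 0 i *: y + R2 0 i *: z).
HB.instance Definition _ := GRing.RMorphism.on psi.

(** A section of [psi], obtained by solving x_1 = y - 2c z and x_2 = z. *)
Definition rho : A -> B :=
  mmap (@mpolyC 3 K) (fun i => if i == 0 then 'X_1 + (c *+ 2) *: 'X_2%:R else 'X_2%:R).
HB.instance Definition _ := GRing.RMorphism.on rho.

Definition evl : 'rV[K]_3 := \row_i c ^+ i.

Lemma lf_evl R : lf evl R = (rVpoly R).[c].
Proof.
rewrite (@horner_coef_wide _ 3) ?size_poly //; apply: eq_bigr => i _.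
by rewrite mxE coef_rVpoly_ord mulrC.
Qed.

Lemma psi_evl : psi (lin_form evl) = 1.
Proof.
have H (s : 'rV[K]_3) (u : A) : \sum_i (evl 0 i * s 0 i) *: u = (rVpoly s).[c] *: u.
  by rewrite -lf_evl -scaler_suml.
rewrite /lin_form raddf_sum /=.
transitivity (\sum_i ((evl 0 i * R0 0 i) *: 1 + (evl 0 i * R1 0 i) *: y + (evl 0 i * R2 0 i) *: z) : A).
  apply: eq_bigr => i _; rewrite -mul_mpolyC /psi rmorphM /= mmapC mmapX mmap1U.
  by rewrite mul_mpolyC !scalerDr !scalerA -[(R0 0 i)%:MP]alg_mpolyC scalerA.
rewrite !big_split /= !H rVpoly_R0 rVpoly_R1 rVpoly_R2 !hornerE subrr expr0n /=.
by rewrite !scale0r !addr0 scale1r.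
Qed.

Lemma rho_psi (p : B) : exists h, p = rho (psi p) + h * (lin_form evl - 1).
Proof.
have closM (q r : B) : (exists h, q = rho (psi q) + h * (lin_form evl - 1)) ->
    (exists h, r = rho (psi r) + h * (lin_form evl - 1)) ->
    exists h, q * r = rho (psi (q * r)) + h * (lin_form evl - 1).
  case=> h Eh [k Ek]; exists (h * r + rho (psi q) * k).
  have -> : rho (psi (q * r)) = rho (psi q) * rho (psi r) by rewrite !rmorphM.
  rewrite {1}Eh mulrDl [in RHS]mulrDl {1}Ek.
  by move: (rho (psi q)) (rho (psi r)) (lin_form evl) => q' r' l; ring.
rewrite [p]mpolyE; elim/big_ind: _ => [|p1 p2 [h1 E1] [h2 E2]|u _].
- by exists 0; rewrite !rmorph0 mul0r addr0.
- exists (h1 + h2); rewrite !rmorphD /= {1}E1 {1}E2 mulrDl addrACA //.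
rewrite -mul_mpolyC; apply: (closM).
  by exists 0; rewrite /psi mmapC /rho mmapC mul0r addr0.
rewrite mpolyXE_id; elim/big_ind: _ => [|//|i _]; first by exists 0; rewrite !rmorph1 mul0r addr0.
elim: (u i) => [|e IH]; first by exists 0; rewrite !rmorph1 mul0r addr0.
rewrite exprS; apply: (closM) IH.
have X i' : rho (psi 'X_i') = (R0 0 i')%:MP + R1 0 i' *: ('X_1 + (c *+ 2) *: 'X_2%:R) + R2 0 i' *: 'X_2%:R.
  rewrite /psi mmapX mmap1U !rmorphD /= -!mul_mpolyC !rmorphM /=.
  by rewrite /rho !mmapC !mmapX !mmap1U /= !mul_mpolyC.
have lE : lin_form evl = 'X_0 + c *: 'X_1 + (c ^+ 2) *: 'X_2%:R.
  rewrite /lin_form !big_ord_recl big_ord0 addr0 !mxE /= expr0 expr1 scale1r addrA.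
  by congr ('X__ + _ *: 'X__ + _ *: 'X__); apply: val_inj.
have i012 : [\/ i = 0, i = 1 | i = 2%:R].
  by case: i => [[|[|[|//]]] ?]; [apply: Or31|apply: Or32|apply: Or33]; apply: val_inj.
(* The composite fixes x_1 and x_2, and moves x_0 by exactly [lin_form evl - 1]. *)
exists (i == 0)%:R; rewrite X lE /R0 /R1 /R2 !mxE.
case: i012 => -> /=; rewrite ?scale0r ?scale1r ?mul0r ?mul1r ?addr0 ?add0r ?mpolyC0 ?mpolyC1.
- rewrite -!mul_mpolyC mpolyCN mpolyCMn expr2 mpolyCM; ring.
- rewrite -!mul_mpolyC mpolyCN; ring.
- by [].
Qed.

End Chart.

(* The coefficients b_i of the Bezoutian
   (g1(q) g2(t) - g2(q) g1(t)) / (t - q) = sum_i b_i(t) q^i, in t = T - c; they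
   put the pencil of multiplications by forms of degree 2 vanishing at c in
   Kronecker normal form. *)
Section Bezoutian.
Variables (K : closedFieldType) (N : nat) (c : K) (g h : {poly K}).
Hypothesis cop : coprimep g h.
Hypothesis se : maxn (size g) (size h) = N.+2.
Local Notation t := ('X - c%:P).

Definition shiftp (p : {poly K}) := p \Po ('X + c%:P).
Local Notation g' := (shiftp g).
Local Notation h' := (shiftp h).

Lemma shiftpK p : shiftp p \Po t = p.
Proof. by rewrite /shiftp -comp_polyA comp_polyD comp_polyX comp_polyC subrK comp_polyXr. Qed.

Lemma size_shiftp p : size (shiftp p) = size p.
Proof. by rewrite size_comp_poly2 // size_XaddC. Qed.

Lemma coprime_shiftp : coprimep g' h'.
Proof.
apply/Pdiv.ClosedField.coprimepP => r; rewrite /root !horner_comp !hornerE => gr.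
by apply: (coprimep_root cop).
Qed.

Lemma dropS (p : {poly K}) k : 'X * drop_poly k.+1 p = drop_poly k p - (p`_k)%:P.
Proof.
apply/polyP => i; rewrite coefXM coefB coefC !coef_drop_poly.
case: i => [|i] /=; first by rewrite add0n subrr.
by rewrite subr0 addSnnS.
Qed.

(** The polynomials [drop_poly i.+1 p] have distinct degrees N - i. *)
Lemma drop_free (p : {poly K}) (x : 'I_N.+1 -> K) : size p = N.+2 ->
  \sum_i x i *: drop_poly i.+1 p = 0 -> forall i, x i = 0.
Proof.
move=> sp /polyP E [i iN]; have [k] := ubnP i; elim: k i iN => // k IH i iN; rewrite ltnS => ik.
have := E (N - i)%N; rewrite coef0 coef_sum (bigD1 (Ordinal iN)) //= big1 ?addr0.
  rewrite coefZ coef_drop_poly; have -> : (N - i + i.+1 = (size p).-1)%N by rewrite sp /=; lia.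
  move/eqP; rewrite mulf_eq0 -lead_coefE lead_coef_eq0 -size_poly_eq0 sp orbF => /eqP //.
move=> [j jN] /=; rewrite -val_eqE /= coefZ coef_drop_poly => ji.
have [jlt|jge] := ltnP j i; first by rewrite IH ?mul0r //; apply: leq_trans jlt ik.
by rewrite (leq_sizeP _ _ (leqnn (size p))) ?mulr0 // sp; lia.
Qed.

Lemma drop_free_const (p : {poly K}) (x : 'I_N -> K) y : size p = N.+2 ->
  \sum_i x i *: drop_poly i.+1 p + y%:P = 0 -> (forall i, x i = 0) /\ y = 0.
Proof.
move=> sp E; have lc0 : p`_N.+1 != 0.
  have -> : p`_N.+1 = lead_coef p by rewrite lead_coefE sp.
  by rewrite lead_coef_eq0 -size_poly_eq0 sp.
pose x' (i : 'I_N.+1) := if unlift ord_max i is Some j then x j else y / p`_N.+1.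
have x'w j : x' (widen_ord (leqnSn N) j) = x j.
  rewrite /x'; have -> : widen_ord (leqnSn N) j = lift ord_max j.
    by apply/val_inj; rewrite /= /bump leqNgt ltn_ord.
  by rewrite liftK.
have dN : drop_poly N.+1 p = (p`_N.+1)%:P.
  apply/polyP => i; rewrite coef_drop_poly coefC; case: i => [|i] //=.
  by rewrite (leq_sizeP _ _ (leqnn (size p))) // sp; lia.
have x'0 : forall i, x' i = 0.
  apply: (drop_free sp); rewrite -[RHS]E big_ord_recr /=; congr (_ + _).
    by apply: eq_bigr => i _; rewrite x'w.
  by rewrite /x' unlift_none dN -mul_polyC -polyCM mulfVK.
split=> [i|]; first by rewrite -x'w.
have := x'0 ord_max; rewrite /x' unlift_none => /eqP; rewrite mulf_eq0 invr_eq0 (negPf lc0) orbF.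
by move/eqP.
Qed.

(** A closed form of the Bezoutian coefficients: [bez k.+1] is b_k up to sign, since both satisfy
    the recursion [bez0S] from 0. *)
Definition bez0 k := drop_poly k g' * h' - drop_poly k h' * g'.
Definition bez k := bez0 k \Po t.

Lemma bez0S k : 'X * bez0 k.+1 = bez0 k - g'`_k *: h' + h'`_k *: g'.
Proof. by rewrite /bez0 mulrBr !mulrA !dropS -!mul_polyC; ring. Qed.

Lemma bez0_0 : bez0 0 = 0.
Proof. by rewrite /bez0 !drop_poly0l mulrC subrr. Qed.

Lemma bez0_end : bez0 N.+2 = 0.
Proof.
have d (p : {poly K}) : (size p <= N.+2)%N -> drop_poly N.+2 (shiftp p) = 0.
  by move=> sp; rewrite drop_poly_eq0 // size_shiftp.
by rewrite /bez0 !d -?se ?leq_maxl ?leq_maxr // !mul0r subrr.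
Qed.

(** The source of the Kronecker form: modulo the pencil, multiplication by T - c shifts the index by
    one. *)
Lemma bez_mul k : t * bez k.+1 = bez k - g'`_k *: h + h'`_k *: g.
Proof.
have := congr1 (fun p => p \Po t) (bez0S k).
have lin (p q r : {poly K}) x y :
    (p - x *: q + y *: r) \Po t = p \Po t - x *: (q \Po t) + y *: (r \Po t).
  by rewrite comp_polyD comp_polyB !comp_polyZ.
by rewrite comp_polyM comp_polyX lin !shiftpK.
Qed.

Lemma bez_0 : bez 0 = 0. Proof. by rewrite /bez bez0_0 comp_poly0. Qed.
Lemma bez_end : bez N.+2 = 0. Proof. by rewrite /bez bez0_end comp_poly0. Qed.

Lemma size_bez k : (size (bez k) <= N.+1)%N.
Proof.
elim: k => [|k IH]; first by rewrite bez_0 size_poly0.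
have [->|b0] := eqVneq (bez k.+1) 0; first by rewrite size_poly0.
have : (size (t * bez k.+1)%R <= N.+2)%N.
  rewrite bez_mul; apply: leq_trans (size_polyD _ _) _; rewrite geq_max.
  rewrite (leq_trans (size_scale_leq _ _)) -?se ?leq_maxl // andbT.
  apply: leq_trans (size_polyD _ _) _; rewrite size_polyN geq_max.
  by rewrite (leq_trans (size_scale_leq _ _)) -?se ?leq_maxr ?andbT // se leqW.
by rewrite size_mul ?polyXsubC_eq0 // size_XsubC.
Qed.

Lemma comp_sub_inj (p : {poly K}) : p \Po t = 0 -> p = 0.
Proof.
move=> p0; have : shiftp (p \Po t) = 0 by rewrite p0 /shiftp comp_poly0.
by rewrite /shiftp -comp_polyA comp_polyB comp_polyX comp_polyC addrK comp_polyXr.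
Qed.

Lemma size_drop_sum (p : {poly K}) k (x : 'I_k -> K) : (size p <= N.+2)%N ->
  (size (\sum_i x i *: drop_poly i.+1 p)%R <= N.+1)%N.
Proof.
move=> sp; apply: leq_trans (size_sum _ _ _) _; apply/bigmax_leqP => i _.
apply: leq_trans (size_scale_leq _ _) _; rewrite size_drop_poly; lia.
Qed.

Lemma bez_sum k (x : 'I_k -> K) : \sum_i x i *: bez i.+1 =
  ((\sum_i x i *: drop_poly i.+1 g') * h' - (\sum_i x i *: drop_poly i.+1 h') * g') \Po t.
Proof.
rewrite !mulr_suml -sumrB raddf_sum; apply: eq_bigr => i _ /=.
by rewrite -!scalerAl -scalerBr comp_polyZ.
Qed.

Let sg' : (size g' <= N.+2)%N. Proof. by rewrite size_shiftp -se leq_maxl. Qed.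
Let sh' : (size h' <= N.+2)%N. Proof. by rewrite size_shiftp -se leq_maxr. Qed.
Let se' : maxn (size g') (size h') = N.+2. Proof. by rewrite !size_shiftp. Qed.
Let big_gh : size g' = N.+2 \/ size h' = N.+2.
Proof.
by have := se'; case: leqP => _ E; [right|left].
Qed.

Lemma bez_free (x : 'I_N.+1 -> K) : \sum_i x i *: bez i.+1 = 0 -> forall i, x i = 0.
Proof.
rewrite bez_sum => /comp_sub_inj /subr0_eq E.
have [u0 v0] := coprime_syzygy0 coprime_shiftp se' (size_drop_sum x sg') (size_drop_sum x sh') E.
by case: big_gh => /drop_free; apply.
Qed.

(** [bez N.+1] is left out because it is a combination of [g] and [h]. The constants [y], [z] are
    absorbed into a syzygy of [g'], [h'] whose degree is still too low. *)
Lemma bez_free2 (x : 'I_N -> K) y z : \sum_i x i *: bez i.+1 + y *: g + z *: h = 0 ->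
  [/\ forall i, x i = 0, y = 0 & z = 0].
Proof.
rewrite bez_sum -{3}(shiftpK g) -{3}(shiftpK h) -!comp_polyZ -!comp_polyD => /comp_sub_inj E.
set u := \sum_i _ in E; set v := \sum_i _ in E; rewrite !comp_polyZ in E.
have su : (size u <= N.+1)%N by exact: size_drop_sum.
have sv : (size v <= N.+1)%N by exact: size_drop_sum.
have sC (w : K) : (size (w%:P : {poly K}) <= N.+1)%N by exact: leq_trans (size_polyC_leq1 _) _.
have E' : (u + z%:P) * h' = (v - y%:P) * g'.
  apply/eqP; rewrite -subr_eq0 -[X in _ == X]E -!mul_polyC; apply/eqP; ring.
have [||u0 v0] := coprime_syzygy0 coprime_shiftp se' _ _ E'.
- by apply: leq_trans (size_polyD _ _) _; rewrite geq_max su sC.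
- by apply: leq_trans (size_polyD _ _) _; rewrite size_polyN geq_max sv sC.
have C0 (w : K) : w%:P = 0 :> {poly K} -> w = 0 by move/eqP; rewrite polyC_eq0 => /eqP.
rewrite -polyCN in v0.
case: big_gh => [/drop_free_const|/drop_free_const] free.
  have [x0 z0] := free _ _ u0; split=> //.
  have : (- y)%:P = 0 :> {poly K}.
    by rewrite -[RHS]v0 /v big1 ?add0r // => i _; rewrite x0 scale0r.
  by move/C0/eqP; rewrite oppr_eq0 => /eqP.
have [x0 /eqP] := free _ _ v0; rewrite oppr_eq0 => /eqP y0; split=> //; apply: C0.
by rewrite -[RHS]u0 /u big1 ?add0r // => i _; rewrite x0 scale0r.
Qed.

End Bezoutian.

(** * Reduction of M_2 at a general point of the curve *)

Section Length.
Variables (K : closedFieldType) (n : nat) (a : 'M[K]_(3, n.+1)).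
Hypothesis charK0 : [pchar K] =i pred0.
Hypothesis n_gt2 : (2 < n)%N.
Hypothesis a_proper : proper_param a.
Local Notation cpoly := (cpoly a).
Local Notation param := (param a).
Local Notation A := {mpoly K[2]}.
Local Notation N := (n - 2)%N.

Let n_gt1 : (1 < n)%N. Proof. exact: ltnW. Qed.

(** [c] is a zero of no [G_R] with R in X_2. If the fixed divisor at its image had degree 2 or more,
    [c] and a second point of it, possibly infinity, would form such a [G_R]. *)
Lemma smooth_point : exists c l1 l2 (g1 g2 : {poly K}),
  [/\ annpair (param (aff c)) l1 l2,
      cpoly l1 = ('X - c%:P) * g1 /\ cpoly l2 = ('X - c%:P) * g2,
      coprimep g1 g2, maxn (size g1) (size g2) = n
    & forall R : 'rV[K]_3, Xpts a R -> (rVpoly R).[c] != 0].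
Proof.
have [E E0 HE] := X_roots charK0 n_gt1 a_proper.
have [c Ec] : exists c, ~~ root E c by apply/closed_nonrootP.
have noX (R : 'rV[K]_3) : Xpts a R -> ~~ root (rVpoly R) c.
  by move=> XR; apply: contra Ec; exact: (HE 2%N R n_gt1 XR c).
have P0 : param (aff c) != 0 by apply: (proj1 a_proper); exact: aff_neq0.
have [m [l1 [l2 [D [g [h pen]]]]]] := pencil_exists charK0 n_gt1 a_proper P0.
have [ann [E1 E2] cop se [sD D0 mn]] := pen.
have [z1 z2] := annpair_ann ann; rewrite !lf_param_aff in z1 z2.
have Dc : root D c.
  apply/negPn/negP => Dc; move: z1 z2; rewrite E1 E2 !hornerM => /eqP; rewrite mulf_eq0 -rootE (negPf Dc) /=.
  move=> gc /eqP; rewrite mulf_eq0 -rootE (negPf Dc) /=; apply/negP; exact: coprimep_root cop gc.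
have /factor_theorem[D1 ED] := Dc; rewrite mulrC in ED.
have D10 : D1 != 0 by apply: contraNneq D0 => z; rewrite ED z mulr0.
have sDD : size D = (size D1).+1 by rewrite ED size_mul ?polyXsubC_eq0 // size_XsubC.
have m1 : (m <= 1)%N.
  rewrite leqNgt; apply/negP => m2.
  have bad (G D2 : {poly K}) : D = G * D2 -> (size G <= 3)%N -> root G c ->
      (size D2 <= m.-1)%N -> False.
    move=> EG sG Gc sD2.
    have G0 : G != 0 by apply: contraNneq D0 => z; rewrite EG z mul0r.
    have dv l (q : {poly K}) : cpoly l = D * q -> (size q <= (n - m).+1)%N ->
        fdvd a 2 (rVpoly (poly_rV G : 'rV_3)) l.
      move=> El sq; exists (D2 * q); last by rewrite poly_rV_K // mulrA -EG.
      by apply: leq_trans (size_polyMleq _ _) _; plia.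
    have XG : Xpts a (poly_rV G : 'rV_3).
      apply/(XptsP charK0 n_gt1 a_proper _ n_gt1); split.
        by rewrite -rVpoly_eq0 poly_rV_K.
      have [_ _ ind] := ann; exists l1, l2; split=> //.
        by apply: dv E1 _; rewrite -se leq_maxl.
      by apply: dv E2 _; rewrite -se leq_maxr.
    by have := noX _ XG; rewrite poly_rV_K // Gc.
  have [/closed_rootP[s /factor_theorem[D2 ED1]]|] := boolP (size D1 != 1%N).
    apply: (bad (('X - c%:P) * ('X - s%:P)) D2).
    - by rewrite ED ED1; ring.
    - by rewrite size_mul ?polyXsubC_eq0 // !size_XsubC.
    - by rewrite rootM root_XsubC eqxx.
    - have D20 : D2 != 0 by apply: contraNneq D10 => z; rewrite ED1 z mul0r.
      by move: sD; rewrite sDD ED1 size_mul ?polyXsubC_eq0 // size_XsubC; plia.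
  rewrite negbK => /eqP sD1; apply: (bad ('X - c%:P) D1) => //.
  - by rewrite size_XsubC.
  - by rewrite root_XsubC.
  - by plia.
have D1pos : (0 < size D1)%N by rewrite lt0n size_poly_eq0.
have sD1 : size D1 = 1%N by plia.
have m_eq : m = 1%N by plia.
have /size_poly1P[d d0 Ed] : size D1 == 1%N by rewrite sD1.
exists c, l1, l2, (d *: g), (d *: h); split=> //.
- by rewrite E1 E2 ED Ed -!mul_polyC !mulrA.
- by rewrite coprimepZl // coprimepZr.
- by rewrite !size_scale // se m_eq; lia.
Qed.

Section Reduction.
Variables (c : K) (l1 l2 : 'rV[K]_3) (g h : {poly K}).
Hypothesis ann : annpair (param (aff c)) l1 l2.
Hypothesis E1 : cpoly l1 = ('X - c%:P) * g.
Hypothesis E2 : cpoly l2 = ('X - c%:P) * h.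
Hypothesis cop : coprimep g h.
Hypothesis se : maxn (size g) (size h) = n.
Local Notation t := ('X - c%:P).
Local Notation bez := (bez c g h).

Let nN : n = N.+2. Proof. by lia. Qed.
Let seN : maxn (size g) (size h) = N.+2. Proof. by rewrite -nN. Qed.

Lemma size_tbez k i : (k <= 2)%N -> (size (t ^+ k * bez i)%R <= n.+1)%N.
Proof.
move=> k2; apply: leq_trans (size_polyMleq _ _) _; rewrite size_exp_XsubC.
by have := size_bez c seN i; plia.
Qed.

Definition bezmx k : 'M[K]_(N.+1, n.+1) := \matrix_i poly_rV (t ^+ k * bez i.+1).
Definition emx : 'M[K]_(N, n.+1) := \matrix_j poly_rV (t * bez j.+1).
(** The basis of polynomials of degree at most n in which the columns of M_2 take their normal
    form. *)
Definition Emx : 'M[K]_(N + 3, n.+1) := col_mx emx a.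
Definition bezbase : 'M[K]_N.+1 := \matrix_i poly_rV (bez i.+1).

Lemma sum_rVpoly (F : 'I_N -> {poly K}) (u : 'rV[K]_N) d : (forall j, (size (F j) <= d)%N) ->
  rVpoly (u *m \matrix_j (poly_rV (F j) : 'rV_d)) = \sum_j u 0 j *: F j.
Proof.
move=> sF; rewrite mulmx_sum_row raddf_sum; apply: eq_bigr => j _ /=.
by rewrite rowK linearZ /= poly_rV_K.
Qed.

(** Evaluation at [c] kills [emx], so in a relation the part from [a] is the pullback of a
    combination of [l1] and [l2]; after division by T - c, [bez_free2] applies. *)
Lemma row_free_Emx : row_free Emx.
Proof.
rewrite -kermx_eq0; apply/rowV0P => u /sub_kermxP.
rewrite -[u]hsubmxK mul_row_col => /(congr1 rVpoly).
rewrite linearD linear0 /= -/(cpoly _) sum_rVpoly; last first.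
  by move=> j; rewrite -['X - _]expr1; exact: size_tbez.
set x := lsubmx u; set d := rsubmx u => E.
have dc : lf d (param (aff c)) = 0.
  rewrite lf_param_aff; have := congr1 (horner^~ c) E.
  rewrite hornerD horner_sum big1 ?add0r ?horner0 // => j _.
  by rewrite hornerZ hornerM hornerXsubC subrr mul0r mulr0.
have [sp _ _] := ann; have [p [q Ed]] := proj1 (sp d) dc.
have t0 : t != 0 by rewrite polyXsubC_eq0.
have /(bez_free2 cop seN)[x0 p0 q0] : \sum_j x 0 j *: bez j.+1 + p *: g + q *: h = 0.
  apply: (mulfI t0); rewrite mulr0 -[RHS]E Ed cpolyD !cpolyZ E1 E2 !mulrDr mulr_sumr -addrA.
  by congr (_ + (_ + _)); [apply: eq_bigr => j _|..]; rewrite -scalerAr.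
have -> : x = 0 by apply/rowP => j; rewrite x0 mxE.
by rewrite Ed p0 q0 !scale0r addr0 row_mx0.
Qed.

Lemma row_full_Emx : row_full Emx.
Proof.
have /eqP r := row_free_Emx.
by rewrite /row_full r; apply/eqP; lia.
Qed.

Lemma bezbase_unit : bezbase \in unitmx.
Proof.
rewrite -row_free_unit -kermx_eq0; apply/rowV0P => u /sub_kermxP /(congr1 rVpoly) E.
apply/rowP => i; rewrite mxE; apply: (bez_free cop seN (x := fun i => u 0 i)).
rewrite linear0 in E; rewrite -[RHS]E mulmx_sum_row raddf_sum; apply: eq_bigr => j _ /=.
by rewrite rowK linearZ /= poly_rV_K // size_bez.
Qed.

Let size_comb p q : (size (t * (p *: g + q *: h))%R <= n.+1)%N.
Proof.
apply: leq_trans (size_polyMleq _ _) _; rewrite size_XsubC /=.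
rewrite ltnS; apply: leq_trans (size_polyD _ _) _; rewrite -[X in (_ <= X)%N]se geq_max.
by rewrite !(leq_trans (size_scale_leq _ _)) ?leq_maxl ?leq_maxr.
Qed.

Let comb_sub p q : ((poly_rV (t * (p *: g + q *: h)) : 'rV[K]_n.+1) <= a)%MS.
Proof.
apply/submxP; exists (p *: l1 + q *: l2); apply: (can_inj rVpolyK).
rewrite -/(cpoly _) cpolyD !cpolyZ E1 E2 poly_rV_K; first by rewrite mulrDr -!scalerAr.
exact: size_comb.
Qed.

Lemma bezmx1 : exists Y, bezmx 1 = row_mx (\matrix_(i, j) (i == j :> nat)%:R) Y *m Emx.
Proof.
set S := \matrix_(i, j) _.
suff /submxP[Y EY] : (bezmx 1 - S *m emx <= a)%MS.
  by exists Y; rewrite mul_row_col -EY addrC subrK.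
apply/row_subP => i; rewrite linearB /= rowK expr1 row_mul.
have [iN|iN] := ltnP i N.
  have -> : row i S *m emx = poly_rV (t * bez i.+1).
    have -> : row i S = delta_mx 0 (Ordinal iN) by apply/rowP => j; rewrite !mxE eq_sym.
    by rewrite -rowE rowK.
  by rewrite subrr sub0mx.
(* The last row has no counterpart in [emx]; it lies in the row space of [a] because
   [bez N.+2 = 0]. *)
have iE : i.+1 = N.+1 by have := ltn_ord i; lia.
have -> : row i S = 0.
  apply/rowP => j; rewrite !mxE; case: eqP => // e; have := ltn_ord j; rewrite -e; lia.
rewrite mul0mx subr0 iE.
have := bez_mul c g h N.+1; rewrite bez_end // mulr0 => /esym/eqP.
rewrite -addrA addr_eq0 => /eqP ->.
rewrite opprD opprK -scaleNr [X in t * X]addrC; exact: comb_sub.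
Qed.

Lemma bezmx2 : exists Y, bezmx 2 = row_mx (\matrix_(i, j) (i == j.+1 :> nat)%:R) Y *m Emx.
Proof.
set S := \matrix_(i, j) _.
suff /submxP[Y EY] : (bezmx 2 - S *m emx <= a)%MS.
  by exists Y; rewrite mul_row_col -EY addrC subrK.
apply/row_subP => i; rewrite linearB /= rowK row_mul.
have -> : row i S *m emx = poly_rV (t * bez i).
  case: i => [[|i] iN] /=.
    have -> : row (Ordinal iN) S = 0 by apply/rowP => j; rewrite !mxE.
    by rewrite mul0mx bez_0 mulr0 linear0.
  have -> : row (Ordinal iN) S = delta_mx 0 (Ordinal (iN : (i < N)%N)).
    by apply/rowP => j; rewrite !mxE eqSS eq_sym.
  by rewrite -rowE rowK.
have aux (p q r : {poly K}) : p - q + r - p = - q + r by ring.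
rewrite -linearB /= expr2 -mulrA -mulrBr bez_mul aux.
rewrite -scaleNr [X in t * X]addrC; exact: comb_sub.
Qed.

Local Notation C := (@mpolyC 2 K).
Local Notation y := ('X_(0 : 'I_2) : A).
Local Notation z := ('X_(1 : 'I_2) : A).

Lemma bez_shift k (R : 'rV[K]_3) : rVpoly R = t ^+ k -> (k <= 2)%N ->
  bezbase *m shiftmx n R = bezmx k.
Proof.
move=> ER k2; apply/row_matrixP => i; rewrite row_mul !rowK.
apply: (can_inj rVpolyK); rewrite (shiftmx_mul R _ n_gt1) ER !poly_rV_K ?size_tbez //; last exact: size_bez.
by rewrite mulrC.
Qed.

Lemma psi_Mmat : map_mx (psi c) (Mmat a 2) =
  col_mx (map_mx C (shiftmx n (R0 K)) + y *: map_mx C (shiftmx n (R1 c))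
            + z *: map_mx C (shiftmx n (R2 c))) (map_mx C a).
Proof.
rewrite map_col_mx; congr col_mx; apply/matrixP => i j; last first.
  by rewrite !mxE /psi mmapC.
rewrite mxE [LHS](_ : _ = psi c ((if (i <= j <= i + 2)%N then 'X_(inord (j - i)) else 0))); last by rewrite mxE.
rewrite !mxE; case: ifP => _; last by rewrite rmorph0 mpolyC0 !mulr0 !addr0.
by rewrite /psi mmapX mmap1U -!mul_mpolyC ![_%:MP * _]mulrC !mxE.
Qed.

(** [bezbase] on the rows and [Emx] on the columns turn the blocks of 1, T - c and (T - c)^2 into a
    constant block, the truncated identity and its shift, up to rows of [a]. The factor with [- Y]
    in [U] subtracts the latter. *)
Lemma reduction : exists Cm : 'M[K]_(N.+1, N), forall x : A,
  ideal_gen (minor (n - 2 + 3) (map_mx (psi c) (Mmat a 2))) x <->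
  exists v, x = \sum_i v i * cof (Lmx Cm) i.
Proof.
have [W EW] : exists W, bezmx 0 = W *m Emx.
  by exists (bezmx 0 *m pinvmx Emx); rewrite mulmxKpV // submx_full // row_full_Emx.
have [Y1 EY1] := bezmx1; have [Y2 EY2] := bezmx2.
pose Cm : 'M[K]_(N.+1, N) := lsubmx W; exists Cm => x.
pose Y : 'M[A]_(N.+1, 3) := map_mx C (rsubmx W) + y *: map_mx C Y1 + z *: map_mx C Y2.
pose U : 'M[A]_(N.+1 + 3) :=
  block_mx 1%:M (- Y) 0 1%:M *m block_mx (map_mx C bezbase) 0 0 1%:M.
apply: (@ideal_reduction K 1 N n.+1 _ (Lmx Cm) U Emx x).
- by lia.
- rewrite unitmx_mul !unitmxE !det_ublock !det1 mulr1 unitr1 /= mulr1.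
  by rewrite det_map_mx rmorph_unit // -unitmxE bezbase_unit.
- exact: row_free_Emx.
have top : map_mx C bezbase *m (map_mx C (shiftmx n (R0 K)) + y *: map_mx C (shiftmx n (R1 c))
            + z *: map_mx C (shiftmx n (R2 c))) = row_mx (Lmx Cm) Y *m map_mx C Emx.
  rewrite !mulmxDr -!scalemxAr -!map_mxM.
  rewrite (@bez_shift 0) ?rVpoly_R0 ?expr0 // (@bez_shift 1) ?rVpoly_R1 ?expr1 // (@bez_shift 2) ?rVpoly_R2 //.
  rewrite EW EY1 EY2 !map_mxM !scalemxAl -!mulmxDl; congr (_ *m _).
  rewrite -[W]hsubmxK !map_row_mx !scale_row_mx !add_row_mx; congr row_mx.
  by apply/matrixP => i j; rewrite !mxE !rmorph_nat !mulr_natr addrC addrA addrAC.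
rewrite psi_Mmat /U -mulmxA mul_block_col !mul0mx mul1mx addr0 add0r top.
rewrite mul_block_col mul1mx mul0mx mul1mx add0r.
have aE : map_mx C a = row_mx 0 1%:M *m map_mx C Emx.
  by rewrite /Emx map_col_mx mul_row_col mul0mx mul1mx add0r.
rewrite {1}aE mulmxA -mulmxDl {1}aE -mul_col_mx; congr (_ *m _).
by rewrite mul_mx_row mulmx0 mulmx1 add_row_mx addr0 subrr.
Qed.

End Reduction.
End Length.

Lemma card_bmultinom2 N : #|{: 'X_{1..2 < N}}| = 'C(N.+1, 2).
Proof.
pose f (u : 'X_{1..2 < N}) : 'I_N * 'I_N :=
  let H := bmdeg u in
  (Ordinal (leq_ltn_trans (leq_trans (leq_addr _ _) (eq_leq (esym (mdeg_mk (bmnm u 0%R) (bmnm u 1%R)))))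
     (eq_ind _ (fun w => (mdeg w < N)%N) H _ (mk_eta u))),
   Ordinal (leq_ltn_trans (leq_trans (leq_addl _ _) (eq_leq (esym (mdeg_mk (bmnm u 0%R) (bmnm u 1%R)))))
     (eq_ind _ (fun w => (mdeg w < N)%N) H _ (mk_eta u)))).
have finj : injective f.
  move=> u v [e0 e1]; apply: val_inj; rewrite /= (mk_eta (bmnm u)) (mk_eta (bmnm v)).
  by rewrite e0 e1.
have S (p : 'I_N * 'I_N) : (p \in codom f) = (p.1 + p.2 < N)%N.
  apply/codomP/idP => [[u ->] /=|pN].
    by rewrite -mdeg_mk -mk_eta bmdeg.
  have H : (mdeg (mk p.1 p.2) < N)%N by rewrite mdeg_mk.
  exists (BMultinom H); apply/eqP; rewrite -pair_eqE /= -!val_eqE /= mk0 mk1.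
  by rewrite !eqxx.
rewrite -(card_codom finj) (eq_card S) -sum1_card.
rewrite (eq_bigl (fun p : 'I_N * 'I_N => true && (p.1 + p.2 < N)%N)) //.
rewrite -(pair_big_dep xpredT (fun x y : 'I_N => (x + y < N)%N) (fun _ _ => 1%N)) /=.
have inner (x : 'I_N) : (\sum_(y < N | (x + y < N)%N) 1 = N - x)%N.
  rewrite -(big_mkord (fun y => (x + y < N)%N) (fun=> 1%N)).
  rewrite (@big_cat_nat _ _ _ (N - x)) ?leq_subr //=.
  rewrite [X in (_ + X)%N]big_nat_cond [X in (_ + X)%N]big1 => [|y]; last by lia.
  rewrite addn0 big_nat_cond (eq_bigl (fun y => (0 <= y < N - x)%N)) => [|y]; last first.
    by apply/idP/idP; lia.
  by rewrite -big_nat sum_nat_const_nat subn0 muln1.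
under eq_bigr do rewrite inner.
rewrite -bin2_sum big_mkord big_ord_recl add0n.
rewrite (reindex_inj rev_ord_inj); apply: eq_bigr => i _ /=.
by rewrite /bump /= add1n subKn.
Qed.

(** * Zeros of ideals of finite codimension *)

Section Nullstellensatz.
Variables (K : closedFieldType) (m : nat).
Local Notation A := {mpoly K[m.+1]}.

Definition is_ideal (J : A -> Prop) :=
  [/\ J 0, forall p q, J p -> J q -> J (p + q) & forall q p, J p -> J (q * p)].

(** If adding x - r gave the unit ideal for every r, the factors x - r could be cancelled one by one
    from u(x) in [J], leaving 1 in [J]. *)
Lemma ideal_addvar (J : A -> Prop) (x : A) (u : {poly K}) : is_ideal J -> ~ J 1 ->
  u != 0 -> J (map_poly (@mpolyC m.+1 K) u).[x] ->
  exists (r : K) (J' : A -> Prop),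
    [/\ is_ideal J', ~ J' 1, forall p, J p -> J' p & J' (x - r%:MP)].
Proof.
move=> [J0 JD JM] J1 u0 Jux; apply: NNPP => H; apply: J1.
pose J' r p := exists j q, J j /\ p = j + q * (x - r%:MP).
have all1 r : J' r 1.
  apply: NNPP => n1; apply: H; exists r, (J' r); split=> //.
  - split; first by exists 0, 0; rewrite mul0r addr0.
      move=> _ _ [j [q [Jj ->]]] [j' [q' [Jj' ->]]]; exists (j + j'), (q + q'); split; first exact: JD.
      by rewrite mulrDl addrACA.
    move=> p _ [j [q [Jj ->]]]; exists (p * j), (p * q); split; first exact: JM.
    by rewrite mulrDr mulrA.
  - by move=> p Jp; exists p, 0; rewrite mul0r addr0.
  - by exists 0, 1; rewrite mul1r add0r.
have [rs Eu] := closed_field_poly_normal u.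
have lc0 : lead_coef u != 0 by rewrite lead_coef_eq0.
have : J (\prod_(r <- rs) (x - r%:MP)).
  have -> : \prod_(r <- rs) (x - r%:MP) = (lead_coef u)^-1%:MP * (map_poly (@mpolyC m.+1 K) u).[x].
    rewrite {2}Eu map_polyZ hornerZ /= mulrA -mpolyCM mulVf // mpolyC1 mul1r.
    rewrite rmorph_prod horner_prod; apply: eq_bigr => r _.
    by rewrite rmorphB /= map_polyX map_polyC !hornerE.
  exact: JM.
elim: rs {Eu} => [|r rs IH]; first by rewrite big_nil.
rewrite big_cons => JP; apply: IH.
have [j [q [Jj E]]] := all1 r.
set P := \prod_(_ <- _) _ in JP *.
have -> : P = P * j + q * ((x - r%:MP) * P) by rewrite mulrA [P * j]mulrC -mulrDl -E mul1r.
by apply: JD; apply: JM.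
Qed.

(** The variables are specialized one at a time, keeping the ideal proper; in the end every
    polynomial is congruent to its value at [v]. *)
Lemma finite_ideal_zero (J : A -> Prop) : is_ideal J -> ~ J 1 ->
  (forall x : A, exists2 u : {poly K}, u != 0 & J (map_poly (@mpolyC m.+1 K) u).[x]) ->
  exists v : 'rV[K]_m.+1, forall F, J F -> hval F v = 0.
Proof.
move=> idJ J1 fin.
have step (s : seq 'I_m.+1) : exists (v : 'I_m.+1 -> K) (J' : A -> Prop),
    [/\ is_ideal J', ~ J' 1, forall p, J p -> J' p & forall i, i \in s -> J' ('X_i - (v i)%:MP)].
  elim: s => [|i s [v [J' [idJ' J'1 JJ' Hs]]]]; first by exists (fun=> 0), J.
  have [u u0 Ju] := fin 'X_i.
  have [r [J'' [idJ'' J''1 J'J'' Jr]]] := ideal_addvar idJ' J'1 u0 (JJ' _ Ju).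
  exists (fun j => if j == i then r else v j), J''; split=> //.
    by move=> p /JJ'/J'J''.
  move=> j; rewrite inE; case: eqP => [-> //|_ /= js].
  by apply: J'J''; exact: Hs.
have [v [J' [[J'0 J'D J'M] J'1 JJ' Hv]]] := step (enum 'I_m.+1).
exists (\row_i v i) => F /JJ' J'F.
have congM p q (x y : K) : J' (p - x%:MP) -> J' (q - y%:MP) -> J' (p * q - (x * y)%:MP).
  move=> hp hq; have -> : p * q - (x * y)%:MP = q * (p - x%:MP) + x%:MP * (q - y%:MP).
    by rewrite mpolyCM; ring.
  by apply: J'D; apply: J'M.
have cong G : J' (G - (hval G (\row_i v i))%:MP).
  rewrite [G]mpolyE; apply: (big_ind (fun p => J' (p - (hval p (\row_i v i))%:MP))).
  - by rewrite /hval meval0 mpolyC0 subr0.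
  - by move=> p q hp hq; rewrite /hval mevalD mpolyCD opprD addrACA; apply: J'D.
  move=> u _; rewrite /hval -mul_mpolyC mevalM mevalC; apply: (@congM); first by rewrite subrr.
  rewrite mevalX mpolyXE_id.
  apply: (big_ind2 (fun p (x : K) => J' (p - x%:MP))) => [|p1 x1 p2 x2 h1 h2|i _].
  - by rewrite mpolyC1 subrr.
  - exact: congM.
  rewrite mxE; elim: (u i) => [|e IH]; first by rewrite !expr0 mpolyC1 subrr.
  by rewrite !exprS; apply: (@congM) => //; apply: Hv; rewrite mem_enum.
apply/eqP; apply/negPn/negP => F0; apply: J'1.
have -> : 1 = ((hval F (\row_i v i))^-1)%:MP * (F - (F - (hval F (\row_i v i))%:MP)).
  by rewrite subKr -mpolyCM mulVf // mpolyC1.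
by apply: (J'M); apply: J'D => //; rewrite -mulN1r; apply: J'M.
Qed.

(** Uniqueness of coordinates keeps 1 out of the ideal when N > 0, and the N + 1 powers x^0, ...,
    x^N are dependent modulo it. *)
Lemma quot_dim_zero (S : A -> Prop) N : quot_dim (ideal_gen S) N -> (0 < N)%N ->
  exists v : 'rV[K]_m.+1, forall F, S F -> hval F v = 0.
Proof.
case=> b Hb N0; set J := ideal_gen S.
have idJ : is_ideal J.
  split; [exact: ideal_gen0|exact: ideal_genD|exact: ideal_genMl].
have J1 : ~ J 1.
  move=> J1; have all p : J p by rewrite -[p]mulr1; apply: ideal_genMl.
  have [c [_ uc]] := Hb 0; have := uc 0 (all _); rewrite (uc (const_mx 1) (all _)).
  by move/rowP/(_ (Ordinal N0)); rewrite !mxE => /eqP; rewrite oner_eq0.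
have fin (x : A) : exists2 u : {poly K}, u != 0 & J (map_poly (@mpolyC m.+1 K) u).[x].
  have /fin_all_exists[c Hc] : forall k : 'I_N.+1, exists c : 'rV[K]_N, J (x ^+ k - \sum_(i < N) c 0 i *: b i).
    by move=> k; have [c [Hc _]] := Hb (x ^+ k); exists c.
  pose M : 'M[K]_(N.+1, N) := \matrix_k c k.
  have : kermx M != 0.
    by rewrite -mxrank_eq0 mxrank_ker subn_eq0 -ltnNge ltnS rank_leq_col.
  case/rowV0Pn => w /sub_kermxP wM w0.
  exists (rVpoly w); first by rewrite rVpoly_eq0.
  have -> : (map_poly (@mpolyC m.+1 K) (rVpoly w)).[x] =
      \sum_(k < N.+1) (w 0 k)%:MP * (x ^+ k - \sum_(i < N) c k 0 i *: b i).
    rewrite (@horner_coef_wide _ N.+1); last first.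
      by apply: leq_trans (size_poly _ _) _; exact: size_poly.
    under [RHS]eq_bigr do rewrite mulrBr.
    rewrite sumrB [X in _ - X](_ : _ = 0) ?subr0.
      by apply: eq_bigr => k _; rewrite coef_map /= coef_rVpoly_ord.
    under eq_bigr do rewrite mulr_sumr.
    rewrite exchange_big big1 // => i _.
    have /rowP/(_ i) := wM; rewrite !mxE => wi.
    transitivity ((\sum_(k < N.+1) w 0 k * c k 0 i) *: b i).
      by rewrite scaler_suml; apply: eq_bigr => k _; rewrite mul_mpolyC scalerA.
    rewrite (_ : \sum_(k < N.+1) _ = 0) ?scale0r // -[RHS]wi.
    by apply: eq_bigr => k _; rewrite mxE.
  by apply: ideal_gen_sum => k _; apply: ideal_genMl; exact: Hc.
have [v Hv] := finite_ideal_zero idJ J1 fin.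
by exists v => F SF; apply: Hv; apply: ideal_gen_mem.
Qed.

End Nullstellensatz.

(** * The coordinate ring of X_2 in the chart *)

Section X2Length.
Variables (K : closedFieldType) (n : nat) (a : 'M[K]_(3, n.+1)).
Hypothesis charK0 : [pchar K] =i pred0.
Hypothesis n_gt2 : (2 < n)%N.
Hypothesis a_proper : proper_param a.
Local Notation A := {mpoly K[2]}.
Local Notation N := (n - 2)%N.

Lemma psi_rho c (p : A) : psi c (rho c p) = p.
Proof.
have X i : psi c (rho c 'X_i) = 'X_i.
  have psiX j : psi c 'X_j = (R0 K 0 j)%:MP + R1 c 0 j *: 'X_0 + R2 c 0 j *: 'X_1.
    by rewrite /psi mmapX mmap1U.
  have z2 : psi c 'X_2%:R = 'X_1.
    by rewrite psiX !mxE /= mpolyC0 scale0r scale1r !add0r.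
  rewrite /rho mmapX mmap1U; case: (unliftP 0 i) => [j ->|->] /=.
    by rewrite z2; congr 'X__; apply: val_inj; rewrite /= ord1.
  rewrite rmorphD /= -mul_mpolyC rmorphM /= z2 /psi mmapC -/(psi c _) psiX !mxE /=.
  by rewrite mpolyC0 add0r scale1r mul_mpolyC scaleNr subrK.
have C (e : K) : psi c (rho c e%:MP) = e%:MP by rewrite /rho mmapC /psi mmapC.
pose f : {rmorphism A -> A} := psi c \o rho c.
rewrite -[LHS]/(f p) [in LHS](mpolyE p) [RHS]mpolyE (raddf_sum f).
apply: eq_bigr => u _; rewrite -mul_mpolyC [LHS](rmorphM f) [f _%:MP]C; congr (_ * _).
rewrite mpolyXE_id [LHS](rmorph_prod f); apply: eq_bigr => i _.
by rewrite [LHS](rmorphXn f) [f _]X.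
Qed.

(** [psi] is surjective, with section [rho], and its kernel is generated by
    [lin_form (evl c) - 1]. *)
Lemma chart_ideal c p :
  ideal_gen (fun p => Xideal a p \/ p = lin_form (evl c) - 1) p <->
  ideal_gen (minor (n - 2 + 3) (map_mx (psi c) (Mmat a 2))) (psi c p).
Proof.
split.
  case=> r [d [g [Sg ->]]]; rewrite rmorph_sum; apply: ideal_gen_sum => i _.
  rewrite /= rmorphM; apply: ideal_genMl; case: (Sg i) => [[r' [d' [g' [Sg' ->]]]]|->].
    rewrite rmorph_sum; apply: ideal_gen_sum => j _; rewrite /= rmorphM; apply: ideal_genMl.
    apply: ideal_gen_mem; have [f [f' [hf hf' ->]]] := Sg' j; exists f, f'; split=> //.
    by rewrite -map_mxsub det_map_mx.
  by rewrite rmorphB rmorph1 /= psi_evl subrr; exact: ideal_gen0.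
case=> r [d [g [Sg E]]].
have {}Sg i : exists2 m', minor (n - 2 + 3) (Mmat a 2) m' & g i = psi c m'.
  have [f [f' [hf hf' ->]]] := Sg i.
  exists (\det (mxsub f f' (Mmat a 2))); first by exists f, f'.
  by rewrite -map_mxsub det_map_mx.
have /fin_all_exists2[m' Sm' gE] := Sg.
pose p' := \sum_(i < r) rho c (d i) * m' i.
have [h Eh] := rho_psi c (p - p').
have pp' : psi c (p - p') = 0.
  rewrite rmorphB /= E /p' rmorph_sum -sumrB big1 // => i _.
  by rewrite /= rmorphM /= psi_rho gE subrr.
rewrite pp' rmorph0 add0r in Eh.
rewrite -[p](subrK p') Eh; apply: ideal_genD.
  by apply: ideal_genMl; apply: ideal_gen_mem; right.
apply: ideal_gen_sum => i _; apply: ideal_genMl; apply: ideal_gen_mem; left.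
exact: ideal_gen_mem.
Qed.

(** The monomials of degree below [N], lifted by [rho], form the basis: [minors_span] gives the
    coordinates and [minors_low] their uniqueness. *)
Lemma X2_quot_dim : exists c : K,
  (forall v, zeros (@Xideal K n a 2) v -> hval (lin_form (evl c)) v != 0) /\
  quot_dim (ideal_gen (fun p => Xideal a p \/ p = lin_form (evl c) - 1)) 'C(n.-1, 2).
Proof.
have [c [l1 [l2 [g [h [ann [E1 E2] cop se noX]]]]]] := smooth_point charK0 n_gt2 a_proper.
exists c; split=> [v Xv|]; first by rewrite hval_lin_form lf_evl; exact: noX.
have [Cm red] := reduction n_gt2 ann E1 E2 cop se.
have cE : #|{: 'X_{1..2 < N}}| = 'C(n.-1, 2).
  by rewrite card_bmultinom2; congr 'C(_, _); lia.
pose u (i : 'I_('C(n.-1, 2))) : 'X_{1..2 < N} := enum_val (cast_ord (esym cE) i).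
have ubij : bijective u.
  exists (fun w => cast_ord cE (enum_rank w)) => [i|w]; rewrite /u.
    by rewrite enum_valK cast_ordKV.
  by rewrite cast_ordK enum_rankK.
exists (fun i => rho c 'X_[u i]) => p.
have inJ q := iff_trans (chart_ideal c q) (red (psi c q)).
have psiS (e : 'rV[K]_('C(n.-1, 2))) :
    psi c (\sum_i e 0 i *: rho c 'X_[u i]) = \sum_i e 0 i *: 'X_[u i].
  rewrite rmorph_sum; apply: eq_bigr => i _ /=.
  by rewrite -!mul_mpolyC rmorphM /= psi_rho /psi mmapC.
have [q [v [sq Eq]]] := minors_span Cm (psi c p).
exists (\row_i q@_(u i)); split.
  apply/inJ; exists v; rewrite rmorphB /= psiS Eq [X in X + _ - _](mpolywE sq).
  rewrite (reindex u) /=; last exact: onW_bij.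
  by under [X in _ - X]eq_bigr do rewrite mxE; rewrite addrAC subrr add0r.
move=> e /inJ[w Ew].
have low : \sum_i (q@_(u i) - e 0 i) *: 'X_[u i] = 0 :> A.
  have E : \sum_i (q@_(u i) - e 0 i) *: 'X_[u i] = \sum_i (w i - v i) * cof (Lmx Cm) i.
    under [RHS]eq_bigr do rewrite mulrBl.
    rewrite sumrB -Ew rmorphB /= psiS Eq [in RHS](mpolywE sq).
    rewrite (reindex u) /=; last exact: onW_bij.
    under eq_bigr do rewrite scalerBl.
    by rewrite sumrB addrAC addrK.
  rewrite E; apply: minors_low; rewrite -E.
  apply: msize_sum_le => i _; apply: leq_trans (msizeZ_le _ _) _.
  by rewrite msizeX bmdeg.
apply/rowP => i; rewrite mxE; apply/eqP; rewrite -subr_eq0; apply/eqP.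
have := congr1 (mcoeff (u i)) low; rewrite mcoeff0 raddf_sum (bigD1 i) //= mcoeffZ mcoeffX eqxx mulr1.
rewrite big1 ?addr0 // => j ji; rewrite mcoeffZ mcoeffX.
case: eqP => [/val_inj/(bij_inj ubij) e'|]; last by rewrite mulr0.
by rewrite e' eqxx in ji.
Qed.

Lemma X2_nonempty : nonempty (@Xpts K n a 2).
Proof.
have [c [_ qd]] := X2_quot_dim.
have [|v Hv] := quot_dim_zero qd; first by rewrite bin_gt0; lia.
(* The equation of the chart keeps the zero [v] from being the zero vector. *)
have lv : hval (lin_form (evl c)) v = 1.
  have := Hv (lin_form (evl c) - 1) (or_intror erefl).
  by rewrite /hval mevalB meval1 => /eqP; rewrite subr_eq0 => /eqP.
exists v; split; last by move=> F XF; apply: Hv; left.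
apply/negP => /eqP v0; move: lv; rewrite v0 hval_lin_form lfC.
by rewrite -[X in lf X _](scale0r 0) lfZl mul0r => /esym/eqP; rewrite oner_eq0.
Qed.

End X2Length.

Local Close Scope ring_scope.

Theorem proposition2p2 (K : closedFieldType) (charK0 : [pchar K]%R =i pred0)
    (n : nat) (n_ge3 : 3 <= n) (a : 'M[K]_(3, n.+1)) (a_proper : proper_param a) :
  (forall k : nat, 2 <= k <= n.-1 ->
     ~ nonempty (@Xpts K n a k) \/ has_dim (@Xpts K n a k) 0) /\
  (forall k : nat, 2 <= k <= n.-1 ->
     (nonempty (@Xpts K n a k) <->
      exists (P : 'rV[K]_3) (mu : nat),
        [/\ singular_pt (curve a) P, has_mult (curve a) P mu & k <= mu])) /\
  [/\ forall P : 'rV[K]_3, singular_pt (curve a) P ->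
        exists2 R : 'rV[K]_3, @Xpts K n a 2 R & contracted_to a R P,
      scheme_length (@Xideal K n a 2) 'C(n.-1, 2)
    & nonempty (@Xpts K n a 2)].
Proof.
have n_gt1 : (1 < n)%N by exact: ltnW.
have kn k : (2 <= k <= n.-1)%N -> (2 <= k <= n)%N.
  by case/andP=> -> /= kn; apply: leq_trans kn (leq_pred n).
split; [|split; [|split]].
- by move=> k /kn; exact: X_dim0.
- by move=> k /kn; exact: X_nonemptyP.
- exact: singular_contracted.
- by have [c Hc] := X2_quot_dim charK0 n_ge3 a_proper; exists (evl c).
- exact: X2_nonempty.
Qed.
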